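(* Let $E$ be a simple, closed, densely defined, symmetric operator with infinite deficiency indices on a complex separable infinite dimensional Hilbert space $\mathfrak{X}$, let $Y\subseteq\mathfrak{X}$ be a closed infinite dimensional subspace, and let $\Omega\subseteq\mathbb{C}$ be a nonempty open set, symmetric about the real axis, consisting of $Y$-regular points of $E$. Write $\mathfrak{M}_\xi=\mathrm{rng}(E-\xi I)$. Let $G:\mathfrak{X}\to\mathfrak{X}$ be an injective bounded linear operator with $\mathrm{rng}(G)=Y$, and let $\mathcal{H}_3$ and $\mathfrak{D}$ be the reproducing kernel Hilbert space and the operator constructed from $E$, $Y$, $\Omega$, $G$ as defined in the context. Then: (1) $\mathcal{H}_3$ is an $\mathcal{H}_0(U)$ space, with signature operator $J=J_1=\begin{bmatrix}0&I\\ I&0\end{bmatrix}$ on $\mathfrak{X}\oplus\mathfrak{X}$. (2) If there exists at least one $\alpha\in\Omega\cap\mathbb{C}_+$ such that (i) $\dim(\mathfrak{M}_\alpha\cap\mathfrak{M}_\omega^\perp)<\infty$ and $\mathfrak{M}_\alpha+\mathfrak{M}_\omega^\perp$ is closed for all $\omega\in\Omega\cap\mathbb{C}_-$, and (ii) $\dim(\mathfrak{M}_{\bar\alpha}\cap\mathfrak{M}_\omega^\perp)<\infty$ and $\mathfrak{M}_{\bar\alpha}+\mathfrak{M}_\omega^\perp$ is closed for all $\omega\in\Omega\cap\mathbb{C}_+$, then the operator $E$ on $\mathfrak{X}$ is unitarily equivalent to the operator $\mathfrak{D}$ on the de Branges space $\mathcal{H}_3$.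
   Context: $\mathbb{C}_+,\mathbb{C}_-$ are the open upper and lower half planes; $B(\mathfrak{K})$ is the space of bounded linear operators on a Hilbert space $\mathfrak{K}$. A symmetric operator $E$ is simple if it has no nonzero reducing subspace on which it is self-adjoint (equivalently $\bigcap_{\xi\in\mathbb{C}\setminus\mathbb{R}}\mathrm{rng}(E-\xi I)=\{0\}$). For a closed subspace $Y$ of $\mathfrak{X}$, a point $\xi\in\mathbb{C}$ is $Y$-regular for $E$ if $\mathfrak{M}_\xi$ is closed and $\mathfrak{X}=\mathfrak{M}_\xi\dotplus Y$ (direct sum). Every $Y$-regular point is a point of regular type of $E$, i.e. there is $c_\xi>0$ with $\|(E-\xi I)g\|\ge c_\xi\|g\|$ for all $g\in\mathcal{D}(E)$. For $\xi\in\Omega$, $P_Y(\xi)\in B(\mathfrak{X})$ is the projection onto $Y$ along $\mathfrak{M}_\xi$, and $\tau_Y(\xi)f=(E-\xi I)^{-1}(I-P_Y(\xi))f$; thus $f=(E-\xi I)\tau_Y(\xi)f+P_Y(\xi)f$. Construction of $\mathcal{H}_3$: for $f\in\mathfrak{X}$, $\xi\in\Omega$ put $f_Y(\xi)=G^{-1}P_Y(\xi)f$ and $\tilde f_Y(\xi)=\frac{1}{\pi i}G^*\tau_Y(\xi)f$. Then $\mathcal{H}_3=\left\{\begin{bmatrix}f_Y\\ \tilde f_Y\end{bmatrix}:f\in\mathfrak{X}\right\}$, a space of $\mathfrak{X}\oplus\mathfrak{X}$ valued functions on $\Omega$, with inner product $\left\langle\begin{bmatrix}f_Y\\ \tilde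 f_Y\end{bmatrix},\begin{bmatrix}g_Y\\ \tilde g_Y\end{bmatrix}\right\rangle_{\mathcal{H}_3}=2\langle f,g\rangle_{\mathfrak{X}}$. Operator $\mathfrak{D}$: let $\mathcal{N}=\{f_Y:f\in\mathfrak{X}\}$ with inner product $\langle f_Y,g_Y\rangle_{\mathcal{N}}=\langle f,g\rangle_{\mathfrak{X}}$ (the map $f\mapsto f_Y$ is injective). Under the conditions in (2), $\mathcal{N}$ is a de Branges space of the type $\mathcal{B}(\mathfrak{E})$. Let $T$ be multiplication by the independent variable on $\mathcal{N}$, $(Tf)(\lambda)=\lambda f(\lambda)$, with domain $\mathcal{D}(T)=\{f\in\mathcal{N}:\lambda\mapsto\lambda f(\lambda)\in\mathcal{N}\}$. Let $R_\xi$ be the generalized backward shift, $(R_\xi g)(\lambda)=\frac{g(\lambda)-g(\xi)}{\lambda-\xi}$ for $\lambda\ne\xi$ and $(R_\xi g)(\xi)=g'(\xi)$; it maps $\mathcal{N}$ into $\mathcal{N}$ for $\xi\in\Omega$. For $f_Y\in\mathcal{N}$ let $Zf_Y$ be the $\mathfrak{X}$-valued function on $\Omega$ given by $\langle(Zf_Y)(\xi),l\rangle_{\mathfrak{X}}=\frac{1}{\pi i}\langle R_\xi f_Y,(Gl)_Y\rangle_{\mathcal{N}}$ for all $\xi\in\Omega$, $l\in\mathfrak{X}$. One has $Zf_Y=\tilde f_Y$, and $\mathfrak{D}$ is the operator on $\mathcal{H}_3$ defined by $\mathfrak{D}\begin{bmatrix}f_Y\\ Zf_Y\end{bmatrix}=\begin{bmatrix}Tf_Y\\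 ZTf_Y\end{bmatrix}$ for all $f\in\mathfrak{X}$ with $f_Y\in\mathcal{D}(T)$. $\mathcal{H}(U)$ spaces: let $J$ be a unitary self-adjoint operator on a Hilbert space $\mathfrak{K}$ and $U:\Omega\to B(\mathfrak{K})$ analytic with $U(\lambda)JU(\bar\lambda)^*=J=U(\bar\lambda)^*JU(\lambda)$ for all $\lambda\in\Omega$. Put $K^U_\xi(\lambda)=\frac{J-U(\lambda)JU(\xi)^*}{-2\pi i(\lambda-\bar\xi)}$ if $\lambda\ne\bar\xi$, $K^U_\xi(\bar\xi)=\frac{U'(\bar\xi)JU(\xi)^*}{2\pi i}$. When this kernel is positive on $\Omega\times\Omega$ (i.e. $\sum_{i,j}\langle K^U_{\omega_j}(\omega_i)u_j,u_i\rangle\ge0$ for all finite choices of $\omega_i\in\Omega$, $u_i\in\mathfrak{K}$), $\mathcal{H}(U)$ denotes the unique reproducing kernel Hilbert space of $\mathfrak{K}$-valued analytic functions on $\Omega$ with reproducing kernel $K^U$ (i.e. $K^U_\omega u\in\mathcal{H}(U)$ and $\langle f,K^U_\omega u\rangle_{\mathcal{H}(U)}=\langle f(\omega),u\rangle$ for all $\omega\in\Omega$, $u\in\mathfrak{K}$, $f\in\mathcal{H}(U)$). A space of functions on $\Omega$ is an $\mathcal{H}_0(U)$ space (with signature operator $J$) if it equals $\mathcal{H}(U)$ for some such $U$ for which, for every $\lambda\in\Omega$, the operator $I-U(\lambda)$ is not compact. *)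

(* Defs.v *)
From HB Require Import structures.
From mathcomp Require Import all_boot all_order all_algebra sesquilinear.
From mathcomp Require Import complex ring.
From mathcomp Require Import all_classical all_reals all_analysis.
Set Implicit Arguments.
Unset Strict Implicit.
Unset Printing Implicit Defensive.
Import Order.TTheory GRing.Theory Num.Theory.
Import numFieldNormedType.Exports.

Local Open Scope classical_set_scope.
Local Open Scope ring_scope.

(* The topological structures on the complex field live on the alias R[i]^o;
   R[i] itself is used for scalars. The inner product is linear in its first
   argument and conjugate-linear in the second one. *)

HB.mixin Record CompleteNormedModule_isHilbert (R : realType) (V : Type)
    & CompleteNormedModule R[i] V := {
  hdot : {dot V for (@Num.conj R[i])} ;
  hdot_norm : forall x : V, hdot x x = `|x| ^+ 2 }.

#[short(type="hilbertType")]
HB.structure Definition Hilbert (R : realType) :=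
  {V of CompleteNormedModule R[i] V & CompleteNormedModule_isHilbert R V}.

Notation "''[' u , v ]" := (hdot u v)
  (format "''[' u ,  v ]") : ring_scope.

(* The Hilbert direct sum. It is a copy of the product type because the norm
   which the library puts on X * Y is the maximum of the two norms. *)
Section HilbertSum.
Variables (R : realType) (X Y : hilbertType R).

Definition hsum : Type := (X * Y)%type.
HB.instance Definition _ := GRing.Lmodule.copy hsum (X * Y)%type.

Definition hsum_dot (u v : hsum) : R[i] := '[u.1, v.1] + '[u.2, v.2].
Definition hsum_norm (u : hsum) : R[i] := sqrtC (hsum_dot u u).

Lemma hsum_dotxx u : hsum_dot u u = `|u.1| ^+ 2 + `|u.2| ^+ 2.
Proof. by rewrite /hsum_dot !hdot_norm. Qed.

Lemma hsum_dot_ge0 u : 0 <= hsum_dot u u.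
Proof. by rewrite hsum_dotxx addr_ge0// exprn_ge0. Qed.

Lemma hsum_norm_sqr u : hsum_norm u ^+ 2 = hsum_dot u u.
Proof. exact: sqrtCK. Qed.

Lemma hsum_norm_ge0 u : 0 <= hsum_norm u.
Proof. by rewrite sqrtC_ge0 hsum_dot_ge0. Qed.

Lemma hsum_norm_fst (u : hsum) : `|u.1| <= hsum_norm u.
Proof.
by rewrite -(@ler_pXn2r _ 2)// ?nnegrE ?hsum_norm_ge0// hsum_norm_sqr
  hsum_dotxx lerDl exprn_ge0.
Qed.

Lemma hsum_norm_snd (u : hsum) : `|u.2| <= hsum_norm u.
Proof.
by rewrite -(@ler_pXn2r _ 2)// ?nnegrE ?hsum_norm_ge0// hsum_norm_sqr
  hsum_dotxx lerDr exprn_ge0.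
Qed.

Lemma hsum_norm_le (u : hsum) : hsum_norm u <= `|u.1| + `|u.2|.
Proof.
rewrite -(@ler_pXn2r _ 2)// ?nnegrE ?hsum_norm_ge0 ?addr_ge0// hsum_norm_sqr.
by rewrite hsum_dotxx sqrrD -addrA lerD2l lerDr mulrn_wge0// mulr_ge0.
Qed.

Lemma hsum_ler_normD u v : hsum_norm (u + v) <= hsum_norm u + hsum_norm v.
Proof.
set s := hsum_norm u; set t := hsum_norm v.
have [s0 t0] : 0 <= s /\ 0 <= t by split; exact: hsum_norm_ge0.
rewrite -(@ler_pXn2r _ 2)// ?nnegrE ?hsum_norm_ge0 ?addr_ge0//.
rewrite hsum_norm_sqr hsum_dotxx sqrrD !hsum_norm_sqr !hsum_dotxx/=.
set a := `|u.1|; set b := `|u.2|; set c := `|v.1|; set d := `|v.2|.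
have [a0 b0 c0 d0] : [/\ 0 <= a, 0 <= b, 0 <= c & 0 <= d].
  by split; exact: normr_ge0.
have st : a * c + b * d <= s * t.
  rewrite -(@ler_pXn2r _ 2)// ?nnegrE ?addr_ge0 ?mulr_ge0//.
  rewrite exprMn !hsum_norm_sqr !hsum_dotxx -/a -/b -/c -/d -subr_ge0.
  have -> : (a ^+ 2 + b ^+ 2) * (c ^+ 2 + d ^+ 2) - (a * c + b * d) ^+ 2
            = (a * d - b * c) ^+ 2 by ring.
  by rewrite real_exprn_even_ge0// realB// realM// ger0_real.
apply: (@le_trans _ _ ((a + c) ^+ 2 + (b + d) ^+ 2)).
  by apply: lerD; rewrite ler_pXn2r// ?nnegrE ?addr_ge0//; exact: ler_normD.
have -> : (a + c) ^+ 2 + (b + d) ^+ 2 =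
    a ^+ 2 + b ^+ 2 + (a * c + b * d) *+ 2 + (c ^+ 2 + d ^+ 2) by ring.
by rewrite lerD2r lerD2l lerMn2r.
Qed.

Lemma hsum_normrZ (l : R[i]) (x : hsum) :
  hsum_norm (l *: x) = `|l| * hsum_norm x.
Proof.
rewrite /hsum_norm !hsum_dotxx/= !normrZ !exprMn -mulrDr rootCMl ?exprn_ge0//.
by rewrite sqrCK.
Qed.

Lemma hsum_normr0_eq0 (x : hsum) : hsum_norm x = 0 -> x = 0.
Proof.
move=> x0; case: x x0 => a b x0; congr pair; apply/eqP; rewrite -normr_le0 -x0.
  exact: (hsum_norm_fst (a, b)).
exact: (hsum_norm_snd (a, b)).
Qed.

HB.instance Definition _ := @Lmodule_isNormed.Build R[i] hsum hsum_norm
  hsum_ler_normD hsum_normrZ hsum_normr0_eq0.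

Lemma hsum_normE (u : hsum) : `|u| = hsum_norm u.
Proof. by []. Qed.

Lemma hsum_complete (F : set_system hsum) :
  ProperFilter F -> cauchy F -> cvg F.
Proof.
move=> FF /cauchyP Fc.
have c1 : cauchy (fst @ F : set_system X).
  apply/cauchyP => e /Fc[x Fx]; exists x.1.
  change (F (fst @^-1` ball x.1 e)); apply: filterS Fx => y.
  rewrite /preimage/= -!ball_normE/=; apply: le_lt_trans.
  exact: (hsum_norm_fst (x - y)).
have c2 : cauchy (snd @ F : set_system Y).
  apply/cauchyP => e /Fc[x Fx]; exists x.2.
  change (F (snd @^-1` ball x.2 e)); apply: filterS Fx => y.
  rewrite /preimage/= -!ball_normE/=; apply: le_lt_trans.
  exact: (hsum_norm_snd (x - y)).
have /cvgrPdist_lt l1 : cvg (fst @ F) by exact: cauchy_cvg.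
have /cvgrPdist_lt l2 : cvg (snd @ F) by exact: cauchy_cvg.
apply/cvg_ex; exists (lim (fst @ F), lim (snd @ F)).
apply/cvgrPdist_lt => e e0.
have e20 : 0 < e / 2 by rewrite divr_gt0.
have h1 : \forall u \near F, `|lim (fst @ F) - fst u| < e / 2 := l1 _ e20.
have h2 : \forall u \near F, `|lim (snd @ F) - snd u| < e / 2 := l2 _ e20.
near=> u; rewrite hsum_normE; apply: le_lt_trans (hsum_norm_le _) _.
rewrite (splitr e) ltrD//=.
  by near: u.
by near: u.
Unshelve. all: by end_near. Qed.

HB.instance Definition _ := Uniform_isComplete.Build hsum hsum_complete.

Lemma hsum_dot_bilinear : bilinear_for
  (GRing.Scale.Law.clone _ _ ( *%R ) _)
  (GRing.Scale.Law.clone _ _ (Num.conj \; *%R) _) hsum_dot.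
Proof.
split=> [v|u] a x y; rewrite /hsum_dot/=.
- by rewrite !linearPl/= mulrDr addrACA.
- by rewrite !linearPr/= mulrDr addrACA.
Qed.

HB.instance Definition _ :=
  bilinear_isBilinear.Build R[i] hsum hsum R[i] _ _ hsum_dot hsum_dot_bilinear.

Lemma hsum_dot_hermitian u v :
  hsum_dot u v = (-1) ^+ false * (hsum_dot v u)^*.
Proof.
rewrite expr0 mul1r /hsum_dot rmorphD/=; congr (_ + _).
  by have := hermC hdot u.1 v.1; rewrite expr0 mul1r.
by have := hermC hdot u.2 v.2; rewrite expr0 mul1r.
Qed.

HB.instance Definition _ :=
  isHermitianSesquilinear.Build R[i] hsum false Num.conj hsum_dot
    hsum_dot_hermitian.

Lemma hsum_dot_gt0 u : u != 0 -> 0 < hsum_dot u u.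
Proof.
move=> u0; rewrite lt0r hsum_dot_ge0 andbT; apply: contra u0 => /eqP u0.
by apply/eqP/hsum_normr0_eq0; rewrite /hsum_norm u0 sqrtC0.
Qed.

HB.instance Definition _ := isDotProduct.Build R[i] hsum hsum_dot hsum_dot_gt0.

Lemma hsum_dot_norm u : hsum_dot u u = `|u| ^+ 2.
Proof. by rewrite hsum_normE hsum_norm_sqr. Qed.

HB.instance Definition _ :=
  CompleteNormedModule_isHilbert.Build R hsum hsum_dot_norm.

End HilbertSum.

Section Operators.
Variables (R : realType) (X : hilbertType R).

Definition linear_subspace (S : set X) : Prop :=
  S 0 /\ forall (a : R[i]) u v, S u -> S v -> S (a *: u + v).

Definition finite_dim (S : set X) : Prop :=
  exists n (e : 'I_n -> X), (forall i, S (e i)) /\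
    forall v, S v -> exists a : 'I_n -> R[i], v = \sum_(i < n) a i *: e i.

Definition orthc (S : set X) : set X :=
  [set v | forall u, S u -> '[u, v] = 0].

Definition set_add (A B : set X) : set X :=
  [set w | exists u v, [/\ A u, B v & w = u + v]].

Definition separable_space : Prop := exists A : set X, countable A /\ dense A.

Definition direct_sum (A B : set X) : Prop :=
  set_add A B = setT /\ A `&` B = [set 0].

Definition bounded_op (T : X -> X) : Prop := linear T /\ continuous T.

(* The Hilbert space adjoint of a bounded operator. *)
Definition adjoint (T : X -> X) (y : X) : X :=
  xget 0 [set z | forall x, '[T x, y] = '[x, z]].

Definition compact_op (T : X -> X) : Prop :=
  precompact (T @` [set x | `|x| <= 1]).

End Operators.

(* A possibly unbounded operator: its values outside of its domain are
   irrelevant. *)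
Record operator (U V : Type) := Operator { dom : set U ; op_fun :> U -> V }.

Section UnboundedOperators.
Variables (R : realType) (X : hilbertType R).
Local Notation C := (R[i])^o.
Implicit Types (E : operator X X) (xi : C) (Y L : set X).

Definition linear_op E : Prop :=
  linear_subspace (dom E) /\
  forall (a : R[i]) u v, dom E u -> dom E v -> E (a *: u + v) = a *: E u + E v.

Definition closed_op E : Prop :=
  closed [set p : X * X | dom E p.1 /\ p.2 = E p.1].

Definition symmetric_op E : Prop :=
  forall f g, dom E f -> dom E g -> '[E f, g] = '[f, E g].

Definition op_rng E xi : set X := [set E g - xi *: g | g in dom E].

Definition reducing E L : Prop :=
  [/\ linear_subspace L, closed L &
    forall g, dom E g -> exists u v,
      [/\ g = u + v, L u /\ dom E u, orthc L v /\ dom E v,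
          L (E u) & orthc L (E v)]].

(* The restriction of E to L, as an operator in the Hilbert space L, is densely
   defined and coincides with its adjoint. *)
Definition selfadjoint_on E L : Prop :=
  L `<=` closure (dom E `&` L) /\
  forall y z, L y -> L z ->
    ((forall x, dom E x -> L x -> '[E x, y] = '[x, z]) <->
     (dom E y /\ E y = z)).

Definition simple_op E : Prop :=
  forall L, reducing E L -> selfadjoint_on E L -> L = [set 0].

(* The deficiency indices of E are the dimensions of the orthogonal complements
   of the ranges of E - i I and E + i I. *)
Definition infinite_deficiency E : Prop :=
  ~ finite_dim (orthc (op_rng E 'i)) /\ ~ finite_dim (orthc (op_rng E (- 'i))).

(* xi is a Y-regular point of E. *)
Definition regular_point E Y xi : Prop :=
  closed (op_rng E xi) /\ direct_sum (op_rng E xi) Y.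

(* P_Y(xi): the projection onto Y along the range of E - xi I. *)
Definition proj_along E Y xi (f : X) : X :=
  xget 0 [set y | Y y /\ op_rng E xi (f - y)].

(* (E - xi I)^-1 (I - P_Y(xi)) *)
Definition tauY E Y xi (f : X) : X :=
  xget 0 [set g | dom E g /\ E g - xi *: g = f - proj_along E Y xi f].

End UnboundedOperators.

Record fun_space (R : realType) (T V : Type) := FunSpace {
  fcar : set (T -> V) ;
  fdot : (T -> V) -> (T -> V) -> R[i] }.

Section FunctionSpaces.
Variables (R : realType) (T : Type) (K : hilbertType R).
Implicit Type H : fun_space R T K.

(* The image of an injective map Phi, with <Phi f, Phi g> = c <f, g>. *)
Definition image_space (X : hilbertType R) (c : R[i]) (Phi : X -> T -> K) :
    fun_space R T K :=
  FunSpace (range Phi) (fun F G =>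
    c * '[xget 0 [set f | Phi f = F], xget 0 [set g | Phi g = G]]).

Definition fnorm H (F : T -> K) : R[i] := sqrtC (fdot H F F).

Definition is_hilbert H : Prop :=
  [/\ fcar H 0 /\ (forall (a : R[i]) F G,
        fcar H F -> fcar H G -> fcar H (a *: F + G)),
      forall (a : R[i]) F G L, fcar H F -> fcar H G -> fcar H L ->
        fdot H (a *: F + G) L = a * fdot H F L + fdot H G L,
      forall F G, fcar H F -> fcar H G -> fdot H F G = (fdot H G F)^*,
      forall F, fcar H F -> F <> 0 -> 0 < fdot H F F &
      forall u : nat -> T -> K, (forall n, fcar H (u n)) ->
        (forall e : R[i], 0 < e -> exists N, forall m n, (N <= m)%N ->
           (N <= n)%N -> fnorm H (u m - u n) < e) ->
        exists2 F, fcar H F & forall e : R[i], 0 < e ->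
          exists N, forall n, (N <= n)%N -> fnorm H (u n - F) < e].

(* E and D are unitarily equivalent: V is a unitary map from X onto H, it maps
   the domain of E onto the domain of D, and V E = D V. *)
Definition unitarily_equivalent (X : hilbertType R) (E : operator X X)
    H (D : operator (T -> K) (T -> K)) : Prop :=
  exists V : X -> T -> K,
    [/\ linear V, range V = fcar H,
        forall x y, fdot H (V x) (V y) = '[x, y],
        V @` dom E = dom D &
        forall x, dom E x -> V (E x) = D (V x)].

End FunctionSpaces.

Section HUSpaces.
Variables (R : realType) (K : hilbertType R).
Local Notation C := (R[i])^o.
Variables (Omega : set C) (J : K -> K).
Implicit Types (U : C -> K -> K) (H : fun_space R Omega K).

Definition analytic_fun (F : Omega -> K) : Prop :=
  forall z : C, Omega z -> derivable ('valL_0 F : C -> K) z 1.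

(* The complex derivative with respect to the operator norm. *)
Definition is_op_derive U (z : C) (L : K -> K) : Prop :=
  bounded_op L /\
  forall e : R[i], 0 < e -> \forall h \near (0 : C)^',
    forall u, `|h^-1 *: (U (h + z) u - U z u) - L u| <= e * `|u|.

Definition op_derive U (z : C) : K -> K :=
  xget (fun=> 0) [set L | is_op_derive U z L].

Definition signature_op : Prop :=
  [/\ bounded_op J, adjoint J =1 J,
      forall u, adjoint J (J u) = u & forall u, J (adjoint J u) = u].

Definition J_unitary U : Prop :=
  forall z u, Omega z ->
    U z (J (adjoint (U z^*) u)) = J u /\ adjoint (U z^*) (J (U z u)) = J u.

Definition kernelU U (xi z : C) (u : K) : K :=
  if z == xi^* then
    (2 * (pi : R)%:C%C * 'i)^-1 *: op_derive U xi^* (J (adjoint (U xi) u))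
  else
    (- 2 * (pi : R)%:C%C * 'i * (z - xi^*))^-1 *:
      (J u - U z (J (adjoint (U xi) u))).

Definition positive_kernel (k : C -> C -> K -> K) : Prop :=
  forall n (w : 'I_n -> C) (u : 'I_n -> K), (forall i, Omega (w i)) ->
    0 <= \sum_(i < n) \sum_(j < n) '[k (w j) (w i) (u j), u i].

Definition section_fun (k : C -> C -> K -> K) (w : C) (u : K) : Omega -> K :=
  fun z => k w (\val z) u.

Definition is_RKHS (k : C -> C -> K -> K) H : Prop :=
  [/\ is_hilbert H,
      forall F, fcar H F -> analytic_fun F,
      forall (w : Omega) u, fcar H (section_fun k (\val w) u) &
      forall F (w : Omega) u, fcar H F ->
        fdot H F (section_fun k (\val w) u) = '[F w, u]].

Definition is_HU U H : Prop :=
  [/\ signature_op,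
      (forall z, Omega z -> bounded_op (U z)) /\
      (forall z, Omega z -> exists L, is_op_derive U z L),
      J_unitary U, positive_kernel (kernelU U) & is_RKHS (kernelU U) H].

Definition is_H0U H : Prop :=
  exists2 U, is_HU U H &
    forall z, Omega z -> ~ compact_op (fun u => u - U z u).

End HUSpaces.

Section Model.
Variables (R : realType) (X : hilbertType R).
Local Notation C := (R[i])^o.
Variables (E : operator X X) (Y : set X) (Omega : set C) (G : X -> X).

(* The inverse of the injective map G on its range. *)
Definition Ginv (y : X) : X := xget 0 [set x | G x = y].

Definition fY (f : X) : Omega -> X :=
  fun xi => Ginv (proj_along E Y (\val xi) f).

Definition ftilde (f : X) : Omega -> X :=
  fun xi => ((pi : R)%:C%C * 'i)^-1 *: adjoint G (tauY E Y (\val xi) f).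

Definition column (F1 F2 : Omega -> X) : Omega -> hsum X X :=
  fun xi => (F1 xi, F2 xi).

Definition H3 : fun_space R Omega (hsum X X) :=
  image_space 2 (fun f => column (fY f) (ftilde f)).

Definition spaceN : fun_space R Omega X := image_space 1 fY.

Definition mulT (F : Omega -> X) : Omega -> X := fun z => \val z *: F z.

Definition domT : set (Omega -> X) :=
  [set F | fcar spaceN F /\ fcar spaceN (mulT F)].

(* The generalized backward shift R_xi; 'valL_0 extends a function on Omega by 0
   outside of the open set Omega. *)
Definition bshift (xi : Omega) (g : Omega -> X) : Omega -> X :=
  fun z => if \val z == \val xi then 'D_1 ('valL_0 g : C -> X) (\val xi)
           else (\val z - \val xi)^-1 *: (g z - g xi).

Definition opZ (F : Omega -> X) : Omega -> X :=
  fun xi => xget 0 [set v | forall l,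
    '[v, l] = ((pi : R)%:C%C * 'i)^-1 * fdot spaceN (bshift xi F) (fY (G l))].

(* The operator [f_Y; Z f_Y] |-> [T f_Y; Z T f_Y]; the first component of its
   argument is f_Y. *)
Definition opD : operator (Omega -> hsum X X) (Omega -> hsum X X) :=
  Operator
    [set F | exists f, domT (fY f) /\ F = column (fY f) (opZ (fY f))]
    (fun F => let F1 := fun xi => (F xi).1 in column (mulT F1) (opZ (mulT F1))).

End Model.

Definition J1 (R : realType) (X : hilbertType R) (u : hsum X X) : hsum X X :=
  (u.2, u.1).

(* Main.v *)
Require Import Defs.
From HB Require Import structures.
From mathcomp Require Import all_boot all_order all_algebra sesquilinear.
From mathcomp Require Import complex ring lra.
From mathcomp Require Import all_classical all_reals all_analysis.
Set Implicit Arguments.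
Unset Strict Implicit.
Unset Printing Implicit Defensive.
Import Order.TTheory GRing.Theory Num.Theory.
Import numFieldNormedType.Exports.
Local Open Scope classical_set_scope.
Local Open Scope ring_scope.

(** Put k = pi i, let z' be the conjugate of z, and write
    Gamma(z) = (G^{-1} P_Y(z); k^{-1} G^* tau_Y(z)) and
    N(z, w) = J + k (z - w') Gamma(z) Gamma(w)^*. The resolvent-type identity
    Gamma(z) - Gamma(w) = (z - w) Gamma(z) tau_Y(w), together with the symmetry of
    E, gives N(z, m) J N(m', w) = N(z, w), where N(z, z') = J. Hence, for b in
    Omega with Im b > 0, M = N(b, b) has the inverse J N(b', b') J. The upper left
    block of -M and the lower right block of M^{-1} are positive and invertible,
    and their inverse square roots yield S with S^* M S = J. Then
    U(z) = N(z, b) S satisfies U(z) J U(w)^* = N(z, w), which identifies the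
    kernel of H_3 with K^U.

    S may be composed with diag(t, 1/t). If for every t > 0 the operator I - U(z)
    were compact for some z = z_t in Omega, then the z_t would be real, distinct
    for distinct t, and isolated from each other, which countability forbids.

    For (2), the vectors f with f_Y = 0 form a subspace which reduces E to a
    self-adjoint operator; since E is simple, f |-> f_Y is injective and turns E
    into multiplication by the variable. *)

(** Write A(z) = G^{-1} P_Y(z). The relation A(z) G = I makes the adjoint of A(z) bounded below, and
    this is the source of all invertibility used here: A(z) A(w)^* is bounded below for w near z.
    The same fact defeats compactness. If the defects I - U are compact at z for the parameter t and
    at w for the parameter s, then N(z, w) is a compact perturbation of an antidiagonal operator, so
    its upper left block k (z - w') A(z) A(w)^* is compact; in infinite dimension and for w near z
    this forces z = w'. Taking w = z gives reality, and taking two parameters gives separation.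
    Bounded operators are carried together with an adjoint: a pair of maps with <T u, v> = <u, T' v>
    is automatically linear and bounded, so continuity is derived from an algebraic identity and
    explicit constants appear only where they matter. *)

(** * Real-valued norms *)

Section RealNorm.
Variable R : realType.

(** Norms of type [R[i]] are traded for real numbers, so that infima and linear arithmetic over [R]
    apply. *)
Definition nrm (V : normedZmodType R[i]) (x : V) : R := complex.Re `|x|.

Lemma nrmE (V : normedZmodType R[i]) (x : V) : `|x| = (nrm x)%:C%C.
Proof. by rewrite /nrm RRe_real// ger0_real. Qed.

Lemma nrm_ge0 (V : normedZmodType R[i]) (x : V) : 0 <= nrm x.
Proof. by rewrite -ler0c -nrmE. Qed.

Lemma nrm0 (V : normedZmodType R[i]) : nrm (0 : V) = 0.
Proof. by rewrite /nrm normr0. Qed.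

Lemma nrm_eq0 (V : normedZmodType R[i]) (x : V) : nrm x = 0 -> x = 0.
Proof. by move=> x0; apply/normr0_eq0; rewrite nrmE x0. Qed.

Lemma nrmN (V : normedZmodType R[i]) (x : V) : nrm (- x) = nrm x.
Proof. by rewrite /nrm normrN. Qed.

Lemma nrmD (V : normedZmodType R[i]) (x y : V) : nrm (x + y) <= nrm x + nrm y.
Proof. by rewrite -lecR rmorphD/= -!nrmE ler_normD. Qed.

Lemma nrmB (V : normedZmodType R[i]) (x y : V) : nrm (x - y) <= nrm x + nrm y.
Proof. by rewrite -(nrmN y) nrmD. Qed.

Lemma nrmBC (V : normedZmodType R[i]) (x y : V) : nrm (x - y) = nrm (y - x).
Proof. by rewrite -nrmN opprB. Qed.

Lemma nrm_triangle (V : normedZmodType R[i]) (y x z : V) :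
  nrm (x - z) <= nrm (x - y) + nrm (y - z).
Proof. by rewrite -[x - z](subrKA y) nrmD. Qed.

Lemma nrmM (a b : R[i]) : nrm (a * b) = nrm a * nrm b.
Proof. by apply: complexI; rewrite rmorphM/= -!nrmE normrM. Qed.

Lemma nrmZ (V : normedModType R[i]) (a : R[i]) (x : V) :
  nrm (a *: x) = nrm a * nrm x.
Proof. by apply: complexI; rewrite rmorphM/= -!nrmE normrZ. Qed.

Lemma nrmV (a : R[i]) : nrm a^-1 = (nrm a)^-1.
Proof. by apply: complexI; rewrite fmorphV/= -!nrmE normfV. Qed.

Lemma nrm_conj (a : R[i]) : nrm a^* = nrm a.
Proof. by apply: complexI; rewrite -!nrmE norm_conjC. Qed.

Lemma nrm_real (a : R) : nrm (a%:C%C : R[i]) = `|a|.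
Proof.
by apply: complexI; rewrite -nrmE normc_def/= expr0n addr0 sqrtr_sqr.
Qed.

Lemma nrm_neq0 (V : normedZmodType R[i]) (x : V) : x != 0 -> 0 < nrm x.
Proof. by move=> x0; rewrite -ltcR -nrmE normr_gt0. Qed.

Lemma Re_le_nrm (a : R[i]) : complex.Re a <= nrm a.
Proof.
rewrite -lecR -nrmE; apply: le_trans (normc_ge_Re a).
by rewrite lecR ler_norm.
Qed.

Lemma conj_realC (a : R) : (a%:C%C : R[i])^* = a%:C%C.
Proof. by apply/CrealP/complex_realP; exists a. Qed.

Lemma eps_le (a b : R) : (forall e, 0 < e -> a <= b + e) -> a <= b.
Proof. by move=> h; apply/ler_addgt0Pr => e e0; exact: h. Qed.

End RealNorm.

(** * Neighbourhoods, closures and limits in terms of real norms *)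

Section NormTopology.
Variables (R : realType) (X : normedModType R[i]).
Implicit Types (x y : X) (S : set X).

Lemma nbhs_nrmP x S :
  nbhs x S <-> exists2 e : R, 0 < e & forall y, nrm (y - x) < e -> S y.
Proof.
split=> [/nbhs_normP[e/= e0 eS]|[e e0 eS]].
  have eE : e = (complex.Re e)%:C%C by rewrite RRe_real// gtr0_real.
  exists (complex.Re e); first by rewrite -ltcR -eE.
  by move=> y yx; apply: eS => /=; rewrite eE nrmE ltcR nrmBC.
apply/nbhs_normP; exists (e%:C)%C; first by rewrite /= ltcR.
by move=> y /=; rewrite nrmE ltcR nrmBC; exact: eS.
Qed.

Lemma closureP S x :
  closure S x <-> forall e : R, 0 < e -> exists2 y, S y & nrm (y - x) < e.
Proof.
split=> [Sx e e0|Sx B /nbhs_nrmP[e e0 eB]].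
  have [|y [Sy yx]] := Sx [set y | nrm (y - x) < e]; last by exists y.
  by apply/nbhs_nrmP; exists e.
by have [y Sy yx] := Sx e e0; exists y; split=> //; exact: eB.
Qed.

Lemma closedP S : (forall x, (forall e : R, 0 < e -> exists2 y, S y & nrm (y - x) < e) ->
  S x) -> closed S.
Proof. by move=> h x /closureP; exact: h. Qed.

End NormTopology.

Section SequentialTopology.
Variables (R : realType) (X : completeNormedModType R[i]).
Implicit Types (x y : X) (S : set X) (u : nat -> X).

Definition lim_to u x :=
  forall e : R, 0 < e -> exists N, forall n, (N <= n)%N -> nrm (u n - x) < e.

Lemma complete_seq u :
  (forall e : R, 0 < e -> exists N, forall m n, (N <= m)%N -> (N <= n)%N ->
     nrm (u m - u n) < e) -> exists x, lim_to u x.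
Proof.
move=> cu.
have : cvg (u @ \oo).
  apply: cauchy_cvg; apply/cauchyP => e e0.
  have eE : e = (complex.Re e)%:C%C by rewrite RRe_real// gtr0_real.
  have [N hN] := cu (complex.Re e) ltac:(by rewrite -ltcR -eE).
  exists (u N), N => //= n /= Nn; rewrite -ball_normE/=.
  by rewrite eE nrmE ltcR hN.
move=> /cvg_ex[x /cvgrPdist_lt ux]; exists x => e e0.
have [|N _ hN] := ux (e%:C)%C; first by rewrite ltcR.
by exists N => n Nn; have := hN n Nn; rewrite /= nrmE ltcR nrmBC.
Qed.

Lemma closed_lim S u x :
  closed S -> (forall n, S (u n)) -> lim_to u x -> S x.
Proof.
move=> Sc Su ux; rewrite (closure_id S).1//; apply/closureP => e e0.
by have [N hN] := ux e e0; exists (u N) => //; exact: hN.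
Qed.

End SequentialTopology.

(** * Orthogonal projections *)

Section Inner.
Variables (R : realType) (X : hilbertType R).
Implicit Types (x y z u v : X) (a b : R[i]).

Lemma hdotDl x y z : '[x + y, z] = '[x, z] + '[y, z].
Proof. exact: linearDl. Qed.

Lemma hdotDr x y z : '[z, x + y] = '[z, x] + '[z, y].
Proof. exact: linearDr. Qed.

Lemma hdotBl x y z : '[x - y, z] = '[x, z] - '[y, z].
Proof. exact: linearBl. Qed.

Lemma hdotBr x y z : '[z, x - y] = '[z, x] - '[z, y].
Proof. exact: linearBr. Qed.

Lemma hdotZl a x z : '[a *: x, z] = a * '[x, z].
Proof. exact: linearZl_LR. Qed.

Lemma hdotZr a x z : '[z, a *: x] = a^* * '[z, x].
Proof. exact: linearZr_LR. Qed.

Lemma hdotNl x z : '[- x, z] = - '[x, z].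
Proof. exact: linearNl. Qed.

Lemma hdotNr x z : '[z, - x] = - '[z, x].
Proof. exact: linearNr. Qed.

Lemma hdot0l z : '[0, z] = 0.
Proof. exact: linear0l. Qed.

Lemma hdot0r z : '[z, 0] = 0.
Proof. exact: linear0r. Qed.

Lemma hdotC x y : '[x, y] = '[y, x]^*.
Proof. by have := hermC hdot x y; rewrite expr0 mul1r. Qed.

Lemma hdotxx x : '[x, x] = (nrm x ^+ 2)%:C%C.
Proof. by rewrite hdot_norm nrmE rmorphXn. Qed.

Lemma Re_hdotC x y : complex.Re '[x, y] = complex.Re '[y, x].
Proof. by rewrite hdotC; case: '[y, x]. Qed.

Lemma nrm_sub_sqr x y :
  nrm (x - y) ^+ 2 = nrm x ^+ 2 - complex.Re '[x, y] *+ 2 + nrm y ^+ 2.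
Proof.
have := congr1 (@complex.Re R) (hdotxx (x - y)) => /= <-.
rewrite hdotBl !hdotBr !hdotxx !raddfB/= (Re_hdotC y x); ring.
Qed.

Lemma nrm_add_sqr x y :
  nrm (x + y) ^+ 2 = nrm x ^+ 2 + complex.Re '[x, y] *+ 2 + nrm y ^+ 2.
Proof. by rewrite -[y]opprK nrm_sub_sqr hdotNr raddfN nrmN/= opprK mulNrn opprK. Qed.

Lemma parallelogram x y :
  nrm (x - y) ^+ 2 + nrm (x + y) ^+ 2 = (nrm x ^+ 2 + nrm y ^+ 2) *+ 2.
Proof. by rewrite nrm_sub_sqr nrm_add_sqr; ring. Qed.

Lemma Re_conj_mul a : complex.Re (a^* * a) = nrm a ^+ 2.
Proof.
by have := congr1 (@complex.Re R) (normCKC a); rewrite nrmE -rmorphXn/= => ->.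
Qed.

Lemma Re_realM (t : R) a : complex.Re (t%:C%C * a) = t * complex.Re a.
Proof. by case: a => a1 a2 /=; rewrite mul0r subr0. Qed.

Lemma hdot_optimal (w s : X) : (forall a, nrm w <= nrm (w - a *: s)) -> '[w, s] = 0.
Proof.
move=> h; apply: nrm_eq0; apply/eqP; rewrite -sqrf_eq0.
(* The [+ 1] covers [s = 0]. For the coefficient [t * '[w, s]] the quadratic term is at most half of
   the linear one, so optimality forces the inner product to vanish. *)
set t := (nrm s ^+ 2 + 1)^-1.
have s1 : 0 < nrm s ^+ 2 + 1 by rewrite ltr_wpDl ?sqr_ge0.
have t0 : 0 < t by rewrite invr_gt0.
have := h (t%:C%C * '[w, s]).
rewrite -(@ler_pXn2r _ 2)// ?nnegrE ?nrm_ge0// nrm_sub_sqr hdotZr nrmZ nrmM.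
rewrite nrm_real gtr0_norm// rmorphM/= conj_realC -mulrA Re_realM Re_conj_mul.
set p := nrm '[w, s] ^+ 2.
have -> : (t * nrm '[w, s] * nrm s) ^+ 2 = t * p * (t * nrm s ^+ 2).
  by rewrite /p; ring.
have ts : t * nrm s ^+ 2 <= 1.
  by rewrite /t mulrC ler_pdivrMr// mul1r lerDl.
have p0 : 0 <= p by rewrite sqr_ge0.
have tp : 0 <= t * p by rewrite mulr_ge0// ltW.
have : t * p * (t * nrm s ^+ 2) <= t * p by rewrite ler_piMr.
move=> h1 h2; have : t * p <= 0 by lra.
by rewrite pmulr_rle0// => p1; rewrite eq_le p1.
Qed.

Lemma hdot_nrm_le x y : nrm '[x, y] <= nrm x * nrm y.
Proof.
have [->|y0] := eqVneq y 0; first by rewrite hdot0r !nrm0 mulr0.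
have ny : 0 < nrm y := nrm_neq0 y0.
set p := '[x, y].
have h := sqr_ge0 (nrm (x - ((nrm y ^- 2)%:C%C * p) *: y)).
move: h; rewrite nrm_sub_sqr hdotZr nrmZ nrmM nrm_real rmorphM/= conj_realC.
rewrite -mulrA Re_realM Re_conj_mul.
rewrite ger0_norm ?invr_ge0 ?exprn_ge0 ?nrm_ge0//.
have -> : nrm x ^+ 2 - nrm y ^- 2 * nrm p ^+ 2 *+ 2 +
  (nrm y ^- 2 * nrm p * nrm y) ^+ 2 = nrm x ^+ 2 - nrm p ^+ 2 / nrm y ^+ 2.
  by field; rewrite gt_eqF.
rewrite subr_ge0 ler_pdivrMr ?exprn_gt0// -exprMn.
by rewrite ler_pXn2r// ?nnegrE ?mulr_ge0 ?nrm_ge0.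
Qed.

Lemma hdot_inj x y : (forall z, '[z, x] = '[z, y]) -> x = y.
Proof.
move=> h; apply/eqP; rewrite -subr_eq0; apply/eqP/nrm_eq0/eqP.
rewrite -sqrf_eq0; apply/eqP/complexI.
by rewrite -hdotxx hdotBr h subrr.
Qed.

Lemma hdot_injl x y : (forall z, '[x, z] = '[y, z]) -> x = y.
Proof. by move=> h; apply: hdot_inj => z; rewrite hdotC h -hdotC. Qed.

End Inner.

Section Projection.
Variables (R : realType) (X : hilbertType R).
Implicit Types (x y z u v : X) (a b : R[i]) (S : set X).

Lemma linear_subspaceD S x y : linear_subspace S -> S x -> S y -> S (x + y).
Proof. by move=> [_ h] Sx Sy; rewrite -[x]scale1r; exact: h. Qed.

Lemma linear_subspaceZ S a x : linear_subspace S -> S x -> S (a *: x).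
Proof. by move=> [S0 h] Sx; rewrite -[_ *: _]addr0; exact: h. Qed.

Lemma linear_subspaceB S x y : linear_subspace S -> S x -> S y -> S (x - y).
Proof.
by move=> sS Sx Sy; rewrite -scaleN1r; apply: linear_subspaceD => //;
  exact: linear_subspaceZ.
Qed.

(** A minimizing sequence for the distance to [S] is Cauchy by the parallelogram law, because
    midpoints stay in [S]; its limit is a best approximation, and [hdot_optimal] makes the residual
    orthogonal to [S]. *)
Lemma subspace_projection S x : linear_subspace S -> closed S ->
  exists2 y, S y & forall s, S s -> '[x - y, s] = 0.
Proof.
move=> sS cS.
pose D := [set r : R | exists2 s, S s & r = nrm (x - s) ^+ 2].
have infD : has_inf D.
  split; first by exists (nrm (x - 0) ^+ 2), 0 => //; exact: sS.1.
  by exists 0 => _ [s _ ->]; rewrite sqr_ge0.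
pose d := inf D.
have dle s : S s -> d <= nrm (x - s) ^+ 2.
  by move=> Ss; apply: ge_inf; [exact: infD.2|exists s].
have /choice[u hu] (n : nat) : exists s, S s /\ nrm (x - s) ^+ 2 < d + n.+1%:R^-1.
  have [//|_ [s Ss ->] h] := @inf_adherent _ D n.+1%:R^-1 _ infD.
  by exists s.
have key m n : nrm (u m - u n) ^+ 2 <= (m.+1%:R^-1 + n.+1%:R^-1) *+ 2.
  have := parallelogram (x - u n) (x - u m).
  have -> : x - u n - (x - u m) = u m - u n.
    by rewrite opprB addrC addrA subrK.
  have -> : x - u n + (x - u m) = 2 *: (x - 2^-1 *: (u m + u n)).
    rewrite scalerBr scalerA mulfV ?pnatr_eq0// scale1r scaler_nat mulr2n.
    by rewrite opprD addrACA [- u m + _]addrC.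
  rewrite nrmZ exprMn.
  have -> : nrm (2 : R[i]) = 2.
    by have := @nrm_real R 2; rewrite rmorph_nat => ->; rewrite ger0_norm.
  have /dle : S (2^-1 *: (u m + u n)).
    by apply: linear_subspaceZ => //; apply: linear_subspaceD => //;
      [case: (hu m)|case: (hu n)].
  have [_] := hu m; have [_] := hu n.
  move: (nrm _ ^+ 2) (nrm _ ^+ 2) (nrm _ ^+ 2) (nrm _ ^+ 2) => a b c e.
  move: (m.+1%:R^-1) (n.+1%:R^-1) => p q.
  by rewrite !mulr2n expr2; lra.
have invlt (e : R) : 0 < e -> exists N : nat, forall n, (N <= n)%N -> n.+1%:R^-1 < e.
  move=> e0; have ie : 0 < e^-1 by rewrite invr_gt0.
  exists (Num.truncn e^-1) => n Nn; rewrite -ltf_pV2 ?posrE// invrK.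
  by apply: lt_le_trans (truncnS_gt _) _; rewrite ler_nat ltnS.
have [y uy] : exists y, lim_to u y.
  apply: complete_seq => e e0; have e40 : 0 < e ^+ 2 / 4 by rewrite divr_gt0// exprn_gt0.
  have [N hN] := invlt _ e40; exists N => m n mN nN.
  rewrite -(@ltr_pXn2r _ 2)// ?nnegrE ?nrm_ge0 ?ltW//.
  apply: le_lt_trans (key m n) _; have := hN m mN; have := hN n nN.
  by move: (m.+1%:R^-1) (n.+1%:R^-1) (e ^+ 2) => a b c; rewrite mulr2n; lra.
have Sy : S y by apply: closed_lim uy => // n; case: (hu n).
exists y => // s Ss; apply: hdot_optimal => a.
have -> : x - y - a *: s = x - (y + a *: s) by rewrite opprD addrA.
have /dle dz : S (y + a *: s).
  by apply: linear_subspaceD => //; exact: linear_subspaceZ.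
apply: le_trans (_ : Num.sqrt d <= _); last first.
  rewrite -(@ler_pXn2r _ 2)// ?nnegrE ?nrm_ge0 ?sqrtr_ge0//.
  rewrite sqr_sqrtr//; apply: lb_le_inf; first exact: infD.1.
  by move=> _ [? _ ->]; rewrite sqr_ge0.
apply: eps_le => e e0.
have e2 : 0 < e / 2 by rewrite divr_gt0.
have [N hN] := uy _ e2.
have [N' hN'] := invlt _ (exprn_gt0 2 e2).
set n := maxn N N'; have hn := hN n (leq_maxl _ _).
have hn' := hN' n (leq_maxr _ _).
apply: le_trans (nrm_triangle (u n) x y) _.
have : nrm (x - u n) <= Num.sqrt d + e / 2.
  have d0 : 0 <= d.
    by apply: lb_le_inf; [exact: infD.1|move=> _ [? _ ->]; rewrite sqr_ge0].
  rewrite -(@ler_pXn2r _ 2)// ?nnegrE ?nrm_ge0 ?addr_ge0 ?sqrtr_ge0// ?ltW//.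
  rewrite sqrrD sqr_sqrtr//.
  have [_ h] := hu n.
  have : 0 <= Num.sqrt d * (e / 2) by rewrite mulr_ge0 ?sqrtr_ge0// ltW.
  rewrite mulr2n; move: h hn'; move: (Num.sqrt d * (e / 2)).
  by move: (n.+1%:R^-1) ((e / 2) ^+ 2) (nrm _ ^+ 2) => a1 a2 a3 a4; lra.
by move: hn => /ltW; move: (nrm _) (nrm _) => a1 a2; lra.
Qed.

Lemma closure_subspace S : linear_subspace S -> linear_subspace (closure S).
Proof.
move=> sS.
split; first by apply: subset_closure; exact: sS.1.
move=> a u v /closureP Su /closureP Sv; apply/closureP => e e0.
have a1 : 0 < nrm a + 1 by rewrite ltr_wpDl ?nrm_ge0.
have e2 : 0 < e / 2 / (nrm a + 1) by rewrite !divr_gt0.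
have [u' Su' uu] := Su _ e2.
have [|v' Sv' vv] := Sv (e / 2); first by rewrite divr_gt0.
exists (a *: u' + v'); first exact: sS.2.
rewrite opprD addrACA -scalerBr; apply: le_lt_trans (nrmD _ _) _.
rewrite nrmZ (splitr e) ltr_leD ?(ltW vv)//.
apply: (@le_lt_trans _ _ ((nrm a + 1) * nrm (u' - u))).
  by rewrite ler_wpM2r ?nrm_ge0// lerDl.
by rewrite mulrC -ltr_pdivlMr.
Qed.

Lemma dense_subspace S : linear_subspace S ->
  (forall z, (forall s, S s -> '[z, s] = 0) -> z = 0) -> forall x, closure S x.
Proof.
move=> sS h x.
have sC := closure_subspace sS.
have [y Cy hy] := subspace_projection x sC (@closed_closure _ S).
suff /eqP : x - y = 0 by rewrite subr_eq0 => /eqP ->.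
by apply: h => s Ss; apply: hy; exact: subset_closure.
Qed.

End Projection.

(** * Geometrically convergent sequences *)

Section Limits.
Variables (R : realType) (X : completeNormedModType R[i]).
Implicit Types (x y : X) (u : nat -> X).

Lemma lim_nrm_le u x y (b : R) n :
  lim_to u x -> (forall m, (n <= m)%N -> nrm (u m - y) <= b) -> nrm (x - y) <= b.
Proof.
move=> ux h; apply: eps_le => e e0; have [N hN] := ux e e0.
have h1 := hN _ (leq_maxl N n); have h2 := h _ (leq_maxr N n).
apply: le_trans (nrm_triangle (u (maxn N n)) _ _) _.
by rewrite nrmBC addrC lerD// ltW.
Qed.

Lemma expr_small (q e : R) : 0 <= q -> q < 1 -> 0 < e ->
  exists N, forall n, (N <= n)%N -> q ^+ n < e.
Proof.
move=> q0 q1 e0.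
have /cvgrPdist_lt/(_ _ e0)[N _ hN] : (GRing.exp q) @ \oo --> (0 : R).
  by apply: cvg_expr; rewrite ger0_norm.
exists N => n Nn; have := hN n Nn.
by rewrite /= sub0r normrN ger0_norm// exprn_ge0.
Qed.

Lemma geometric_lim u (c q : R) : 0 <= c -> 0 <= q -> q < 1 ->
  (forall n, nrm (u n.+1 - u n) <= c * q ^+ n) ->
  exists2 x, lim_to u x & forall n, nrm (x - u n) <= c * q ^+ n / (1 - q).
Proof.
move=> c0 q0 q1 h; have q1' : 0 < 1 - q by rewrite subr_gt0.
have key n m : (n <= m)%N -> nrm (u m - u n) <= c * q ^+ n / (1 - q).
  move=> nm; rewrite -(subnK nm); set k := (m - n)%N.
  (* The induction carries the exact geometric partial sum, since the bare bound is not
     inductive. *)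
  apply: (@le_trans _ _ (c * (q ^+ n - q ^+ (k + n)) / (1 - q))).
    elim: k => [|k IH]; first by rewrite add0n !subrr nrm0 mulr0 mul0r.
    apply: le_trans (nrm_triangle (u (k + n)%N) _ _) _.
    apply: le_trans (lerD (h (k + n)%N) IH) _.
    rewrite addSn exprS ler_pdivlMr// mulrDl divfK ?gt_eqF//.
    by rewrite le_eqVlt; apply/orP; left; apply/eqP; ring.
  rewrite ler_pM2r ?invr_gt0//; apply: ler_wpM2l => //.
  by rewrite gerBl exprn_ge0.
have [x ux] : exists x, lim_to u x.
  apply: complete_seq => e e0.
  have e1 : 0 < e * (1 - q) / (2 * (c + 1)).
    by rewrite divr_gt0 ?mulr_gt0// ltr_wpDl.
  have [N hN] := expr_small q0 q1 e1; have {}hN := hN N (leqnn N).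
  have small : c * q ^+ N / (1 - q) < e / 2.
    rewrite ltr_pdivrMr//; apply: (@le_lt_trans _ _ ((c + 1) * q ^+ N)).
      by rewrite ler_wpM2r ?exprn_ge0// lerDl.
    rewrite mulrC -ltr_pdivlMr ?ltr_wpDl//; apply: lt_le_trans hN _.
    by rewrite invfM mulrA le_eqVlt; apply/orP; left; apply/eqP; ring.
  exists N => m n Nm Nn; apply: le_lt_trans (nrm_triangle (u N) _ _) _.
  rewrite (nrmBC (u N)) (splitr e).
  by rewrite ltrD//; apply: le_lt_trans small; exact: key.
by exists x => // n; apply: (lim_nrm_le ux (n := n)) => m; exact: key.
Qed.

End Limits.

(** * Adjoints and the closed graph theorem *)

(* Gliding hump: if [nrm (w (j n))] exceeds [6 (n + 1) 4^n], steps of length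
   [4^-n] lead to a vector [l] whose inner products with the [w (j n)] are
   unbounded. *)
Lemma uniform_boundedness (R : realType) (X : hilbertType R) (I : Type)
  (w : I -> X) : (forall x, exists c : R, forall i, nrm '[x, w i] <= c) ->
  exists2 c : R, 0 <= c & forall i, nrm (w i) <= c.
Proof.
move=> pb; apply: contrapT => nb.
have /choice[j hj] (n : nat) : exists i, 6 * n.+1%:R * 4 ^+ n < nrm (w i).
  apply: contrapT => h; apply: nb; exists (6 * n.+1%:R * 4 ^+ n).
    by rewrite !mulr_ge0// exprn_ge0.
  by move=> i; rewrite leNgt; apply/negP => wi; apply: h; exists i.
pose q : R := 4^-1.
have q0 : 0 < q by rewrite invr_gt0.
have w0 n : 0 < nrm (w (j n)).
  by apply: le_lt_trans (hj n); rewrite !mulr_ge0// exprn_ge0.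
have /choice[f hf] (p : nat * X) : exists y, nrm (y - p.2) <= q ^+ p.1 /\
    q ^+ p.1 * nrm (w (j p.1)) / 2 <= nrm '[y, w (j p.1)].
  case: p => n x /=; set v := w (j n).
  (* Moving [x] by a step of length [q ^+ n] along [v] changes its inner product with [v] by
     [q ^+ n * nrm v], so before or after the move it is at least half of that. *)
  have [h|h] := leP (q ^+ n * nrm v / 2) (nrm '[x, v]).
    by exists x; rewrite subrr nrm0 exprn_ge0// ltW.
  have v0 : 0 < nrm v := w0 n.
  exists (x + (q ^+ n / nrm v)%:C%C *: v); rewrite [x + _ - x]addrC addKr nrmZ.
  have qv : 0 <= q ^+ n / nrm v.
    by apply: divr_ge0; [exact/exprn_ge0/ltW|exact: ltW].
  rewrite nrm_real (ger0_norm qv) divfK ?gt_eqF// lexx; split=> //.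
  rewrite hdotDl hdotZl hdotxx -rmorphM/=.
  have -> : q ^+ n / nrm v * nrm v ^+ 2 = q ^+ n * nrm v.
    by field; rewrite gt_eqF.
  set p : R[i] := '[x, v]; set r := (q ^+ n * nrm v).
  have r0 : 0 <= r by rewrite mulr_ge0// ?exprn_ge0// ltW.
  have : r <= nrm (p + r%:C%C) + nrm p.
    have := @nrmB _ _ (p + r%:C%C) p.
    by rewrite addrC addKr nrm_real (ger0_norm r0).
  by move: h; rewrite -/p -/r; move: (nrm _) (nrm _) => a b; lra.
pose x := fix x n := if n is m.+1 then f (m, x m) else 0.
have [||||l xl hl] := @geometric_lim R X x 1 q => //; first exact: ltW.
- by rewrite invf_lt1// ltr1n.
- by move=> n; rewrite mul1r; have [] := hf (n, x n).
have [c hc] := pb l.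
have [n nc] : exists n : nat, c < n.+1%:R.
  by exists (Num.truncn c); exact: truncnS_gt.
have := hc (j n); apply/negP; rewrite -ltNge; apply: lt_le_trans nc _.
have [_ /= h1] := hf (n, x n).
(* The later steps add up to at most [q ^+ n.+1 / (1 - q) = q ^+ n / 3]. Of the half gained at step
   [n] a sixth survives, which explains the factor 6 in the choice of [j]. *)
have h2 : nrm '[l - x n.+1, w (j n)] <= q ^+ n / 3 * nrm (w (j n)).
  apply: le_trans (hdot_nrm_le _ _) _; apply: ler_wpM2r; first exact: nrm_ge0.
  apply: le_trans (hl _) _; rewrite exprS /q.
  by rewrite le_eqVlt; apply/orP; left; apply/eqP; field.
have h3 := nrmB '[l, w (j n)] '[l - x n.+1, w (j n)].
rewrite hdotBl opprB addrC subrK -hdotBl in h3.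
have h4 : n.+1%:R <= q ^+ n * nrm (w (j n)) / 6.
  rewrite ler_pdivlMr// /q exprVn mulrC ler_pdivlMl ?exprn_gt0//.
  apply: ltW; rewrite mulrCA mulrA; apply: le_lt_trans (hj n).
  by rewrite le_eqVlt; apply/orP; left; apply/eqP; ring.
move: h1 h2 h3 h4; rewrite -/(x n.+1).
have -> : q ^+ n / 3 * nrm (w (j n)) = q ^+ n * nrm (w (j n)) / 3 by ring.
move: (q ^+ n * _) (nrm '[x n.+1, _]) (nrm '[l - _, _]) (nrm '[l, _]) (n.+1%:R) => *; lra.
Qed.

Section Adjoint.
Variables (R : realType).

Definition adj (X Z : hilbertType R) (T : X -> Z) (T' : Z -> X) :=
  forall u v, '[T u, v] = '[u, T' v].

Lemma adj_sym (X Z : hilbertType R) (T : X -> Z) T' : adj T T' -> adj T' T.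
Proof. by move=> h u v; rewrite hdotC -h -hdotC. Qed.

Lemma adj_linear (X Z : hilbertType R) (T : X -> Z) T' : adj T T' -> linear T.
Proof.
move=> h a u v; apply: hdot_injl => z.
by rewrite h hdotDl hdotZl hdotDl hdotZl !h.
Qed.

Lemma adj_adjoint (X : hilbertType R) (T T' : X -> X) : adj T T' -> adjoint T = T'.
Proof.
move=> h; apply/funext => y; rewrite /adjoint.
case: xgetP => [z -> hz|/(_ (T' y))[]]; last by move=> x /=; exact: h.
by apply: hdot_inj => x; rewrite -hz h.
Qed.

Definition bounded_by (X Z : normedZmodType R[i]) (T : X -> Z) :=
  exists2 c : R, 0 <= c & forall u, nrm (T u) <= c * nrm u.

(** Hellinger-Toeplitz: for [nrm v <= 1] the inner products of [x] with [T' v] are bounded by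
    [nrm (T x)], so uniform boundedness applies to the vectors [T' v]. *)
Lemma adj_bounded (X Z : hilbertType R) (T : X -> Z) T' :
  adj T T' -> bounded_by T.
Proof.
move=> h.
have [x|c c0 hc] := @uniform_boundedness R X {v : Z | nrm v <= 1}
    (fun v => T' (sval v)).
  exists (nrm (T x)) => -[v v1] /=; rewrite -h.
  by apply: le_trans (hdot_nrm_le _ _) _; rewrite ler_piMr ?nrm_ge0.
exists c => // u.
have [->|Tu] := eqVneq (T u) 0; first by rewrite nrm0 mulr_ge0 ?nrm_ge0.
have n0 := nrm_neq0 Tu.
pose v := ((nrm (T u))^-1)%:C%C *: T u.
have v1 : nrm v = 1.
  by rewrite nrmZ nrm_real ger0_norm ?invr_ge0 ?nrm_ge0// mulVf ?gt_eqF.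
have := hc (exist _ v (ltac:(by rewrite v1) : nrm v <= 1)) => /= h1.
have : nrm '[T u, v] <= nrm u * c.
  rewrite h; apply: le_trans (hdot_nrm_le _ _) _.
  by rewrite ler_wpM2l ?nrm_ge0.
rewrite hdotZr hdotxx conj_realC nrmM !nrm_real ger0_norm ?invr_ge0 ?nrm_ge0//.
by rewrite ger0_norm ?sqr_ge0// expr2 mulrA mulVf ?gt_eqF// mul1r mulrC.
Qed.

Lemma bounded_by_op (X : hilbertType R) (T : X -> X) :
  linear T -> bounded_by T -> bounded_op T.
Proof.
move=> lT [c c0 hc]; split=> // x; apply/cvgrPdist_lt => e e0.
have eE : e = (complex.Re e)%:C%C by rewrite RRe_real// gtr0_real.
have c1 : 0 < c + 1 by rewrite ltr_wpDl.
have re0 : 0 < complex.Re e by rewrite -ltcR -eE.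
apply/nbhs_nrmP; exists (complex.Re e / (c + 1)); first by rewrite divr_gt0.
move=> y xy; rewrite eE nrmE ltcR.
have -> : T x - T y = T (x - y).
  by have := lT (-1) y x; rewrite !scaleN1r ![- _ + _]addrC => ->.
apply: le_lt_trans (hc _) _; rewrite nrmBC.
apply: (@le_lt_trans _ _ ((c + 1) * nrm (y - x))).
  by rewrite ler_wpM2r ?nrm_ge0// lerDl.
by rewrite mulrC -ltr_pdivlMr.
Qed.

Lemma adj_bounded_op (X : hilbertType R) (T T' : X -> X) : adj T T' -> bounded_op T.
Proof. by move=> h; apply: bounded_by_op; [exact: adj_linear h|exact: adj_bounded h]. Qed.

Lemma riesz (X : hilbertType R) (f : X -> R[i]) :
  (forall a u v, f (a *: u + v) = a * f u + f v) ->
  (exists2 c : R, 0 <= c & forall u, nrm (f u) <= c * nrm u) ->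
  exists z, forall x, f x = '[x, z].
Proof.
move=> fl [c c0 hc].
have f0 : f 0 = 0.
  apply: nrm_eq0; apply/eqP.
  by rewrite eq_le nrm_ge0 (le_trans (hc 0))// nrm0 mulr0.
have [[x fx]|nf] := pselect (exists x, f x != 0); last first.
  exists 0 => x; rewrite hdot0r; apply: contrapT => /eqP fx; apply: nf.
  by exists x.
pose S := [set y | f y = 0].
have sS : linear_subspace S.
  split; first exact: f0.
  by move=> a u v; rewrite /S/= fl => -> ->; rewrite mulr0 addr0.
have cS : closed S.
  apply: closedP => y hy /=; apply: nrm_eq0; apply/eqP; rewrite eq_le nrm_ge0 andbT.
  apply: eps_le => e e0; rewrite add0r.
  have c1 : 0 < c + 1 by rewrite ltr_wpDl.
  have [s /= fs sy] := hy (e / (c + 1)) (divr_gt0 e0 c1).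
  have -> : f y = f ((-1) *: s + y) by rewrite fl fs mulr0 add0r.
  apply: le_trans (hc _) _; rewrite scaleN1r addrC nrmBC.
  apply: (@le_trans _ _ ((c + 1) * nrm (s - y))).
    by rewrite ler_wpM2r ?nrm_ge0// lerDl.
  by apply/ltW; rewrite mulrC -ltr_pdivlMr.
have [y fy hy] := subspace_projection x sS cS.
pose w := x - y.
have fw : f w = f x by rewrite /w -scaleN1r addrC fl fy mulr0 add0r.
have w0 : '[w, w] != 0.
  apply: contra fx => /eqP; rewrite hdotxx => /complexI/eqP; rewrite sqrf_eq0.
  by move=> /eqP/nrm_eq0 w0; rewrite -fw w0 f0.
exists ((f w / '[w, w])^* *: w) => z; rewrite hdotZr conjCK.
have : '[w, (- (f z / f w)) *: w + z] = 0.
  by apply: hy; rewrite /S/= fl fw mulNr divfK ?addNr.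
rewrite hdotDr hdotZr => /(congr1 Num.conj).
rewrite rmorphD rmorphM/= conjCK -hdotC conjC0.
rewrite -hdotC => /eqP; rewrite mulNr addrC subr_eq0 => /eqP ->.
have fdiv (a b c' : R[i]) : a != 0 -> b != 0 -> c' = a / b * (c' / a * b).
  by move=> a0 b0; field; rewrite a0 b0.
by apply: fdiv; rewrite ?fw.
Qed.

(* The domain [D] of the adjoint is dense since the graph is closed, and
   [nrm (T u)] is the supremum of [nrm '[T u, v]] over the unit ball of [D]. *)
Lemma closed_graph (X : hilbertType R) (T : X -> X) :
  linear T ->
  (forall x y, (forall e : R, 0 < e ->
     exists u, nrm (u - x) < e /\ nrm (T u - y) < e) -> T x = y) ->
  exists T', adj T T'.
Proof.
move=> lT cT.
have T0 : T 0 = 0 by have := lT (-1) 0 0; rewrite scaler0 addr0 scaleN1r addNr.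
pose Gr : set (hsum X X) := [set p | p.2 = T p.1].
have sG : linear_subspace Gr.
  by split=> [|a u v]; rewrite /Gr/= ?T0// => -> ->; rewrite lT.
have cG : closed Gr.
  apply: closedP => -[x y] h; apply/esym/cT => e e0.
  have [[u v] /= uv le] := h e e0; exists u; split.
    by apply: le_lt_trans le; rewrite -lecR -!nrmE; exact: hsum_norm_fst.
  by rewrite -uv; apply: le_lt_trans le; rewrite -lecR -!nrmE; exact: hsum_norm_snd.
pose D := [set v | exists z, forall u, '[T u, v] = '[u, z]].
have sD : linear_subspace D.
  split; first by exists 0 => u; rewrite !hdot0r.
  move=> a u v [u' hu] [v' hv]; exists (a *: u' + v') => x.
  by rewrite !hdotDr !hdotZr hu hv.
have dD : forall x, closure D x.
  apply: dense_subspace => // z zD.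
  (* The residual [(- x, z - y)] of the projection of [(0, z)] is orthogonal to the graph, which
     says that [z - y] lies in [D] with adjoint value [x]. As [z] is orthogonal to [D], testing
     against [(x, y)] makes [x] and [z - y] vanish together. *)
  have [[x y] /= xy hxy] := subspace_projection ((0, z) : hsum X X) sG cG.
  have /= hb u : '[0 - x, u] + '[z - y, T u] = 0.
    exact: (hxy (u, T u) erefl).
  have {}xy : y = T x := xy.
  have Db : D (z - y).
    exists x => u; rewrite hdotC [RHS]hdotC; congr (_^*).
    by have := hb u; rewrite sub0r hdotNl addrC => /eqP; rewrite subr_eq0 => /eqP.
  have zb := zD _ Db.
  have := hb x; rewrite -xy sub0r hdotNl hdotxx.
  have -> : '[z - y, y] = - '[z - y, z - y].
    by rewrite [X in _ = - X]hdotBr (hdotC _ z) zb conjC0 sub0r opprK.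
  rewrite hdotxx => /eqP; rewrite -opprD oppr_eq0 -rmorphD/= => /eqP/complexI/eqP.
  rewrite paddr_eq0 ?sqr_ge0// !sqrf_eq0 => /andP[/eqP/nrm_eq0 x0 /eqP/nrm_eq0/eqP].
  by rewrite subr_eq0 xy x0 T0 => /eqP.
pose I := {v : X | D v /\ nrm v <= 1}.
have /choice[w hw] (i : I) : exists z, forall u, '[T u, sval i] = '[u, z].
  by case: i => v [[z hz] ?]; exists z.
have [x|c c0 hc] := uniform_boundedness (w := w).
  exists (nrm (T x)) => -[v Dv] /=; rewrite -hw/=.
  by apply: le_trans (hdot_nrm_le _ _) _; rewrite ler_piMr ?nrm_ge0//; case: Dv.
have bT u : nrm (T u) <= c * nrm u.
  have Dbound v : D v -> nrm '[T u, v] <= c * nrm u * nrm v.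
    move=> Dv; have [->|v0] := eqVneq v 0; first by rewrite hdot0r !nrm0 mulr0.
    have n0 := nrm_neq0 v0; pose v' := ((nrm v)^-1)%:C%C *: v.
    have v1 : nrm v' = 1.
      by rewrite nrmZ nrm_real ger0_norm ?invr_ge0 ?nrm_ge0// mulVf ?gt_eqF.
    have Dv' : D v' /\ nrm v' <= 1.
      by split; [exact: linear_subspaceZ|rewrite v1].
    have -> : v = (nrm v)%:C%C *: v'.
      by rewrite scalerA -rmorphM/= mulfV ?gt_eqF// scale1r.
    rewrite hdotZr conj_realC nrmM nrmZ v1 mulr1 mulrC ler_wpM2r ?nrm_ge0//.
    rewrite (hw (exist _ v' Dv')); apply: le_trans (hdot_nrm_le _ _) _.
    by rewrite mulrC ler_wpM2r ?nrm_ge0.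
  have [->|n0] := eqVneq (T u) 0; first by rewrite nrm0 mulr_ge0 ?nrm_ge0.
  have {}n0 := nrm_neq0 n0.
  rewrite -(ler_pM2r n0) -expr2; apply: eps_le => e e0.
  (* [T u] is approximated by some [v] in [D]; [k] dominates the coefficients of [nrm (v - T u)] in
     the resulting estimate of [nrm (T u) ^+ 2]. *)
  pose k := nrm (T u) + c * nrm u + 1.
  have cu : 0 <= c * nrm u by rewrite mulr_ge0 ?nrm_ge0.
  have k0 : 0 < k by rewrite ltr_wpDl// addr_ge0 ?nrm_ge0.
  have /closureP/(_ (e / k))[|v Dv vT] := dD (T u); first by rewrite divr_gt0.
  have h1 : nrm ('[T u, T u] : R[i]) <= nrm '[T u, v] + nrm '[T u, v - T u].
    by have := nrmB '[T u, v] '[T u, v - T u]; rewrite hdotBr opprB addrC subrK.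
  rewrite hdotxx nrm_real ger0_norm ?sqr_ge0// in h1.
  apply: le_trans h1 _; have h2 := Dbound v Dv.
  have h3 : nrm v <= nrm (T u) + nrm (v - T u).
    by have := nrmD (T u) (v - T u); rewrite addrC subrK.
  have h4 := hdot_nrm_le (T u) (v - T u).
  have h5 : k * nrm (v - T u) <= e by rewrite mulrC -ler_pdivlMr// ltW.
  have h6 := ler_wpM2l cu h3.
  have h7 := nrm_ge0 (v - T u).
  move: h5; rewrite /k !mulrDl mulrDr in h6 *; move: h2 h4 h6 h7.
  move: (nrm '[_, _]) (nrm '[_, _]) (c * nrm u * nrm (v - T u)) (c * nrm u * nrm v)
    (c * nrm u * nrm (T u)) (nrm (T u) * nrm (v - T u)) (nrm (v - T u)) => *; lra.
have /choice[T' hT'] y : exists z, forall x, '[T x, y] = '[x, z].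
  apply: riesz => [a u v|]; first by rewrite lT hdotDl hdotZl.
  exists (c * nrm y); first by rewrite mulr_ge0 ?nrm_ge0.
  move=> u; apply: le_trans (hdot_nrm_le _ _) _.
  by rewrite mulrAC ler_wpM2r ?nrm_ge0.
by exists T' => u v.
Qed.

Lemma bounded_op_has_adj (X : hilbertType R) (T : X -> X) :
  bounded_op T -> adj T (adjoint T).
Proof.
move=> [lT cT].
suff [T' h] : exists T', adj T T' by rewrite (adj_adjoint h).
apply: closed_graph => // x y h.
apply/eqP; rewrite -subr_eq0; apply/eqP/nrm_eq0/eqP.
rewrite eq_le nrm_ge0 andbT; apply: eps_le => e e0; rewrite add0r.
have e2 : 0 < e / 2 by rewrite divr_gt0.
have /nbhs_nrmP[d d0 hd] : \forall u \near x, nrm (T u - T x) < e / 2.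
  have /cvgrPdist_lt/(_ (e / 2)%:C%C) := cT x.
  rewrite ltcR => /(_ e2) ?; near=> u; rewrite -ltcR -nrmE distrC.
  by near: u.
have [|u [ux uy]] := h (Num.min d (e / 2)); first by rewrite lt_min d0.
rewrite !lt_min in ux uy; have /andP[ud _] := ux; have /andP[_ uy'] := uy.
apply: le_trans (nrm_triangle (T u) _ _) _; rewrite nrmBC (splitr e).
by rewrite lerD// ltW// hd.
Unshelve. all: by end_near. Qed.

End Adjoint.

(* Testing against inner products turns an identity between vectors into a
   polynomial identity in R[i]. *)
Ltac vector_ring :=
  apply: hdot_injl => ?;
  rewrite ?(hdotDl, hdotBl, hdotNl, hdotZl, hdot0l); ring.

Section LinearMaps.
Variables (R : realType) (Z W : lmodType R[i]) (T : Z -> W).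
Implicit Types (u v : Z) (a : R[i]).

Lemma linearB_op :
  linear T -> {morph T : u v / u - v}.
Proof. by move=> lT u v; rewrite -scaleN1r addrC lT scaleN1r addrC. Qed.

Lemma linearD_op :
  linear T -> {morph T : u v / u + v}.
Proof. by move=> lT u v; rewrite -[u]scale1r lT !scale1r. Qed.

Lemma linear0_op :
  linear T -> T 0 = 0.
Proof. by move=> lT; rewrite -(subrr 0) linearB_op// subrr. Qed.

Lemma linearZ_op : linear T -> forall a u, T (a *: u) = a *: T u.
Proof. by move=> lT a u; rewrite -[a *: u]addr0 lT linear0_op// addr0. Qed.

End LinearMaps.

(** * Square roots of positive operators *)

Section PositiveOperators.
Variables (R : realType) (X : hilbertType R).
Implicit Types (T x y q r : X -> X) (u v : X).

(** Positivity tested at [u - k^-1 x u], with the upper bound tested at [x u], gives |x u|^2 <= k <x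
    u, u>. *)
Lemma positive_norm x (k : R) : adj x x -> 0 < k ->
  (forall u, 0 <= complex.Re '[x u, u] <= k * nrm u ^+ 2) ->
  forall u, nrm (x u) <= k * nrm u.
Proof.
move=> hx k0 h u; have lx := adj_linear hx.
have k0' : 0 <= k := ltW k0.
set v := x u; have /andP[h1 _] := h (u - (k^-1)%:C%C *: v).
have /andP[_ h2] := h u; have /andP[_ h3] := h v.
rewrite (linearB_op lx) (linearZ_op lx) hdotBl !hdotBr !hdotZl !hdotZr in h1.
rewrite conj_realC !(hx v) -/v hdotxx !raddfB/= !Re_realM -!(hx v) in h1.
rewrite /= -(@ler_pXn2r _ 2)// ?nnegrE ?mulr_ge0 ?nrm_ge0// exprMn.
rewrite -(ler_pM2l (x := k^-1)) ?invr_gt0//.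
have -> : k^-1 * (k ^+ 2 * nrm u ^+ 2) = k * nrm u ^+ 2.
  by rewrite expr2 !mulrA mulVf ?gt_eqF// mul1r.
have h4 : k^-1 * (k^-1 * complex.Re '[x v, v]) <= k^-1 * nrm v ^+ 2.
  apply: ler_wpM2l; first by rewrite invr_ge0.
  by rewrite ler_pdivrMl.
by move: h1 h2 h4; lra.
Qed.

(* The solution of [2 y = x + y^2], that is, [y = 1 - sqrt (1 - x)]. *)
Lemma sqrt_iteration x (k : R) : adj x x -> 0 <= k -> k < 1 ->
  (forall u, nrm (x u) <= k * nrm u) ->
  exists y, [/\ adj y y, forall u, nrm (y u) <= k * nrm u &
    forall u, y u + y u = x u + y (y u)].
Proof.
move=> hx k0 k1 bx.
pose half : R[i] := (2^-1 : R)%:C%C.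
pose y := fix y n : X -> X :=
  if n is m.+1 then fun u => half *: (x u + y m (y m u)) else fun=> 0.
have half0 : nrm half = 2^-1 by rewrite nrm_real ger0_norm// invr_ge0.
have hy n : adj (y n) (y n).
  elim: n => [|n IH] u v /=; first by rewrite hdot0l hdot0r.
  by rewrite hdotZl hdotZr conj_realC hdotDl hdotDr hx !IH.
have by_ n u : nrm (y n u) <= k * nrm u.
  elim: n u => [|n IH] u /=; first by rewrite nrm0 mulr_ge0 ?nrm_ge0.
  rewrite nrmZ half0 ler_pdivrMl//.
  apply: le_trans (nrmD _ _) _; have h1 := bx u.
  have h2 : nrm (y n (y n u)) <= k * nrm u.
    apply: le_trans (IH _) _; apply: ler_wpM2l => //.
    by apply: le_trans (IH _) _; rewrite ler_piMl ?nrm_ge0// ltW.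
  by move: h1 h2; lra.
have step n u : nrm (y n.+1 u - y n u) <= k * nrm u * k ^+ n.
  elim: n u => [|n IH] u.
    rewrite expr0 mulr1 subr0 /= addr0 nrmZ half0.
    have := bx u; have := nrm_ge0 (x u); lra.
  have -> : y n.+2 u - y n.+1 u = half *: (y n.+1 (y n.+1 u) - y n (y n u)).
    by rewrite /= -/(y n.+1) -scalerBr; congr (_ *: _); rewrite opprD addrACA subrr add0r.
  rewrite nrmZ half0 ler_pdivrMl//.
  (* Through the mixed term [y n.+1 (y n u)] the difference of squares becomes two differences of
     consecutive iterates, each with one further factor [k]; the two halves then add up to one. *)
  apply: le_trans (nrm_triangle (y n.+1 (y n u)) _ _) _.
  have h1 : nrm (y n.+1 (y n.+1 u) - y n.+1 (y n u)) <= k * (k * nrm u * k ^+ n).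
    rewrite -(linearB_op (adj_linear (hy n.+1))).
    by apply: le_trans (by_ _ _) _; exact: ler_wpM2l.
  have h2 : nrm (y n.+1 (y n u) - y n (y n u)) <= k * (k * nrm u) * k ^+ n.
    apply: le_trans (IH _) _; apply: ler_wpM2r; first exact: exprn_ge0.
    exact: ler_wpM2l.
  by rewrite exprS; move: h1 h2; set a := k ^+ n; set b := nrm u; lra.
have /choice[L hL] u : exists l, lim_to (y^~ u) l /\
    forall n, nrm (l - y n u) <= k * nrm u * k ^+ n / (1 - k).
  have [|l ul hl] := geometric_lim _ k0 k1 (step^~ u).
    by rewrite mulr_ge0 ?nrm_ge0.
  by exists l.
have bL u : nrm (L u) <= k * nrm u.
  rewrite -[L u]subr0; apply: (lim_nrm_le (hL u).1 (n := 0)) => m _.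
  by rewrite subr0.
have close (a e : R) : 0 <= a -> 0 < e -> exists n, a * k ^+ n / (1 - k) <= e.
  move=> a0 e0; have k1' : 0 < 1 - k by rewrite subr_gt0.
  have [|N hN] := @expr_small _ k (e * (1 - k) / (a + 1)) k0 k1.
    by rewrite divr_gt0 ?mulr_gt0// ltr_wpDl.
  exists N; rewrite ler_pdivrMr//; have := hN N (leqnn N).
  rewrite ltr_pdivlMr ?ltr_wpDl// mulrDr mulr1 => h.
  have := exprn_ge0 N k0; rewrite mulrC; lra.
exists L; split => //.
- move=> u v; apply/eqP; rewrite -subr_eq0; apply/eqP/nrm_eq0/eqP.
  rewrite eq_le nrm_ge0 andbT; apply: eps_le => e e0; rewrite add0r.
  have [|n hn] := close ((k * nrm u * nrm v) *+ 2) e _ e0.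
    by rewrite mulrn_wge0// !mulr_ge0 ?nrm_ge0.
  have -> : '[L u, v] - '[u, L v] = '[L u - y n u, v] - '[u, L v - y n v].
    by rewrite hdotBl hdotBr hy opprB addrA subrK.
  apply: le_trans (nrmB _ _) _; apply: le_trans hn.
  apply: le_trans (lerD (hdot_nrm_le _ _) (hdot_nrm_le _ _)) _.
  have h1 := ler_wpM2r (nrm_ge0 v) ((hL u).2 n).
  have h2 := ler_wpM2l (nrm_ge0 u) ((hL v).2 n).
  apply: le_trans (lerD h1 h2) _.
  by rewrite le_eqVlt; apply/orP; left; apply/eqP; rewrite mulr2n; ring.
- move=> u; apply/eqP; rewrite -subr_eq0; apply/eqP/nrm_eq0/eqP.
  rewrite eq_le nrm_ge0 andbT; apply: eps_le => e e0; rewrite add0r.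
  (* The 4 counts the error terms in the identity [E] below. *)
  have [|n hn] := close ((k * nrm u) *+ 4) e _ e0.
    by rewrite mulrn_wge0// !mulr_ge0 ?nrm_ge0.
  have E : L u + L u - (x u + L (L u)) =
      (L u - y n.+1 u) + (L u - y n.+1 u) - ((L (L u) - y n (L u)) + y n (L u - y n u)).
    rewrite (linearB_op (adj_linear (hy n))).
    have -> : L u - y n.+1 u + (L u - y n.+1 u) = L u + L u - (x u + y n (y n u)).
      rewrite addrACA -opprD; congr (_ - _); rewrite /= -scalerDl -rmorphD/=.
      have -> : (2^-1 + 2^-1 : R) = 1 by rewrite [RHS]splitr div1r.
      by rewrite scale1r.
    by vector_ring.
  rewrite E; apply: le_trans (nrmB _ _) _; apply: le_trans hn.
  apply: le_trans (lerD (nrmD _ _) (nrmD _ _)) _.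
  set K := (k * nrm u * k ^+ n / (1 - k)).
  have k1' : 0 < 1 - k by rewrite subr_gt0.
  have K0 : 0 <= K.
    by rewrite divr_ge0 ?mulr_ge0 ?nrm_ge0 ?exprn_ge0// ltW.
  have h1 : nrm (L u - y n.+1 u) <= K.
    apply: le_trans ((hL u).2 _) _; rewrite ler_pM2r ?invr_gt0//.
    by rewrite ler_wpM2l ?mulr_ge0 ?nrm_ge0// exprS ler_piMl ?exprn_ge0// ltW.
  have h2 : nrm (L (L u) - y n (L u)) <= K.
    apply: le_trans ((hL _).2 n) _; rewrite ler_pM2r ?invr_gt0//.
    apply: ler_wpM2r; first exact: exprn_ge0.
    apply: ler_wpM2l => //; apply: le_trans (bL u) _.
    by rewrite ler_piMl ?nrm_ge0// ltW.
  have h3 : nrm (y n (L u - y n u)) <= K.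
    apply: le_trans (by_ _ _) _; apply: le_trans ((hL u).2 n).
    by rewrite ler_piMl ?nrm_ge0// ltW.
  have -> : k * nrm u *+ 4 * k ^+ n / (1 - k) = K *+ 4.
    by rewrite /K !mulrnAl.
  by move: h1 h2 h3; rewrite !mulrS mulr0n; lra.
Qed.

(** A self-adjoint operator that is bounded below has trivial kernel, hence dense range; the lower
    bound turns preimages of an approximating sequence into a Cauchy sequence. *)
Lemma coercive_surjective T (c : R) : adj T T -> 0 < c ->
  (forall u, c * nrm u <= nrm (T u)) -> forall v, exists u, T u = v.
Proof.
move=> hT c0 bT v; have lT := adj_linear hT.
have T0 := linear0_op lT.
pose S := [set w | exists u, T u = w].
have sS : linear_subspace S.
  split; first by exists 0.
  by move=> a _ _ [u <-] [w <-]; exists (a *: u + w); rewrite lT.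
have /closureP cS : closure S v.
  apply: dense_subspace => // z hz.
  have Tz : T z = 0.
    by apply: hdot_injl => w; rewrite hT hdot0l; apply: hz; exists w.
  apply: nrm_eq0; apply/eqP; rewrite eq_le nrm_ge0 andbT.
  by have := bT z; rewrite Tz nrm0 pmulr_rle0.
have /choice[u hu] (n : nat) : exists u, nrm (T u - v) < 2^-1 ^+ n.
  have [|_ [u <-] h] := cS (2^-1 ^+ n); last by exists u.
  by rewrite exprn_gt0// invr_gt0.
have half0 : 0 <= (2^-1 : R) by rewrite invr_ge0.
have half1 : (2^-1 : R) < 1 by rewrite invf_lt1// ltr1n.
have [||l ul _] := @geometric_lim _ _ u (2 / c) (2^-1) _ half0 half1.
- by rewrite divr_ge0// ltW.
- move=> n; rewrite mulrAC ler_pdivlMr// mulrC; apply: le_trans (bT _) _.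
  rewrite (linearB_op lT); apply: le_trans (nrm_triangle v _ _) _.
  rewrite (nrmBC v) mulr2n mulrDl mul1r; apply: lerD; last exact/ltW/hu.
  apply: le_trans (ltW (hu _)) _; rewrite exprS ler_piMl ?exprn_ge0// ltW//.
have [C C0 hC] := adj_bounded hT.
exists l; apply/eqP; rewrite -subr_eq0; apply/eqP/nrm_eq0/eqP.
rewrite eq_le nrm_ge0 andbT; apply: eps_le => e e0; rewrite add0r.
have C1 : 0 < C + 1 by rewrite ltr_wpDl.
have [|N hN] := ul (e / 2 / (C + 1)); first by rewrite !divr_gt0.
have [|N' hN'] := @expr_small R (2^-1) (e / 2) half0 half1; first by rewrite divr_gt0.
set n := maxn N N'; have h1 := hN n (leq_maxl _ _).
have h2 := hN' n (leq_maxr _ _).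
apply: le_trans (nrm_triangle (T (u n)) _ _) _; rewrite nrmBC (splitr e) lerD//.
  rewrite -(linearB_op lT); apply: le_trans (hC _) _.
  apply: (@le_trans _ _ ((C + 1) * nrm (u n - l))).
    by rewrite ler_wpM2r ?nrm_ge0// lerDl.
  by rewrite mulrC -ler_pdivlMr// ltW.
exact/ltW/(lt_trans (hu n)).
Qed.

(** For large [m] the operator x = 1 - T/m has norm less than 1. If y solves 2 y = x + y^2, then
    [r0] = 1 - y satisfies [r0]^2 = T/m; being bounded below, [r0] is invertible, and [q] is its
    inverse divided by the square root of [m]. *)
Lemma positive_inv_sqrt T (c : R) : adj T T -> 0 < c ->
  (forall u, c * nrm u ^+ 2 <= complex.Re '[T u, u]) ->
  exists q r, [/\ adj q q, forall u, q (T (q u)) = u,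
    forall u, q (r u) = u & forall u, r (q u) = u].
Proof.
move=> hT c0 pT.
have [C C0 hC] := adj_bounded hT.
pose m := C + 1; have m0 : 0 < m by rewrite ltr_wpDl.
(* The maximum keeps [k] positive, as [positive_norm] requires. *)
pose k := Num.max (1 - c / m) 2^-1.
have k0 : 0 < k by rewrite lt_max invr_gt0 ltr0n orbT.
have k1 : k < 1 by rewrite gt_max gtrBl divr_gt0//= invf_lt1// ltr1n.
pose x u := u - (m^-1)%:C%C *: T u.
have hx : adj x x.
  by move=> u v; rewrite hdotBl hdotBr hdotZl hdotZr conj_realC hT.
have Tle u : complex.Re '[T u, u] <= C * nrm u ^+ 2.
  apply: le_trans (Re_le_nrm _) _; apply: le_trans (hdot_nrm_le _ _) _.
  by rewrite expr2 mulrA ler_wpM2r ?nrm_ge0.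
have bx : forall u, nrm (x u) <= k * nrm u.
  apply: positive_norm => // u.
  rewrite hdotBl hdotZl hdotxx raddfB/= Re_realM.
  have h1 := Tle u; have h2 := pT u; have n0 := sqr_ge0 (nrm u).
  apply/andP; split.
    rewrite subr_ge0 ler_pdivrMl//; apply: le_trans h1 _.
    by rewrite ler_wpM2r// lerDl.
  apply: (@le_trans _ _ ((1 - c / m) * nrm u ^+ 2)).
    rewrite mulrBl mul1r lerD2l lerN2 [c / m]mulrC -mulrA ler_pM2l ?invr_gt0//.
  by rewrite ler_wpM2r// le_max lexx.
have [y [hy by_ yE]] := sqrt_iteration hx (ltW k0) k1 bx.
have ly := adj_linear hy.
pose r0 u := u - y u.
have hr0 : adj r0 r0 by move=> u v; rewrite hdotBl hdotBr hy.
have r0E u : r0 (r0 u) = (m^-1)%:C%C *: T u.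
  have yE' : y (y u) = y u + y u - x u by rewrite yE addrC addKr.
  by rewrite /r0 (linearB_op ly) yE' /x; vector_ring.
have r0_bound u : c / (C + 1) * nrm u <= (1 + k) * nrm (r0 u).
  have r0b v : nrm (r0 v) <= (1 + k) * nrm v.
    by apply: le_trans (nrmB _ _) _; rewrite mulrDl mul1r lerD2l.
  apply: le_trans (r0b _); rewrite r0E nrmZ nrm_real ger0_norm; last first.
    by rewrite invr_ge0 ltW.
  rewrite [c / _]mulrC -mulrA ler_pM2l ?invr_gt0//.
  have [->|u0] := eqVneq u 0; first by rewrite nrm0 mulr0 nrm_ge0.
  rewrite -(ler_pM2r (nrm_neq0 u0)) -mulrA -expr2.
  apply: le_trans (pT u) _; apply: le_trans (Re_le_nrm _) _.
  exact: hdot_nrm_le.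
have [d d0 hd] : exists2 d : R, 0 < d & forall u, d * nrm u <= nrm (r0 u).
  have k1' : 0 < 1 + k by rewrite addr_gt0.
  exists (c / (C + 1) / (1 + k)); first by rewrite !divr_gt0.
  by move=> u; rewrite mulrAC ler_pdivrMr// [X in _ <= X]mulrC.
have r0_inj : injective r0.
  move=> u v /eqP; rewrite -subr_eq0 -(linearB_op (adj_linear hr0)) => /eqP uv.
  apply/eqP; rewrite -subr_eq0; apply/eqP/nrm_eq0/eqP; rewrite eq_le nrm_ge0.
  by have := hd (u - v); rewrite uv nrm0 pmulr_rle0// => ->.
have /choice[p hp] := coercive_surjective hr0 d0 hd.
pose s : R := Num.sqrt m.
have s0 : 0 < s by rewrite sqrtr_gt0.
have sE : (s^-1)%:C%C * (s^-1)%:C%C * m%:C%C = 1 :> R[i].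
  rewrite -!rmorphM/=.
  by rewrite -[m](sqr_sqrtr (ltW m0)) -/s -invfM -expr2 mulVf// expf_eq0 gt_eqF.
have rp u : p (r0 u) = u by apply: r0_inj; rewrite hp.
have hpp : adj p p.
  by move=> u v; rewrite -{1}(hp v) -hr0 hp.
have lp := adj_linear hpp; have lT := adj_linear hT; have lr0 := adj_linear hr0.
have TE u : T u = m%:C%C *: r0 (r0 u).
  by rewrite r0E scalerA -rmorphM/= mulfV ?gt_eqF// scale1r.
exists (fun u => (s^-1)%:C%C *: p u), (fun u => s%:C%C *: r0 u); split.
- by move=> u v; rewrite hdotZl hdotZr conj_realC hpp.
- move=> u; rewrite TE !(linearZ_op lr0) !(linearZ_op lp) hp rp !scalerA.
  by rewrite mulrCA mulrC sE scale1r.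
- move=> u; rewrite (linearZ_op lp) rp scalerA -rmorphM/= mulVf ?gt_eqF//.
  by rewrite scale1r.
- move=> u; rewrite (linearZ_op lr0) hp scalerA -rmorphM/= mulfV ?gt_eqF//.
  by rewrite scale1r.
Qed.

End PositiveOperators.

(** * The transfer kernel and its J-factorization *)

Section MasterIdentity.
Variables (R : realType) (X K : hilbertType R) (Omega : set R[i]).
Variables (Gam : R[i] -> X -> K) (Gam' : R[i] -> K -> X).
Variables (tau tau' : R[i] -> X -> X) (J : K -> K) (k : R[i]).
Hypothesis Omega_sym : forall z, Omega z -> Omega z^*.
Hypothesis adj_Gam : forall z, Omega z -> adj (Gam z) (Gam' z).
Hypothesis adj_tau : forall z, Omega z -> adj (tau z) (tau' z).
Hypotheses (adj_J : adj J J) (JK : involutive J) (conj_k : k^* = - k).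
Hypothesis Gam_diff : forall z w, Omega z -> Omega w -> forall f,
  Gam z f - Gam w f = (z - w) *: Gam z (tau w f).
Hypothesis deBranges : forall z w, Omega z -> Omega w -> forall f g,
  '[f, tau w g] - '[tau z f, g] + (z - w^*) * '[tau z f, tau w g] =
  - k * '[J (Gam z f), Gam w g].

Definition transfer (z w : R[i]) (u : K) : K :=
  J u + (k * (z - w^*)) *: Gam z (Gam' w u).

Lemma adj_transfer z w : Omega z -> Omega w -> adj (transfer z w) (transfer w z).
Proof.
move=> Oz Ow u v; rewrite /transfer hdotDl hdotDr hdotZl hdotZr adj_J.
rewrite (adj_Gam Oz) -(adj_sym (adj_Gam Ow)).
rewrite rmorphM/= conj_k rmorphB/= conjCK; congr (_ + _ * _).
by rewrite mulNr -mulrN opprB.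
Qed.

Lemma transfer_conj z u : transfer z z^* u = J u.
Proof. by rewrite /transfer conjCK subrr mulr0 scale0r addr0. Qed.

(** At z = w' the quadratic term of [deBranges] drops out, and what remains is an operator
    identity. *)
Lemma tau_adj_diff w f : Omega w ->
  k *: Gam' w (J (Gam w^* f)) = tau w^* f - tau' w f.
Proof.
move=> Ow; apply: hdot_injl => g; have Ow' := Omega_sym Ow.
have := deBranges Ow' Ow f g; rewrite subrr mul0r addr0 => h.
rewrite hdotZl hdotBl (adj_sym (adj_Gam Ow)) (adj_sym (adj_tau Ow)).
by rewrite -[LHS]opprK -mulNr -h opprB.
Qed.

Lemma Gam_adj_diff z w : Omega z -> Omega w -> forall u,
  Gam' z u - Gam' w u = (z - w)^* *: tau' w (Gam' z u).
Proof.
move=> Oz Ow u; apply: hdot_inj => f; rewrite hdotBr hdotZr conjCK.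
rewrite -(adj_Gam Oz) -(adj_Gam Ow) -hdotBl (Gam_diff Oz Ow) hdotZl.
by rewrite (adj_Gam Oz) (adj_tau Ow).
Qed.

(** Only the product Gamma(z) Gamma(m)^* J Gamma(m') Gamma(w)^* is not yet of the right shape.
    [tau_adj_diff] replaces its three inner factors by a difference of tau(m') and the adjoint of
    tau(m); the former is absorbed to the left by [Gam_diff], the latter to the right by
    [Gam_adj_diff], and everything telescopes. *)
Lemma transfer_comp z m w : Omega z -> Omega m -> Omega w -> forall u,
  transfer z m (J (transfer m^* w u)) = transfer z w u.
Proof.
move=> Oz Om Ow u; have Om' := Omega_sym Om.
have lG := adj_linear (adj_Gam Oz); have lG' := adj_linear (adj_sym (adj_Gam Om)).
have lJ := adj_linear adj_J.
rewrite /transfer; set x := Gam' w u; set a := z - m^*; set b := m^* - w^*.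
rewrite !(linearD_op lJ, linearZ_op lJ, linearD_op lG', linearZ_op lG') !JK.
have E1 : k *: Gam' m (J (Gam m^* x)) = tau m^* x - tau' m x by exact: tau_adj_diff.
have E2 : a *: Gam z (tau m^* x) = Gam z x - Gam m^* x by rewrite Gam_diff.
have E3 : b *: tau' m x = Gam' m u - x.
  have := Gam_adj_diff Ow Om u; rewrite -/x => h; rewrite -opprB h -scaleNr -rmorphN/=.
  by rewrite opprB rmorphB.
have -> : (k * b) *: Gam' m (J (Gam m^* x)) = b *: (tau m^* x - tau' m x).
  by rewrite -E1 scalerA mulrC.
rewrite (linearD_op lG) [b *: _]scalerBr (linearB_op lG) E3.
rewrite (linearZ_op lG) (linearB_op lG).
have -> : (k * a) *: (Gam z (Gam' m u) +
    (b *: Gam z (tau m^* x) - (Gam z (Gam' m u) - Gam z x)))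
  = (k * b) *: (a *: Gam z (tau m^* x)) + (k * a) *: Gam z x.
  by vector_ring.
rewrite E2.
have -> : z - w^* = a + b by rewrite /a /b addrA subrK.
by vector_ring.
Qed.

End MasterIdentity.

Section HilbertSumFacts.
Variables (R : realType) (X : hilbertType R).

Lemma hdot_pair (u v : hsum X X) : '[u, v] = '[u.1, v.1] + '[u.2, v.2].
Proof. by []. Qed.

Lemma adj_J1 : adj (@J1 R X) (@J1 R X).
Proof. by move=> u v; rewrite !hdot_pair/= addrC. Qed.

Lemma nrm_pair_sqr (u : hsum X X) : nrm u ^+ 2 = nrm u.1 ^+ 2 + nrm u.2 ^+ 2.
Proof. by apply: complexI; rewrite rmorphD/= -!hdotxx hdot_pair. Qed.

Lemma nrm_fst (u : hsum X X) : nrm u.1 <= nrm u.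
Proof. by rewrite -lecR -!nrmE; exact: hsum_norm_fst. Qed.

Lemma nrm_inl (x : X) : nrm ((x, 0) : hsum X X) = nrm x.
Proof.
apply/eqP; rewrite -(@eqrXn2 _ 2)// ?nrm_ge0//.
by rewrite nrm_pair_sqr/= nrm0 expr0n addr0.
Qed.

End HilbertSumFacts.

Section Factorization.
Variables (R : realType) (X : hilbertType R) (Omega : set R[i]).
Let K := hsum X X.
Let J : K -> K := @J1 R X.
Variables (A A' B B' tau tau' : R[i] -> X -> X) (k : R[i]).
Let Gam z f : K := (A z f, B z f).
Let Gam' z (u : K) : X := A' z u.1 + B' z u.2.
Hypothesis Omega_sym : forall z, Omega z -> Omega z^*.
Hypothesis adj_A : forall z, Omega z -> adj (A z) (A' z).
Hypothesis adj_B : forall z, Omega z -> adj (B z) (B' z).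
Hypothesis adj_tau : forall z, Omega z -> adj (tau z) (tau' z).
Hypothesis conj_k : k^* = - k.
Hypothesis Gam_diff : forall z w, Omega z -> Omega w -> forall f,
  Gam z f - Gam w f = (z - w) *: Gam z (tau w f).
Hypothesis deBranges : forall z w, Omega z -> Omega w -> forall f g,
  '[f, tau w g] - '[tau z f, g] + (z - w^*) * '[tau z f, tau w g] =
  - k * '[J (Gam z f), Gam w g].
Hypothesis A_coercive : forall z, Omega z ->
  exists2 d : R, 0 < d & forall u, d * nrm u <= nrm (A' z u).

Let N z w : K -> K := transfer Gam Gam' J k z w.

Lemma adj_Gam_pair z : Omega z -> adj (Gam z) (Gam' z).
Proof.
by move=> Oz u v; rewrite hdot_pair/= /Gam' hdotDr adj_A// adj_B.
Qed.

Lemma AA_inv_sqrt z (c : R) : Omega z -> 0 < c ->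
  exists q r, [/\ adj q q, forall u, q (c%:C%C *: A z (A' z (q u))) = u,
    forall u, q (r u) = u & forall u, r (q u) = u].
Proof.
move=> Oz c0; have [d d0 hd] := A_coercive Oz.
have lA := adj_linear (adj_A Oz).
apply: (@positive_inv_sqrt _ _ (fun u => c%:C%C *: A z (A' z u)) (c * d ^+ 2)).
- move=> u v; rewrite hdotZl hdotZr conj_realC (adj_A Oz).
  by rewrite -(adj_sym (adj_A Oz)).
- by rewrite mulr_gt0// exprn_gt0.
- move=> u; rewrite hdotZl (adj_A Oz) hdotxx Re_realM/= -mulrA ler_pM2l//.
  by rewrite -exprMn ler_pXn2r// nnegrE ?mulr_ge0 ?nrm_ge0// ltW.
Qed.

(** Gram-Schmidt for the indefinite form <M u, u>: it is negative definite on the first summand,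
    whose M-orthogonal complement is the image of the second summand under the inverse of M, where
    the form is positive definite. Normalizing both parts by [q] and [q'] brings M to [D] = diag(-1,
    1), and a rotation by 45 degrees brings [D] to J. *)
Lemma J_congruence b (c : R) : Omega b -> 0 < c -> k * (b - b^*) = - c%:C%C ->
  exists S S', [/\ adj S S', forall u, S' (N b b (S u)) = J u &
    forall u, S (J (S' u)) = J (N b^* b^* (J u))].
Proof.
move=> Ob c0 kb; have Ob' := Omega_sym Ob.
have hN z w : Omega z -> Omega w -> adj (N z w) (N w z).
  by move=> Oz Ow; apply: (adj_transfer adj_Gam_pair (@adj_J1 R X) conj_k).
have JK : involutive J by case.
have Ncomp z m w : Omega z -> Omega m -> Omega w -> forall u,
    N z m (J (N m^* w u)) = N z w u.
  by move=> *; apply: (transfer_comp Omega_sym adj_Gam_pair adj_tau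
    (@adj_J1 R X) JK Gam_diff deBranges).
pose M := N b b; pose Minv u := J (N b^* b^* (J u)).
have MMinv u : M (Minv u) = u.
  by rewrite /M /Minv Ncomp// /N transfer_conj JK.
have MinvM u : Minv (M u) = u.
  rewrite /M /Minv -{3}[b]conjCK Ncomp// ?conjCK//.
  by rewrite /N -{2}[b]conjCK transfer_conj JK.
have hM : adj M M by exact: hN.
have hMinv : adj Minv Minv.
  by move=> u v; rewrite adj_J1 hN// adj_J1.
have lM := adj_linear hM; have lMinv := adj_linear hMinv.
have [q [r [hq qaq qr rq]]] := AA_inv_sqrt Ob c0.
have [q' [r' [hq' qaq' qr' rq']]] := AA_inv_sqrt Ob' c0.
have lq := adj_linear hq; have lq' := adj_linear hq'.
have kb' : k * (b^* - b^*^*) = c%:C%C by rewrite conjCK -opprB mulrN kb opprK.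
(* [J] swaps the components, so it contributes nothing to the diagonal blocks. *)
have M1 x : (M (x, 0)).1 = - (c%:C%C *: A b (A' b x)).
  rewrite /M /N /transfer/= kb scaleNr add0r /Gam'/=.
  by rewrite (linear0_op (adj_linear (adj_sym (adj_B Ob)))) addr0.
have Minv2 x : (Minv (0, x)).2 = c%:C%C *: A b^* (A' b^* x).
  rewrite /Minv /N /transfer /= kb' add0r /Gam'/=.
  by rewrite (linear0_op (adj_linear (adj_sym (adj_B Ob')))) addr0.
pose S0 (u : K) : K := (q u.1, 0) + Minv (0, q' u.2).
pose S0' (u : K) : K := (q u.1, q' (Minv u).2).
have hS0 : adj S0 S0'.
  move=> u v; rewrite /S0 /S0' hdotDl hMinv !hdot_pair/= !hdot0l addr0 add0r.
  by rewrite hq hq'.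
pose D (u : K) : K := (- u.1, u.2).
have MS0 u : M (S0 u) = M (q u.1, 0) + (0, q' u.2).
  by rewrite /S0 (linearD_op lM) MMinv.
have MS01 u : (M (S0 u)).1 = - (c%:C%C *: A b (A' b (q u.1))).
  rewrite MS0 -M1; exact: addr0.
have MS02 u : (M (S0 u)).2 = (M (q u.1, 0)).2 + q' u.2 by rewrite MS0.
have S0MS0 u : S0' (M (S0 u)) = D u.
  rewrite /S0' MinvM MS01 -scaleN1r (linearZ_op lq) qaq scaleN1r /D.
  have -> : (S0 u).2 = c%:C%C *: A b^* (A' b^* (q' u.2)).
    by rewrite -Minv2; exact: add0r.
  by rewrite qaq'.
(* The equation [M (S0 u) = M w] is triangular in the components of [u]. Surjectivity upgrades
   [S0' M S0 = D] to [S0 D S0' = Minv], on which the third claim rests. *)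
have S0_surj w : exists u, S0 u = w.
  pose u1 := - q (M w).1.
  pose u2 := r' ((M w).2 - (M (q u1, 0)).2).
  exists (u1, u2); rewrite -[LHS]MinvM -[RHS]MinvM; congr Minv.
  rewrite [LHS]surjective_pairing [RHS]surjective_pairing MS01 MS02.
  rewrite -[(u1, u2).1]/u1 -[(u1, u2).2]/u2 qr' [_ + (_ - _)]addrC subrK.
  have -> : c%:C%C *: A b (A' b (q u1)) = r u1 by rewrite -[LHS]rq qaq.
  have -> : r u1 = - (M w).1.
    by rewrite -[RHS]rq -[- (M w).1]scaleN1r (linearZ_op lq) scaleN1r.
  by rewrite opprK.
have lS0 := adj_linear hS0.
pose h : R[i] := (Num.sqrt 2)^-1%:C%C.
have hE : h * h + h * h = 1.
  rewrite -!rmorphM -rmorphD/= -!invfM -!expr2 sqr_sqrtr ?ler0n//.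
  by rewrite -[RHS](rmorph1 (real_complex R)); congr (_%:C%C); rewrite -div1r -splitr.
have hC : h^* = h by rewrite conj_realC.
pose H (u : K) : K := (h *: (u.1 - u.2), h *: (u.1 + u.2)).
pose H' (u : K) : K := (h *: (u.1 + u.2), h *: (u.2 - u.1)).
have hH : adj H H'.
  move=> u v; rewrite !hdot_pair/= !hdotZl !hdotZr hC !hdotDl !hdotDr hdotNl hdotNr; ring.
have h2 : h * h = 1 - h * h by rewrite -hE addrK.
have HDH u : H' (D (H u)) = J u.
  rewrite /H' /D /H /J /J1/=; congr pair.
    by rewrite -[u.2 in RHS]scale1r -hE; vector_ring.
  by rewrite -[u.1 in RHS]scale1r -hE; vector_ring.
have HJH u : H (J (H' u)) = D u.
  rewrite /H' /D /H /J /J1/=; congr pair.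
    by rewrite -[u.1 in RHS]scale1r -hE; vector_ring.
  by rewrite -[u.2 in RHS]scale1r -hE; vector_ring.
exists (fun u => S0 (H u)), (fun u => H' (S0' u)); split.
- by move=> u v; rewrite hS0 hH.
- by move=> u; rewrite -/M S0MS0 HDH.
- move=> v; rewrite HJH -/(Minv v); have [w wE] := S0_surj (Minv v).
  by rewrite -{1}[v]MMinv -wE S0MS0 /D/= opprK -surjective_pairing.
Qed.

End Factorization.

(** * Compactness *)

Section TotallyBounded.
Variable R : realType.
Implicit Types X Z W : hilbertType R.

(* The image of the unit ball is totally bounded: for every [e] it is covered
   by finitely many pieces, coded by colours, of diameter less than [e]. *)
Definition tot_bounded X Z (D : X -> Z) := forall e : R, 0 < e ->
  exists (I : finType) (c : X -> I), forall u v, nrm u <= 1 -> nrm v <= 1 ->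
    c u = c v -> nrm (D u - D v) < e.

Lemma tot_bounded_ext X Z (D D' : X -> Z) : D =1 D' -> tot_bounded D -> tot_bounded D'.
Proof. by move=> /funext ->. Qed.

Lemma tot_boundedD X Z (D1 D2 : X -> Z) : tot_bounded D1 -> tot_bounded D2 ->
  tot_bounded (fun u => D1 u + D2 u).
Proof.
move=> t1 t2 e e0; have e2 : 0 < e / 2 by rewrite divr_gt0.
have [I1 [c1 h1]] := t1 _ e2; have [I2 [c2 h2]] := t2 _ e2.
exists (I1 * I2)%type, (fun u => (c1 u, c2 u)) => u v u1 v1 [E1 E2].
rewrite opprD addrACA; apply: le_lt_trans (nrmD _ _) _.
by rewrite (splitr e) ltrD// ?h1 ?h2.
Qed.

Lemma tot_bounded_left X Z W (D : X -> Z) (S : Z -> W) :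
  linear S -> bounded_by S -> tot_bounded D -> tot_bounded (fun u => S (D u)).
Proof.
move=> lS [C C0 hC] t e e0; have C1 : 0 < C + 1 by rewrite ltr_wpDl.
have [I [c h]] := t _ (divr_gt0 e0 C1).
exists I, c => u v u1 v1 /(h _ _ u1 v1) uv; rewrite -(linearB_op lS).
apply: le_lt_trans (hC _) _.
apply: (@le_lt_trans _ _ ((C + 1) * nrm (D u - D v))).
  by rewrite ler_wpM2r ?nrm_ge0// lerDl.
by rewrite mulrC -ltr_pdivlMr.
Qed.

Lemma tot_bounded_scale X Z (D : X -> Z) (a : R[i]) : tot_bounded D ->
  tot_bounded (fun u => a *: D u).
Proof.
apply: (@tot_bounded_left X Z Z D (fun u => a *: u)).
  by move=> b u v; rewrite scalerDr !scalerA mulrC.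
by exists (nrm a) => [|u]; rewrite ?nrm_ge0// nrmZ.
Qed.

Lemma tot_bounded_right X Z W (D : Z -> W) (S : X -> Z) :
  linear D -> bounded_by S -> tot_bounded D -> tot_bounded (fun u => D (S u)).
Proof.
move=> lD [C C0 hC] t e e0; have C1 : 0 < C + 1 by rewrite ltr_wpDl.
have [I [c h]] := t _ (divr_gt0 e0 C1).
pose r : R[i] := ((C + 1)^-1)%:C%C.
have nr : nrm r = (C + 1)^-1 by rewrite nrm_real ger0_norm// invr_ge0 ltW.
have small u : nrm u <= 1 -> nrm (r *: S u) <= 1.
  move=> u1; rewrite nrmZ nr ler_pdivrMl// mulr1; apply: le_trans (hC _) _.
  by apply: le_trans (_ : C * 1 <= _); rewrite ?mulr1 ?lerDl// ler_piMr.
exists I, (fun u => c (r *: S u)) => u v u1 v1.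
move=> /(h _ _ (small _ u1) (small _ v1)).
rewrite !(linearZ_op lD) -scalerBr nrmZ nr ltr_pdivlMr// mulrC mulrA mulfV ?gt_eqF//.
by rewrite mul1r.
Qed.

(** Schauder: |D' u - D' v|^2 = <D D' (u - v), u - v>, so a colouring that serves [D D'] also serves
    [D']; the radius [e ^+ 2 / 2] allows for [nrm (u - v) <= 2]. *)
Lemma tot_bounded_adj X Z (D : X -> Z) D' : adj D D' -> tot_bounded D -> tot_bounded D'.
Proof.
move=> hD t; have lD := adj_linear hD; have lD' := adj_linear (adj_sym hD).
have tt := tot_bounded_right lD (adj_bounded (adj_sym hD)) t.
move=> e e0; have e2 : 0 < e ^+ 2 / 2 by rewrite divr_gt0// exprn_gt0.
have [I [c h]] := tt _ e2; exists I, c => u v u1 v1 /(h _ _ u1 v1) uv.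
rewrite -(@ltr_pXn2r _ 2)// ?nnegrE ?nrm_ge0 ?(ltW e0)//.
have -> : nrm (D' u - D' v) ^+ 2 = complex.Re '[D (D' u) - D (D' v), u - v].
  by rewrite -(linearB_op lD) -(linearB_op lD') hD hdotxx.
apply: le_lt_trans (Re_le_nrm _) _; apply: le_lt_trans (hdot_nrm_le _ _) _.
have uv2 : nrm (u - v) <= 2.
  by apply: le_trans (nrmB _ _) _; rewrite -[2]/(1 + 1) lerD.
rewrite -[e ^+ 2](@divfK _ 2)//; apply: le_lt_trans (ler_wpM2l (nrm_ge0 _) uv2) _.
by rewrite ltr_pM2r.
Qed.

Lemma compact_op_tot_bounded X (D : X -> X) : compact_op D -> tot_bounded D.
Proof.
rewrite /compact_op precompactE compact_cover => cD e e0.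
have e2 : 0 < e / 2 by rewrite divr_gt0.
have ballE (p y : X) : ball p (e / 2)%:C%C y <-> nrm (y - p) < e / 2.
  by rewrite -ball_normE/= nrmE ltcR nrmBC.
have [||F _ hF] := cD X setT (fun p => ball p (e / 2)%:C%C).
- by move=> p _; apply: ball_open; rewrite ltcR.
- by move=> y _; exists y => //; apply/ballE; rewrite subrr nrm0.
pose s : seq X := finmap.enum_fset F.
pose P u (p : X) := `[< nrm (D u - p) < e / 2 >].
have Pu u : nrm u <= 1 -> has (P u) s.
  move=> u1; have [|p pF /ballE hp] := hF (D u).
    by apply: subset_closure; exists u => //=; rewrite nrmE lecR.
  by apply/hasP; exists p => //; apply/asboolP.
(* The colour is the index of the first centre within [e / 2]; the successor is there because [find]
   ranges up to [size s]. *)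
exists 'I_(size s).+1, (fun u => inord (find (P u) s)) => u v u1 v1 /(congr1 val).
rewrite /= !inordK ?ltnS ?find_size// => uv.
have /asboolP h1 := nth_find (0 : X) (Pu u u1).
have /asboolP h2 := nth_find (0 : X) (Pu v v1).
rewrite uv in h1; apply: le_lt_trans (nrm_triangle (nth 0 s (find (P v) s)) _ _) _.
by rewrite (splitr e) ltrD// nrmBC.
Qed.

Lemma hdot_suml X n (a : 'I_n -> R[i]) (f : 'I_n -> X) z :
  '[\sum_(i < n) a i *: f i, z] = \sum_(i < n) a i * '[f i, z].
Proof.
rewrite (big_morph (fun x => '[x, z]) (fun x y => hdotDl x y z) (hdot0l z)).
by apply: eq_bigr => i _; rewrite hdotZl.
Qed.

Lemma orthonormal_family X : ~ finite_dim [set: X] -> forall n,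
  exists f : nat -> X, forall i j, (i < n)%N -> (j < n)%N ->
    '[f i, f j] = (i == j)%:R.
Proof.
move=> Xinf; elim=> [|n [f hf]]; first by exists (fun=> 0).
have [v hv] : exists v, v != \sum_(i < n) '[v, f i] *: f i.
  apply: contrapT => h; apply: Xinf; exists n, (fun i => f i); split=> // v _.
  exists (fun i => '[v, f i]); apply: contrapT => /eqP hv; apply: h.
  by exists v.
pose w := v - \sum_(i < n) '[v, f i] *: f i.
have w0 : 0 < nrm w by apply: nrm_neq0; rewrite subr_eq0.
have wf j : (j < n)%N -> '[w, f j] = 0.
  move=> jn; rewrite hdotBl hdot_suml (bigD1 (Ordinal jn))//= hf// eqxx mulr1.
  rewrite big1 ?addr0 ?subrr// => i ij; rewrite hf//.
  by move: ij; rewrite -val_eqE/= => /negbTE ->; rewrite mulr0.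
pose g := ((nrm w)^-1)%:C%C *: w.
have gf j : (j < n)%N -> '[g, f j] = 0.
  by move=> jn; rewrite hdotZl wf// mulr0.
have gg : '[g, g] = 1.
  rewrite hdotxx nrmZ nrm_real ger0_norm ?invr_ge0 ?nrm_ge0//.
  by rewrite mulVf ?gt_eqF// expr1n.
exists (fun i => if (i < n)%N then f i else g) => i j; rewrite !ltnS => ni nj.
case: ltnP => hi; case: ltnP => hj.
- exact: hf.
- by rewrite hdotC gf// conjC0 (ltn_eqF (leq_trans hi hj)).
- by rewrite gf// (gtn_eqF (leq_trans hj hi)).
- have -> : i = j by apply/eqP; rewrite eqn_leq (leq_trans ni hj) (leq_trans nj hi).
  by rewrite eqxx.
Qed.

(** Pigeonhole: among [#|I|.+1] orthonormal vectors two share a colour, while their mutual distance,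
    the square root of 2, keeps their images at least [c] apart. *)
Lemma tot_bounded_finite_dim X Z (D : X -> Z) (c : R) : linear D -> 0 < c ->
  (forall u, c * nrm u <= nrm (D u)) -> tot_bounded D -> finite_dim [set: X].
Proof.
move=> lD c0 hc t; apply: contrapT => Xinf.
have [I [col h]] := t _ c0.
have [f hf] := orthonormal_family Xinf #|I|.+1.
have f1 i : (i < #|I|.+1)%N -> nrm (f i) = 1.
  move=> iI; apply/eqP; rewrite -(@eqrXn2 _ 2)// ?nrm_ge0// expr1n.
  by apply/eqP/complexI; rewrite -hdotxx hf// eqxx.
suff /leq_card : injective (fun i : 'I_#|I|.+1 => col (f i)).
  by rewrite card_ord ltnn.
move=> i j ij; apply: contrapT => /eqP nij.
have := h (f i) (f j); rewrite !f1// lexx => /(_ isT isT ij).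
apply/negP; rewrite -leNgt -(linearB_op lD); apply: le_trans (hc _).
rewrite ler_pMr// -(@ler_pXn2r _ 2)// ?nnegrE ?nrm_ge0// expr1n nrm_sub_sqr.
by rewrite !f1// hf// val_eqE (negbTE nij)/= expr1n mul0rn subr0 lerDl.
Qed.

End TotallyBounded.

(** The balls of radius [d t / 2] about [l t] are disjoint open subsets of the line, so there are
    only countably many; but []0, 1[] has positive Lebesgue measure. *)
Lemma no_uncountable_discrete_family (R : realType) (l d : R -> R) :
  (forall t, 0 < t -> 0 < d t) ->
  (forall s t, 0 < s -> 0 < t -> s != t -> d t <= `|l s - l t|) -> False.
Proof.
move=> d0 sep.
(* The radius 1 for [t <= 0] is a default that keeps every [B t] open and nonempty. *)
pose B (t : R) := ball (l t) (if 0 < t then d t / 2 else 1).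
have B0 t : 0 < (if 0 < t then d t / 2 else 1).
  by case: ifP => // /d0 dt; rewrite divr_gt0.
have : countable (`]0, 1[%classic : set R).
  apply: (@separated_open_countable R R B) => [t|t|].
  - exact: ball_open.
  - by exists (l t); exact: ballxx.
  apply/trivIsetP => s t /=; rewrite !in_itv/= => /andP[s0 _] /andP[t0 _] st.
  rewrite -subset0 => x []; rewrite /B s0 t0 -!ball_normE/= => xs xt.
  have h1 := sep s t s0 t0 st.
  have h2 : d s <= `|l s - l t| by rewrite distrC; apply: sep; rewrite // eq_sym.
  have h3 : `|l s - l t| <= `|l s - x| + `|l t - x|.
    by rewrite (distrC (l t)); exact: ler_distD.
  by move: h1 h2 h3 xs xt; lra.
move/countable_lebesgue_measure0; rewrite lebesgue_measure_itv/= lte_fin ltr01.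
by rewrite -EFinB subr0 => /eqP; rewrite eqe oner_eq0.
Qed.

Lemma adj_bound (R : realType) (X Z : hilbertType R) (T : X -> Z) T' (C : R) :
  adj T T' -> 0 <= C -> (forall f, nrm (T f) <= C * nrm f) ->
  forall u, nrm (T' u) <= C * nrm u.
Proof.
move=> hT C0 hC u; have [T0|T0] := eqVneq (T' u) 0.
  by rewrite T0 nrm0 mulr_ge0 ?nrm_ge0.
rewrite -(ler_pM2r (nrm_neq0 T0)) -expr2.
have -> : nrm (T' u) ^+ 2 = complex.Re '[T (T' u), u] by rewrite hT hdotxx.
apply: le_trans (Re_le_nrm _) _; apply: le_trans (hdot_nrm_le _ _) _.
by rewrite mulrAC ler_wpM2r ?nrm_ge0.
Qed.

(** * Removing compactness of I - U(z) by a dilation *)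

Section NonCompactness.
Variables (R : realType) (X : hilbertType R) (Omega : set R[i]).
Let K := hsum X X.
Let J : K -> K := @J1 R X.
Variables (A A' B B' tau tau' : R[i] -> X -> X) (k : R[i]).
Let Gam z f : K := (A z f, B z f).
Let Gam' z (u : K) : X := A' z u.1 + B' z u.2.
Hypothesis Omega_sym : forall z, Omega z -> Omega z^*.
Hypothesis adj_A : forall z, Omega z -> adj (A z) (A' z).
Hypothesis adj_B : forall z, Omega z -> adj (B z) (B' z).
Hypothesis adj_tau : forall z, Omega z -> adj (tau z) (tau' z).
Hypotheses (conj_k : k^* = - k) (k0 : k != 0).
Hypothesis Gam_diff : forall z w, Omega z -> Omega w -> forall f,
  Gam z f - Gam w f = (z - w) *: Gam z (tau w f).
Hypothesis deBranges : forall z w, Omega z -> Omega w -> forall f g,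
  '[f, tau w g] - '[tau z f, g] + (z - w^*) * '[tau z f, tau w g] =
  - k * '[J (Gam z f), Gam w g].
Hypothesis A_coercive : forall z, Omega z ->
  exists2 d : R, 0 < d & forall u, d * nrm u <= nrm (A' z u).
Hypothesis A_locally_bounded : forall z, Omega z -> exists d C : R,
  [/\ 0 < d, 0 <= C & forall w, Omega w -> nrm (w - z) < d ->
    forall f, nrm (A w f) <= C * nrm f].
Hypothesis Xinf : ~ finite_dim [set: X].

Let N z w : K -> K := transfer Gam Gam' J k z w.
Let adj_N z w (Oz : Omega z) (Ow : Omega w) : adj (N z w) (N w z) :=
  adj_transfer (adj_Gam_pair adj_A adj_B) (@adj_J1 R X) conj_k Oz Ow.

(** A perturbation of A(z) A(z)^*, which is bounded below by [d ^+ 2]: the adjoints of A(w) and A(z)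
    differ by the conjugate of w - z times tau(z)^* A(w)^*, and local boundedness of A makes this at
    most [d / 2] near z. *)
Lemma AA_coercive_near z : Omega z -> exists2 d : R, 0 < d &
  forall w, Omega w -> nrm (w - z) < d ->
    exists2 c : R, 0 < c & forall u, c * nrm u <= nrm (A z (A' w u)).
Proof.
move=> Oz; have [d d0 hd] := A_coercive Oz.
have [r [C [r0 C0 hC]]] := A_locally_bounded Oz.
have [T T0 hT] := adj_bounded (adj_sym (adj_tau Oz)).
have TC0 : 0 <= T * C by rewrite mulr_ge0.
have TC : 0 < T * C + 1 by rewrite ltr_wpDl.
exists (Num.min r (d / 2 / (T * C + 1))).
  by rewrite lt_min r0 !divr_gt0.
move=> w Ow; rewrite lt_min => /andP[wr wd].
exists (d * (d / 2)); first by rewrite !mulr_gt0// invr_gt0.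
move=> u; have [->|u0] := eqVneq u 0; first by rewrite nrm0 mulr0 nrm_ge0.
have n0 := nrm_neq0 u0; have E : A' w u = A' z u + (w - z)^* *: tau' z (A' w u).
  have h := Gam_adj_diff (adj_Gam_pair adj_A adj_B) adj_tau Gam_diff Ow Oz (u, 0).
  have {}h : A' w u - A' z u = (w - z)^* *: tau' z (A' w u).
    move: h; rewrite /= !(linear0_op (adj_linear (adj_sym (adj_B _)))) //.
    by rewrite !addr0.
  by rewrite -h addrCA subrr addr0.
have h1 : nrm (A' w u) <= C * nrm u.
  by apply: (adj_bound (adj_A Ow) C0) => f; exact: hC.
have h2 := hd u; set x := A' z u in E h2 *; set y := (w - z)^* *: _ in E.
have h3 : nrm y <= d / 2 * nrm u.
  rewrite /y nrmZ nrm_conj.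
  apply: (@le_trans _ _ (nrm (w - z) * ((T * C) * nrm u))).
    rewrite ler_wpM2l ?nrm_ge0//; apply: le_trans (hT _) _.
    by rewrite -mulrA ler_wpM2l.
  rewrite mulrA ler_wpM2r ?nrm_ge0//.
  apply: (@le_trans _ _ (nrm (w - z) * (T * C + 1))).
    by rewrite ler_wpM2l ?nrm_ge0// lerDl.
  by rewrite -ler_pdivlMr// ltW.
have h4 : complex.Re '[A z (A' w u), u] = nrm x ^+ 2 + complex.Re '[y, x].
  by rewrite (adj_A Oz) -/x E hdotDl hdotxx raddfD.
have h5 : - (nrm y * nrm x) <= complex.Re '[y, x].
  rewrite lerNl -raddfN -hdotNl/=; apply: le_trans (Re_le_nrm _) _.
  by apply: le_trans (hdot_nrm_le _ _) _; rewrite nrmN.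
have h6 := le_trans (Re_le_nrm _) (hdot_nrm_le (A z (A' w u)) u).
rewrite -(ler_pM2r n0); apply: le_trans h6; rewrite h4.
have x0 := nrm_ge0 x.
have h7 : nrm y * nrm x <= d / 2 * nrm u * nrm x by rewrite ler_wpM2r.
have h8 : d * nrm u * nrm x <= nrm x * nrm x by rewrite ler_wpM2r.
have h9 : d / 2 * nrm u * (d * nrm u) <= d / 2 * nrm u * nrm x.
  by rewrite ler_wpM2l// mulr_ge0 ?nrm_ge0// divr_ge0// ltW.
by move: h5 h7 h8 h9; rewrite expr2; lra.
Qed.

(** A J-unitary factor: [dilation t] J [dilation t] = J, so composing [S] with it changes U but not
    the kernel. *)
Definition dilation (t : R) (u : K) : K := (t%:C%C *: u.1, t^-1%:C%C *: u.2).

Lemma adj_dilation t : adj (dilation t) (dilation t).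
Proof.
by move=> u v; rewrite !hdot_pair/= !hdotZl !hdotZr !conj_realC.
Qed.

Section Perturbation.
Variables (b : R[i]) (S S' : K -> K).
Hypotheses (Ob : Omega b) (hS : adj S S').
Hypothesis SJS : forall u, S (J (S' u)) = J (N b^* b^* (J u)).

Let U t z (u : K) : K := N z b (S (dilation t u)).
Let compact_defect t z := tot_bounded (fun u => u - U t z u).

Let U' t z (u : K) : K := dilation t (S' (N b z u)).

Lemma adj_U t z : Omega z -> adj (U t z) (U' t z).
Proof. by move=> Oz u v; rewrite /U /U' adj_N// hS adj_dilation. Qed.

(** By [SJS] the middle factor is J N(b', b') J, and two uses of [transfer_comp] collapse the
    product. *)
Lemma transfer_factor z w u : Omega z -> Omega w ->
  N z b (S (J (S' (N b w u)))) = N z w u.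
Proof.
move=> Oz Ow; have JK : involutive J by case.
have Ob' := Omega_sym Ob.
have Ncomp := transfer_comp Omega_sym (adj_Gam_pair adj_A adj_B) adj_tau
  (@adj_J1 R X) JK Gam_diff deBranges.
have := Ncomp b^* b^* w Ob' Ob' Ow u; rewrite conjCK => E.
by rewrite SJS -/J /N E Ncomp.
Qed.

(** N(z, w) equals U_t(z) P U_s(w)^*, where the dilations leave the antidiagonal factor [P].
    Replacing both outer factors by the identity costs only totally bounded terms, and the upper
    left block of [P] is zero. *)
Lemma compact_defect_pair t s z w : 0 < t -> 0 < s -> Omega z -> Omega w ->
  compact_defect t z -> compact_defect s w ->
  tot_bounded (fun u : X => (k * (z - w^*)) *: A z (A' w u)).
Proof.
move=> t0 s0 Oz Ow bz bw.
pose D1 u := u - U t z u; pose D2 u := u - U' s w u.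
have tD2 : tot_bounded D2.
  apply: tot_bounded_adj bw => u v; rewrite hdotBl hdotBr.
  by rewrite (adj_U s Ow).
pose P u : K := dilation t^-1 (J (dilation s^-1 u)).
pose P' u : K := dilation s^-1 (J (dilation t^-1 u)).
have hP : adj P P' by move=> u v; rewrite /P /P' adj_dilation adj_J1 adj_dilation.
have lP := adj_linear hP.
have hD1 : adj D1 (fun u => u - U' t z u).
  by move=> u v; rewrite /D1 hdotBl hdotBr (adj_U t Oz).
have lD1 := adj_linear hD1.
have dilK r (u : K) : 0 < r -> dilation r (dilation r^-1 u) = u.
  move=> r0; rewrite /dilation/= !scalerA -!rmorphM/= invrK.
  by rewrite mulfV ?mulVf ?gt_eqF// !scale1r -surjective_pairing.
have NE u : N z w u = P (u - D2 u) - D1 (P (u - D2 u)).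
  rewrite /D1 subKr /D2 subKr /P /U /U' dilK//.
  have := dilK s^-1 (S' (N b w u)); rewrite invrK invr_gt0 => -> //.
  exact/esym/transfer_factor.
pose inl (u : X) : K := (u, 0).
have binl : bounded_by inl by exists 1 => // u; rewrite nrm_inl mul1r.
have l1 : linear (fst : K -> X) by [].
have b1 : bounded_by (fst : K -> X).
  by exists 1 => // u; rewrite mul1r nrm_fst.
have hD2 : adj D2 (fun u => u - U s w u).
  by move=> u v; rewrite /D2 hdotBl hdotBr (adj_sym (adj_U s Ow)).
have lD2 := adj_linear hD2.
have t1 : tot_bounded (fun u => (P (D2 (inl u))).1).
  apply: (tot_bounded_left l1 b1).
  exact: (tot_bounded_left lP (adj_bounded hP) (tot_bounded_right lD2 binl tD2)).
have t2 : tot_bounded (fun u => (D1 (P (inl u - D2 (inl u)))).1).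
  apply: (tot_bounded_left l1 b1).
  apply: (@tot_bounded_right _ _ _ _ D1 (fun u => P (inl u - D2 (inl u)))) => //.
  have [c1 c10 h1] := adj_bounded hP; have [c2 c20 h2] := adj_bounded hD2.
  exists (c1 * (1 + c2)); first by rewrite mulr_ge0// addr_ge0.
  move=> u; apply: le_trans (h1 _) _; rewrite -mulrA ler_wpM2l//.
  apply: le_trans (nrmB _ _) _; rewrite mulrDl mul1r.
  by rewrite lerD ?nrm_inl//; apply: le_trans (h2 _) _; rewrite nrm_inl.
apply: tot_bounded_ext (tot_bounded_scale (-1) (tot_boundedD t1 t2)) => u.
have -> : (k * (z - w^*)) *: A z (A' w u) = (N z w (inl u)).1.
  rewrite /N /transfer /= add0r /Gam' /=.
  by rewrite (linear0_op (adj_linear (adj_sym (adj_B Ow)))) addr0.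
have P0 : (P (inl u)).1 = 0 by rewrite /P /dilation/= !scaler0.
have fstB (x y : K) : (x - y).1 = x.1 - y.1 by [].
rewrite NE; move: (D1 (P _)) => d.
have -> : P (inl u - D2 (inl u)) = P (inl u) - P (D2 (inl u)) := linearB_op lP _ _.
move: (P (D2 _)) => e.
by rewrite !fstB P0 sub0r scaleN1r opprD.
Qed.

(** U_s(z) is U_t(z) composed with the dilation by [r = s / t]. Eliminating U from the two defects
    leaves the identity minus this dilation, whose upper left block is the nonzero scalar 1 - r. *)
Lemma compact_defect_unique t s z : 0 < t -> 0 < s -> s != t -> Omega z ->
  compact_defect t z -> compact_defect s z -> False.
Proof.
move=> t0 s0 st Oz bt bs.
pose r := s / t.
have dilM (u : K) : dilation s u = dilation t (dilation r u).
  rewrite /dilation/= !scalerA -!rmorphM/= /r.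
  by rewrite mulrCA mulfV ?gt_eqF// mulr1 invf_div mulrA mulVf ?gt_eqF// mul1r.
pose D u := u - U t z u.
have hD : adj D (fun u => u - U' t z u).
  by move=> u v; rewrite /D hdotBl hdotBr (adj_U t Oz).
have t1 := tot_bounded_right (adj_linear hD) (adj_bounded (adj_dilation r)) bt.
have t2 := tot_boundedD bs (tot_bounded_scale (-1) t1).
pose inl (u : X) : K := (u, 0).
have binl : bounded_by inl by exists 1 => // u; rewrite nrm_inl mul1r.
have l1 : linear (fst : K -> X) by [].
have b1 : bounded_by (fst : K -> X).
  by exists 1 => // u; rewrite mul1r nrm_fst.
pose F (u : K) : K := u - dilation r u.
have hF : adj F F by move=> u v; rewrite /F hdotBl hdotBr adj_dilation.
have tF : tot_bounded F.
  apply: tot_bounded_ext t2 => u; rewrite /F.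
  have -> : U s z u = U t z (dilation r u) by rewrite /U dilM.
  by rewrite scaleN1r opprB addrA subrK.
have lF := adj_linear hF.
have tFl : tot_bounded (fun u => (F (inl u)).1).
  exact: (tot_bounded_left l1 b1 (tot_bounded_right lF binl tF)).
apply: Xinf; have r1 : r - 1 != 0.
  by rewrite subr_eq0; apply: contra st => /eqP/divr1_eq ->.
apply: (tot_bounded_finite_dim _ _ _ tFl (c := `|r - 1|)).
- move=> a u v; rewrite /F /dilation /inl/= !scalerDr !scalerA opprD addrACA.
  by rewrite scalerN scalerA [a * _]mulrC.
- by rewrite normr_gt0.
- move=> u; have -> : (F (inl u)).1 = ((1 - r)%:C%C : R[i]) *: u.
    by rewrite rmorphB/= scalerBl scale1r.
  by rewrite nrmZ nrm_real distrC.
Qed.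

Lemma exists_good_dilation :
  exists2 t : R, 0 < t & forall z, Omega z -> ~ compact_defect t z.
Proof.
apply: contrapT => nt.
have /choice[l hl] (t : R) : exists z, 0 < t -> Omega z /\ compact_defect t z.
  have [t0|t0] := boolP (0 < t); last by exists 0.
  apply: contrapT => h; apply: nt; exists t => // z Oz bz.
  by apply: h; exists z.
have /choice[d hd] (z : R[i]) : exists d : R, Omega z -> 0 < d /\
    forall w, Omega w -> nrm (w - z) < d ->
    exists2 c : R, 0 < c & forall u, c * nrm u <= nrm (A z (A' w u)).
  have [Oz|Oz] := pselect (Omega z); last by exists 0.
  by have [d d0 h] := AA_coercive_near Oz; exists d.
(* For close points that are not conjugate the block of [compact_defect_pair] is also bounded below,
   against infinite dimension. With [s = t] this makes [l t] real; with [s != t] it keeps the points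
   apart. *)
have close_false t s : 0 < t -> 0 < s -> l t != (l s)^* ->
    nrm (l s - l t) < d (l t) -> False.
  move=> t0 s0 lts near_ts; have [Ot bt] := hl t t0; have [Os bs] := hl s s0.
  have [d0 /(_ _ Os near_ts)[c c0 hc]] := hd _ Ot.
  have tb := compact_defect_pair t0 s0 Ot Os bt bs.
  have kz : 0 < nrm (k * (l t - (l s)^*)).
    by apply: nrm_neq0; rewrite mulf_neq0// subr_eq0.
  apply: Xinf.
  apply: (tot_bounded_finite_dim _ _ _ tb (c := nrm (k * (l t - (l s)^*)) * c)).
  - move=> a u v; rewrite (adj_linear (adj_sym (adj_A Os))) (adj_linear (adj_A Ot)).
    by rewrite scalerDr !scalerA [a * _]mulrC.
  - by rewrite mulr_gt0.
  - by move=> u; rewrite nrmZ -mulrA ler_wpM2l ?nrm_ge0.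
have lreal t : 0 < t -> l t = (l t)^*.
  move=> t0; apply: contrapT => /eqP lt; apply: (close_false t t t0 t0 lt).
  by rewrite subrr nrm0; have [d0 _] := hd _ (hl t t0).1.
have lE t : 0 < t -> l t = (complex.Re (l t))%:C%C.
  by move=> t0; apply/esym/RRe_real/CrealP; rewrite -lreal.
apply: (@no_uncountable_discrete_family R (fun t => complex.Re (l t)) (fun t => d (l t))).
  by move=> t t0; have [] := hd _ (hl t t0).1.
move=> s t s0 t0 st; rewrite leNgt; apply/negP => near_ts.
apply: (close_false t s t0 s0).
  rewrite -lreal//; apply/eqP => lts.
  have [Ot bt] := hl t t0; have [Os bs] := hl s s0; rewrite -lts in bs.
  exact: (compact_defect_unique t0 s0 st Ot bt bs).
by rewrite (lE s s0) (lE t t0) -rmorphB/= nrm_real -lE.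
Qed.

End Perturbation.
End NonCompactness.

(** After [n] substitutions the constant is [2 * a] plus a multiple of [2^-1 ^+ n], so the
    dependence on [c] disappears. This converts bounds for individual operators into one that is
    uniform in a parameter. *)
Lemma self_improving_bound (R : realType) (Z W : normedZmodType R[i])
  (F : Z -> W) (s : Z -> Z) (a c : R) : 0 <= a -> (forall u, nrm (F u) <= c * nrm u) ->
  (forall u, nrm (F u) <= a * nrm u + nrm (F (s u))) ->
  (forall u, nrm (s u) <= 2^-1 * nrm u) ->
  forall u, nrm (F u) <= 2 * a * nrm u.
Proof.
move=> a0 bc imp hs.
have c0 : 0 <= Num.max c 0 by rewrite le_max lexx orbT.
have key n u : nrm (F u) <= (2 * a + Num.max c 0 * 2^-1 ^+ n) * nrm u.
  elim: n u => [|n IH] u.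
    rewrite expr0 mulr1; apply: le_trans (bc u) _; rewrite ler_wpM2r ?nrm_ge0//.
    apply: (@le_trans _ _ (Num.max c 0)); first by rewrite le_max lexx.
    by rewrite lerDr mulr_ge0.
  apply: le_trans (imp u) _.
  have b0 : 0 <= 2 * a + Num.max c 0 * 2^-1 ^+ n.
    by rewrite addr_ge0 ?mulr_ge0// exprn_ge0// invr_ge0.
  have h1 := le_trans (IH (s u)) (ler_wpM2l b0 (hs u)).
  apply: le_trans (lerD (lexx _) h1) _.
  by rewrite le_eqVlt exprS; apply/orP; left; apply/eqP; field.
move=> u; apply: eps_le => e e0.
have n0 := nrm_ge0 u.
have [|||N hN] := @expr_small R (2^-1) (e / (Num.max c 0 * nrm u + 1)).
- by rewrite invr_ge0.
- by rewrite invf_lt1// ltr1n.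
- by rewrite divr_gt0// ltr_wpDl// mulr_ge0.
apply: le_trans (key N u) _; rewrite mulrDl lerD2l mulrAC.
have K0 : 0 <= Num.max c 0 * nrm u by rewrite mulr_ge0.
have K1 : 0 < Num.max c 0 * nrm u + 1 by rewrite ltr_wpDl.
apply: (@le_trans _ _ ((Num.max c 0 * nrm u + 1) * 2^-1 ^+ N)).
  by rewrite ler_wpM2r ?exprn_ge0 ?invr_ge0// lerDl.
by rewrite mulrC -ler_pdivlMr// ltW// hN.
Qed.

(** * The gauge model of a symmetric operator *)

Section GaugeModel.
Variables (R : realType) (X : hilbertType R) (E : operator X X).
Hypotheses (Elin : linear_op E) (Esimple : simple_op E) (Eclosed : closed_op E)
  (Esym : symmetric_op E).
Implicit Types (z w : R[i]) (f g x : X).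

Lemma op_rng_subspace z : linear_subspace (op_rng E z).
Proof.
have [[dom0 domP] linE] := Elin; split.
  exists 0 => //; rewrite scaler0 subr0.
  have := linE (-1) 0 0 dom0 dom0; rewrite scaler0 addr0 => ->.
  by rewrite scaleN1r addNr.
move=> a _ _ [g dg <-] [h dh <-]; exists (a *: g + h); first exact: domP.
by rewrite linE//; vector_ring.
Qed.

Lemma symmetric_real g : dom E g -> '[E g, g]^* = '[E g, g].
Proof. by move=> dg; rewrite -hdotC Esym. Qed.

Lemma op_closed f g :
  (forall e : R, 0 < e -> exists2 u, dom E u & nrm (u - f) < e /\ nrm (E u - g) < e) ->
  dom E f /\ g = E f.
Proof.
move=> h.
have cl : closed [set p : X * X | dom E p.1 /\ p.2 = E p.1] := Eclosed.
suff : [set p : X * X | dom E p.1 /\ p.2 = E p.1] (f, g) by [].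
apply: cl => B [[Q1 Q2] /= [/nbhs_nrmP[e1 e10 h1] /nbhs_nrmP[e2 e20 h2]] sub].
have [|u du [ue1 ue2]] := h (Num.min e1 e2); first by rewrite lt_min e10.
rewrite !lt_min in ue1 ue2; have /andP[? _] := ue1; have /andP[_ ?] := ue2.
exists (u, E u); split=> //; apply: sub; split; [exact: h1|exact: h2].
Qed.

(** The eigenspace [L] is closed and reduces E, which acts on it as a real scalar and hence is
    self-adjoint there; simplicity leaves only 0. *)
Lemma no_real_eigenvalue z g : z^* = z -> dom E g -> E g = z *: g -> g = 0.
Proof.
move=> zr dg Eg; have [[dom0 domP] linE] := Elin.
pose L := [set x | dom E x /\ E x = z *: x].
have E0 : E 0 = 0.
  by have := linE (-1) 0 0 dom0 dom0; rewrite scaler0 addr0 scaleN1r addNr.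
have sL : linear_subspace L.
  split; first by split; rewrite ?E0 ?scaler0.
  move=> a u v [du Eu] [dv Ev]; split; first exact: domP.
  by rewrite linE// Eu Ev; vector_ring.
have cL : closed L.
  apply: closedP => x hx.
  have [|dx xE] := @op_closed x (z *: x); last by split.
  move=> e e0; have z1 : 0 < nrm z + 1 by rewrite ltr_wpDl ?nrm_ge0.
  have [|u [du Eu] ux] := hx (Num.min e (e / (nrm z + 1))).
    by rewrite lt_min e0 divr_gt0.
  move: ux; rewrite lt_min => /andP[ux1 ux2]; exists u => //; split=> //.
  rewrite Eu -scalerBr nrmZ; apply: le_lt_trans (_ : (nrm z + 1) * nrm (u - x) < _).
    by rewrite ler_wpM2r ?nrm_ge0// lerDl.
  by rewrite mulrC -ltr_pdivlMr.
suff L0 : L = [set 0] by have : L g by []; rewrite L0.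
apply: Esimple.
  split=> // x dx; have [u Lu hu] := subspace_projection x sL cL.
  have [du Eu] := Lu; pose v := x - u.
  have dv : dom E v by rewrite /v addrC -scaleN1r; exact: domP.
  have ov l : L l -> '[l, v] = 0 by move=> Ll; rewrite hdotC hu// conjC0.
  exists u, v; split=> //; first by rewrite addrC subrK.
    by rewrite Eu; exact: linear_subspaceZ.
  by move=> l Ll; have [dl El] := Ll; rewrite -Esym// El hdotZl ov// mulr0.
split=> [x Lx|y y' Ly Ly'].
  by apply: subset_closure; split=> //; case: Lx.
have [dy Ey] := Ly; split=> [h|[_ <-] x dx [_ Ex]]; last by rewrite Esym.
split=> //; apply/eqP; rewrite -subr_eq0; apply/eqP/nrm_eq0/eqP.
rewrite -sqrf_eq0; apply/eqP/complexI; rewrite -hdotxx.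
have Lw : L (E y - y').
  by rewrite Ey; apply: linear_subspaceB => //; exact: linear_subspaceZ.
have [dw Ew] := Lw.
by rewrite [X in '[_, X]]/GRing.add/= hdotBr -h// Esym// subrr.
Qed.

(** For nonreal [z] the reality of <E g, g> excludes eigenvectors; for real [z] simplicity does. *)
Lemma regular_injective z Y g : regular_point E Y z -> dom E g ->
  E g - z *: g = 0 -> g = 0.
Proof.
move=> _ dg /eqP; rewrite subr_eq0 => /eqP Eg.
have [zr|zi] := eqVneq z^* z; first exact: (no_real_eigenvalue zr dg Eg).
have := symmetric_real dg; rewrite Eg hdotZl hdotxx rmorphM/= conj_realC.
move=> /eqP; rewrite -subr_eq0 -mulrBl mulf_eq0 subr_eq0 (negbTE zi)/=.
move=> /eqP/complexI/eqP; rewrite sqrf_eq0 => /eqP; exact: nrm_eq0.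
Qed.

Variables (Y : set X) (Omega : set R[i]) (G : X -> X).
Hypotheses (Ysub : linear_subspace Y)
  (Omega_reg : forall z, Omega z -> regular_point E Y z)
  (Gbounded : bounded_op G) (Ginj : injective G) (Grng : range G = Y).

Definition gaugeA z f := Ginv G (proj_along E Y z f).
Definition gaugeB z f := ((pi : R)%:C%C * 'i)^-1 *: adjoint G (tauY E Y z f).
Local Notation A := gaugeA.
Local Notation B := gaugeB.
Local Notation tau := (tauY E Y).

Let hG : adj G (adjoint G) := bounded_op_has_adj Gbounded.
Let lG : linear G := adj_linear hG.
Let GY x : Y (G x).
Proof. by rewrite -Grng; exists x. Qed.

(** The direct sum and the injectivity of E - z and of [G] pin down every choice made by [xget], so
    values of [tau] and [A] can be found by exhibiting a decomposition. *)
Lemma decomposition_unique z f g x : Omega z -> dom E g ->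
  f = E g - z *: g + G x -> tau z f = g /\ A z f = x.
Proof.
move=> Oz dg fE; have [[dom0 domP] linE] := Elin.
have Pf : proj_along E Y z f = G x.
  have hx : Y (G x) /\ op_rng E z (f - G x).
    by split; [exact: GY|exists g => //; rewrite fE addrK].
  rewrite /proj_along; case: xgetP => [y _ [Yy ry]|/(_ (G x))//].
  have [_ [_ MY]] := Omega_reg Oz.
  have : (op_rng E z `&` Y) (G x - y).
    split; last exact: linear_subspaceB.
    have -> : G x - y = (f - y) - (f - G x) by vector_ring.
    by apply: linear_subspaceB => //; [exact: op_rng_subspace|case: hx].
  by rewrite MY => /= /eqP; rewrite subr_eq0 => /eqP.
split; last first.
  rewrite /A Pf /Ginv; case: xgetP => [y _ /Ginj//|/(_ x)/=]; by case.
rewrite /tauY Pf; case: xgetP => [h _ [dh hE]|/(_ g)[]]; last first.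
  by split=> //; rewrite fE addrK.
apply/eqP; rewrite -subr_eq0; apply/eqP.
apply: (regular_injective (Omega_reg Oz)).
  by rewrite addrC -scaleN1r; exact: domP.
have -> : E (h - g) = E h - E g.
  by rewrite -scaleN1r addrC linE// scaleN1r addrC.
have -> : E h - E g - z *: (h - g) = (E h - z *: h) - (E g - z *: g) by vector_ring.
by rewrite hE fE addrK subrr.
Qed.

Lemma decomposition z f : Omega z -> dom E (tau z f) /\
  f = E (tau z f) - z *: tau z f + G (A z f).
Proof.
move=> Oz; have [_ [MYT _]] := Omega_reg Oz.
have : [set: X] f by []; rewrite -MYT => -[m [y [[g dg mE] Yy fE]]].
have [x _ Gx] : range G y by rewrite Grng.
rewrite -Gx -mE in fE.
by have [-> ->] := decomposition_unique Oz dg fE.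
Qed.

Lemma tau_dom z f : Omega z -> dom E (tau z f).
Proof. by move=> Oz; case: (decomposition f Oz). Qed.

Lemma E_tau z f : Omega z -> E (tau z f) = f + z *: tau z f - G (A z f).
Proof. by move=> Oz; have [_ {2}->] := decomposition f Oz; vector_ring. Qed.

Lemma decomposition_linear z a f g : Omega z ->
  tau z (a *: f + g) = a *: tau z f + tau z g /\
  A z (a *: f + g) = a *: A z f + A z g.
Proof.
move=> Oz; have [[dom0 domP] linE] := Elin.
apply: decomposition_unique => //; first by apply: domP; exact: tau_dom.
rewrite linE; [|exact: tau_dom..].
by rewrite !E_tau// lG; vector_ring.
Qed.

(** Closed graph: if u tends to f and A(z) u to x, then f - G x is a limit of elements of the range
    of E - z, which is closed. *)
Lemma adj_gaugeA z : Omega z -> adj (A z) (adjoint (A z)).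
Proof.
move=> Oz; suff [A' h] : exists A', adj (A z) A' by rewrite (adj_adjoint h).
apply: closed_graph => [a f g|f x h]; first by case: (decomposition_linear a f g Oz).
have [C C0 hC] := adj_bounded hG.
have [Mc _] := Omega_reg Oz.
suff [g dg gE] : op_rng E z (f - G x).
  have [|//] := decomposition_unique (f := f) (x := x) Oz dg.
  by rewrite gE subrK.
rewrite ((closure_id (op_rng E z)).1 Mc); apply/closureP => e e0.
have C1 : 0 < 1 + C by rewrite ltr_pwDl.
have [u [uf ux]] := h _ (divr_gt0 e0 C1).
exists (u - G (A z u)).
  exists (tau z u); first exact: tau_dom.
  by rewrite E_tau//; vector_ring.
have -> : u - G (A z u) - (f - G x) = (u - f) - G (A z u - x).
  by rewrite (linearB_op lG); vector_ring.
apply: le_lt_trans (nrmB _ _) _.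
apply: le_lt_trans (lerD (lexx _) (hC _)) _.
have -> : e = e / (1 + C) + C * (e / (1 + C)) by field; rewrite gt_eqF.
by apply: ltr_leD => //; apply: ler_wpM2l => //; exact: ltW.
Qed.

(** Closed graph, now by closedness of E: E tau(z) u = u + z tau(z) u - G A(z) u converges as soon
    as u and tau(z) u do. *)
Lemma adj_tauY z : Omega z -> adj (tau z) (adjoint (tau z)).
Proof.
move=> Oz; suff [A' h] : exists A', adj (tau z) A' by rewrite (adj_adjoint h).
apply: closed_graph => [a f g|f g h]; first by case: (decomposition_linear a f g Oz).
have [C C0 hC] := adj_bounded hG.
have [D D0 hD] := adj_bounded (adj_gaugeA Oz).
suff [dg Eg] : dom E g /\ f + z *: g - G (A z f) = E g.
  have [|//] := decomposition_unique (f := f) (x := A z f) Oz dg.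
  by rewrite -Eg; vector_ring.
apply: op_closed => e e0.
have K0 : 0 <= nrm z + C * D by rewrite addr_ge0 ?nrm_ge0// mulr_ge0.
have K1 : 0 < 1 + (nrm z + C * D) by rewrite ltr_pwDl.
have [u [uf ug]] := h _ (divr_gt0 e0 K1).
set d := e / _ in uf ug.
have de : d <= e.
  by rewrite /d ler_pdivrMr// ler_peMr ?(ltW e0)// lerDl.
exists (tau z u); first exact: tau_dom.
split; first exact: lt_le_trans ug de.
have lA := adj_linear (adj_gaugeA Oz).
have -> : E (tau z u) - (f + z *: g - G (A z f)) =
    (u - f) + (z *: (tau z u - g) - G (A z (u - f))).
  by rewrite E_tau// (linearB_op lA) (linearB_op lG); vector_ring.
apply: le_lt_trans (nrmD _ _) _.
have -> : e = d + (nrm z * d + C * D * d).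
  by rewrite -mulrDl -{1}[d]mul1r -mulrDl mulrC divfK// gt_eqF.
apply: ltr_leD => //; apply: le_trans (nrmB _ _) _; apply: lerD.
  by rewrite nrmZ ler_wpM2l ?nrm_ge0// ltW.
apply: le_trans (hC _) _; rewrite -mulrA ler_wpM2l//.
by apply: le_trans (hD _) _; rewrite ler_wpM2l// ltW.
Qed.

Definition gaugeB' z u := ((pi : R)%:C%C * 'i)^-1^* *: adjoint (tau z) (G u).

Lemma adj_gaugeB z : Omega z -> adj (B z) (gaugeB' z).
Proof.
move=> Oz u v; rewrite /B /gaugeB' hdotZl hdotZr conjCK (adj_sym hG).
by rewrite (adj_tauY Oz).
Qed.

Definition gauge z f : hsum X X := (A z f, B z f).

(** With h = tau(w) f one has f = (E - z) h + (z - w) h + G A(w) f; decomposing (z - w) h at z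
    completes this to the decomposition of f at z. *)
Lemma tau_gaugeA_diff z w f : Omega z -> Omega w ->
  tau z f = tau w f + (z - w) *: tau z (tau w f) /\
  A z f = A w f + (z - w) *: A z (tau w f).
Proof.
move=> Oz Ow; have [[dom0 domP] linE] := Elin.
set h := tau w f; apply: decomposition_unique => //.
  by rewrite addrC; apply: domP; exact: tau_dom.
rewrite addrC [h + _]addrC linE; [|exact: tau_dom..].
rewrite !E_tau// -/h [A w f + _]addrC lG.
by vector_ring.
Qed.

Lemma gauge_diff z w : Omega z -> Omega w -> forall f,
  gauge z f - gauge w f = (z - w) *: gauge z (tau w f).
Proof.
move=> Oz Ow f; have [h1 h2] := tau_gaugeA_diff f Oz Ow.
have lG' := adj_linear (adj_sym hG).
apply: (congr2 pair) => /=; first by rewrite h2 addrC addKr.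
by rewrite /B {1}h1 (linearD_op lG') (linearZ_op lG') scalerDr addrC addKr !scalerA mulrC.
Qed.

Lemma conj_pii : ((pi : R)%:C%C * 'i : R[i])^* = - ((pi : R)%:C%C * 'i).
Proof. by rewrite rmorphM/= conj_realC conjCi mulrN. Qed.

Lemma pii_neq0 : (pi : R)%:C%C * 'i != 0 :> R[i].
Proof.
rewrite mulf_neq0 ?neq0Ci//; apply/eqP => /complexI/eqP.
by rewrite gt_eqF// pi_gt0.
Qed.

(** This is the symmetry relation for tau(z) f and tau(w) g after E is eliminated by [E_tau]; the
    factor 1/(pi i) in [B] cancels against the one in front. *)
Lemma gauge_deBranges z w : Omega z -> Omega w -> forall f g,
  '[f, tau w g] - '[tau z f, g] + (z - w^*) * '[tau z f, tau w g] =
  - ((pi : R)%:C%C * 'i) * '[J1 (gauge z f), gauge w g].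
Proof.
move=> Oz Ow f g; rewrite hdot_pair/= /B hdotZl hdotZr (adj_sym hG) -hG.
have := Esym (tau_dom f Oz) (tau_dom g Ow); rewrite !E_tau//.
rewrite !hdotBl !hdotBr !hdotDl !hdotDr hdotZl hdotZr => h.
have p0 := pii_neq0; rewrite fmorphV/= conj_pii.
rewrite mulrDr !mulrA !mulNr mulfV// invrN mulrN mulfV// mulN1r opprK mul1r.
apply/eqP; rewrite -subr_eq0; apply/eqP.
move/eqP: h; rewrite -subr_eq0 => /eqP h; rewrite -[RHS]h; ring.
Qed.

Lemma gaugeA_G z x : Omega z -> A z (G x) = x.
Proof.
move=> Oz; have [[dom0 domP] linE] := Elin.
have E0 : E 0 = 0.
  by have := linE (-1) 0 0 dom0 dom0; rewrite scaler0 addr0 scaleN1r addNr.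
have [|] := decomposition_unique (f := G x) (x := x) Oz dom0; last by [].
by rewrite E0 scaler0 subr0 add0r.
Qed.

(** A(z) G = I dualizes to G^* A(z)^* = I, so A(z)^* has a bounded left inverse. *)
Lemma gaugeA_coercive z : Omega z ->
  exists2 d : R, 0 < d & forall u, d * nrm u <= nrm (adjoint (A z) u).
Proof.
move=> Oz; have [C C0 hC] := adj_bounded (adj_sym hG).
have C1 : 0 < C + 1 by rewrite ltr_wpDl.
exists (C + 1)^-1; first by rewrite invr_gt0.
move=> u; rewrite ler_pdivrMl//.
have {1}-> : u = adjoint G (adjoint (A z) u).
  by apply: hdot_inj => v; rewrite -hG -(adj_gaugeA Oz) gaugeA_G.
by apply: le_trans (hC _) _; rewrite ler_wpM2r ?nrm_ge0// lerDl.
Qed.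

Lemma adj_gauge z : Omega z ->
  adj (gauge z) (fun u : hsum X X => adjoint (A z) u.1 + gaugeB' z u.2).
Proof. by move=> Oz; apply: (adj_Gam_pair adj_gaugeA adj_gaugeB). Qed.

(** Gamma(w) f = Gamma(z) f + Gamma(w) (w - z) tau(z) f, and the radius is chosen so that (w - z)
    tau(z) has norm at most 1/2. *)
Lemma gauge_locally_bounded z : Omega z -> exists d C : R,
  [/\ 0 < d, 0 <= C & forall w, Omega w -> nrm (w - z) < d ->
    forall f, nrm (gauge w f) <= C * nrm f].
Proof.
move=> Oz; have [C C0 hC] := adj_bounded (adj_gauge Oz).
have [T T0 hT] := adj_bounded (adj_tauY Oz).
have T1 : 0 < T + 1 by rewrite ltr_wpDl.
exists (2^-1 / (T + 1)), (2 * C); split.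
- by rewrite divr_gt0// invr_gt0.
- by rewrite mulr_ge0.
move=> w Ow wz; have [c c0 hc] := adj_bounded (adj_gauge Ow).
apply: (@self_improving_bound _ _ _ _ (fun f => (w - z) *: tau z f) C c) => // f.
  rewrite (linearZ_op (adj_linear (adj_gauge Ow))) -gauge_diff//.
  rewrite -{1}[gauge w f](subrK (gauge z f)) addrC; apply: le_trans (nrmD _ _) _.
  by rewrite lerD2r.
rewrite nrmZ; apply: (@le_trans _ _ (nrm (w - z) * (T + 1) * nrm f)).
  rewrite -mulrA ler_wpM2l ?nrm_ge0//; apply: le_trans (hT _) _.
  by rewrite ler_wpM2r ?nrm_ge0// lerDl.
by rewrite ler_wpM2r ?nrm_ge0// -ler_pdivlMr// ltW.
Qed.

Lemma gaugeA_locally_bounded z : Omega z -> exists d C : R,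
  [/\ 0 < d, 0 <= C & forall w, Omega w -> nrm (w - z) < d ->
    forall f, nrm (A w f) <= C * nrm f].
Proof.
move=> /gauge_locally_bounded[d [C [d0 C0 h]]]; exists d, C; split=> // w Ow wz f.
by apply: le_trans (h w Ow wz f); exact: (nrm_fst (gauge w f)).
Qed.


Hypotheses (Omega0 : Omega !=set0)
  (Omega_ball : forall z, Omega z ->
    exists2 r : R, 0 < r & forall w, nrm (w - z) < r -> Omega w)
  (Omega_sym : forall z, Omega z -> Omega z^*).

(** At z = w + t with small real t, [tau_gaugeA_diff] reduces [A w f] to - t A(z) tau(w) f, which
    tends to 0 by local boundedness. *)
Lemma gaugeA_limit w f : Omega w ->
  (forall z, Omega z -> z != w -> A z f = 0) -> A w f = 0.
Proof.
move=> Ow h; have [d [C [d0 C0 hC]]] := gaugeA_locally_bounded Ow.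
have [r r0 hr] := Omega_ball Ow.
apply: nrm_eq0; apply/eqP; rewrite eq_le nrm_ge0 andbT.
apply: eps_le => e e0; rewrite add0r.
pose k := C * nrm (tau w f); have k0 : 0 <= k by rewrite mulr_ge0 ?nrm_ge0.
have k1 : 0 < k + 1 by rewrite ltr_wpDl.
pose t := Num.min (Num.min r d / 2) (e / (k + 1)).
have m0 : 0 < Num.min r d by rewrite lt_min r0.
have t0 : 0 < t by rewrite lt_min !divr_gt0.
have tm : t < Num.min r d.
  apply: (@le_lt_trans _ _ (Num.min r d / 2)); first by rewrite ge_min lexx.
  by rewrite gtr_pMr// invf_lt1// ltr1n.
pose z := w + t%:C%C.
have zw : z - w = t%:C%C by rewrite /z addrC addKr.
have nzw : nrm (z - w) = t by rewrite zw nrm_real gtr0_norm.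
move: tm; rewrite lt_min => /andP[tr td].
have Oz : Omega z by apply: hr; rewrite nzw.
have zw0 : z != w.
  by rewrite -subr_eq0 zw; apply/eqP => /complexI/eqP; rewrite gt_eqF.
have [_] := tau_gaugeA_diff f Oz Ow; rewrite h// => /esym/eqP.
rewrite addr_eq0 => /eqP ->; rewrite nrmN nrmZ nzw.
apply: (@le_trans _ _ (t * (k + 1))).
  rewrite ler_pM2l//; apply: le_trans (hC _ Oz _ _) _; first by rewrite nzw.
  by rewrite lerDl.
by rewrite -ler_pdivlMr// ge_min lexx orbT.
Qed.

(** [L] is the intersection of the ranges of E - z over [Omega]. On it tau(w) inverts E - w, so E -
    w0 and E - w0' both map the part of the domain in [L] onto [L]; a symmetric operator with this
    property is self-adjoint. *)
Lemma gaugeA_injective f : (forall z, Omega z -> A z f = 0) -> f = 0.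
Proof.
have [[dom0 domP] linE] := Elin.
pose L := [set f | forall z, Omega z -> A z f = 0].
have domB u v : dom E u -> dom E v -> dom E (u - v).
  by move=> du dv; rewrite addrC -scaleN1r; exact: domP.
have EB u v : dom E u -> dom E v -> E (u - v) = E u - E v.
  by move=> du dv; rewrite addrC -scaleN1r linE// scaleN1r addrC.
have sL : linear_subspace L.
  split=> [z Oz|a u v Lu Lv z Oz].
    exact: linear0_op (adj_linear (adj_gaugeA Oz)).
  by rewrite (adj_linear (adj_gaugeA Oz)) Lu// Lv// scaler0 addr0.
have cL : closed L.
  apply: closedP => x hx z Oz; have [C C0 hC] := adj_bounded (adj_gaugeA Oz).
  have lA := adj_linear (adj_gaugeA Oz).
  apply: nrm_eq0; apply/eqP; rewrite eq_le nrm_ge0 andbT.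
  apply: eps_le => e e0; rewrite add0r.
  have C1 : 0 < C + 1 by rewrite ltr_wpDl.
  have [u Lu ux] := hx _ (divr_gt0 e0 C1).
  have -> : A z x = - A z (u - x) by rewrite (linearB_op lA) Lu// sub0r opprK.
  rewrite nrmN; apply: le_trans (hC _) _.
  apply: (@le_trans _ _ ((C + 1) * nrm (u - x))).
    by rewrite ler_wpM2r ?nrm_ge0// lerDl.
  by rewrite mulrC -ler_pdivlMr// ltW.
have tauL w x : Omega w -> L x -> L (tau w x).
  move=> Ow Lx.
  have h z : Omega z -> z != w -> A z (tau w x) = 0.
    move=> Oz zw; have [_] := tau_gaugeA_diff x Oz Ow; rewrite !Lx// add0r.
    by move=> /esym/eqP; rewrite scaler_eq0 subr_eq0 (negbTE zw) => /eqP.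
  by move=> z Oz; have [->|/h->//] := eqVneq z w; exact: gaugeA_limit.
have resolvent w x : Omega w -> L x -> E (tau w x) = x + w *: tau w x.
  by move=> Ow Lx; rewrite E_tau// Lx// (linear0_op lG) subr0.
have EL g : dom E g -> L g -> L (E g).
  move=> dg Lg z Oz.
  have dh : dom E (z *: tau z g + g) by apply: domP => //; exact: tau_dom.
  have [|_ ->//] := decomposition_unique (f := E g) (x := 0) Oz dh.
  rewrite linE//; last exact: tau_dom.
  by rewrite resolvent// (linear0_op lG); vector_ring.
have [w0 Ow0] := Omega0; have Ow0' := Omega_sym Ow0.
have saL (y y' : X) : L y -> L y' -> (forall x, dom E x -> L x -> '[E x, y] = '[x, y']) ->
    dom E y /\ E y = y'.
  move=> Ly Ly' h; pose n := y' - w0^* *: y.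
  have Ln : L n by apply: (linear_subspaceB sL) => //; exact: (linear_subspaceZ _ sL).
  pose g := tau w0^* n; have dg : dom E g by exact: tau_dom.
  have Lg : L g by exact: tauL.
  have Eg : E g = n + w0^* *: g by exact: resolvent.
  (* [y - g] is orthogonal to the image of E - w0 on [L], which is all of [L], hence to itself. *)
  have yg : y = g.
    apply/eqP; rewrite -subr_eq0; apply/eqP.
    have Lyg : L (y - g) by exact: (linear_subspaceB sL).
    pose x := tau w0 (y - g); have dx : dom E x by exact: tau_dom.
    have Lx : L x by exact: tauL.
    have xE : y - g = E x - w0 *: x by rewrite resolvent//; vector_ring.
    apply: nrm_eq0; apply/eqP; rewrite -sqrf_eq0; apply/eqP/complexI.
    rewrite -hdotxx {1}xE hdotBl hdotZl !hdotBr h// (Esym dx dg) Eg.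
    by rewrite /n !(hdotDr, hdotNr, hdotZr) conjCK rmorph0; ring.
  by rewrite yg; split=> //; rewrite Eg /n -yg subrK.
have L0 : L = [set 0].
  apply: Esimple.
    split=> // g dg; have [u Lu hu] := subspace_projection g sL cL.
    have [u' Lu' hu'] := subspace_projection (E g) sL cL.
    (* The projections of [g] and [E g] satisfy the defining relation of the adjoint of E on [L], so
       self-adjointness yields that [u] is in the domain. *)
    have [du Eu] : dom E u /\ E u = u'.
      apply: saL => // x dx Lx.
      have h1 : '[E x, g - u] = 0 by rewrite hdotC hu ?conjC0//; exact: EL.
      have h2 : '[x, E g - u'] = 0 by rewrite hdotC hu' ?conjC0.
      move: h1 h2; rewrite !hdotBr => /eqP; rewrite subr_eq0 => /eqP <-.
      by rewrite Esym// => /eqP; rewrite subr_eq0 => /eqP.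
    exists u, (g - u); split.
    - by rewrite addrC subrK.
    - by [].
    - by split; [move=> x Lx; rewrite hdotC hu// conjC0|exact: domB].
    - by rewrite Eu.
    - by move=> x Lx; rewrite EB// Eu hdotC hu'// conjC0.
  split=> [x Lx|y y' Ly Ly']; last first.
    split; first exact: saL.
    by move=> [dy <-] x dx Lx; rewrite Esym.
  pose S := closure (dom E `&` L).
  have sD : linear_subspace (dom E `&` L).
    split; first by split; [|exact: sL.1].
    by move=> a u v [du Lu] [dv Lv]; split; [exact: domP|exact: sL.2].
  have sS : linear_subspace S := closure_subspace sD.
  have SL (y : X) : S y -> L y.
    by rewrite [L](closure_id _).1//; apply: closure_subset => u [].
  have [y Sy hy] := subspace_projection x sS (@closed_closure _ _).
  suff /eqP : x - y = 0 by rewrite subr_eq0 => /eqP ->.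
  have Lxy : L (x - y) by apply: (linear_subspaceB sL) => //; exact: SL.
  pose m := tau w0 (x - y); have dm : dom E m by exact: tau_dom.
  have Lm : L m by exact: tauL.
  suff m0 : m = 0.
    have := resolvent w0 (x - y) Ow0 Lxy; rewrite -/m m0 scaler0 addr0 => <-.
    by have := linE (-1) 0 0 dom0 dom0; rewrite scaler0 addr0 scaleN1r addNr.
  apply: nrm_eq0; apply/eqP; rewrite -sqrf_eq0; apply/eqP/complexI.
  (* As m = (E - w0') v, symmetry moves E - w0 onto [m] and gives |m|^2 = <x - y, v>, where [v] is
     in the space to which [x - y] is orthogonal. *)
  rewrite -hdotxx; pose v := tau w0^* m.
  have dv : dom E v by exact: tau_dom.
  have Lv : L v by exact: tauL.
  have mE : m = E v - w0^* *: v by rewrite resolvent//; vector_ring.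
  rewrite {2}mE hdotBr hdotZr conjCK -Esym// resolvent// -/m hdotDl hdotZl addrK.
  by apply: hy; exact: subset_closure.
by move=> fA; have : L f by []; rewrite L0.
Qed.

End GaugeModel.

(** * The space H(U) *)

Section FunctionSpaceFacts.
Variable R : realType.
Local Notation C := (R[i])^o.

Lemma open_ball (Omega : set C) z : open Omega -> Omega z ->
  exists2 r : R, 0 < r & forall w : C, nrm (w - z) < r -> Omega w.
Proof.
by move=> Oo Oz; apply/nbhs_nrmP; apply: open_nbhs_nbhs.
Qed.

Lemma valL_E (Omega : set C) (Z : lmodType R[i]) (Phi : C -> Z) w : Omega w ->
  'valL_0 (fun x : Omega => Phi (val x)) w = Phi w.
Proof.
move=> Ow; pose x : Omega := SigSub (mem_set Ow).
have -> : w = val x by [].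
by have := congr1 (fun F => F x) (valLK (0 : Z) (fun x : Omega => Phi (val x))).
Qed.

Lemma valL_derive (Omega : set C) (Z : normedModType R[i]) (Phi : C -> Z) z L :
  open Omega -> Omega z ->
  (exists d c : R, [/\ 0 < d, 0 <= c & forall w, Omega w -> nrm (w - z) < d ->
    nrm (Phi w - Phi z - (w - z) *: L) <= c * nrm (w - z) ^+ 2]) ->
  derivable ('valL_0 (fun x : Omega => Phi (val x)) : C -> Z) z 1 /\
  'D_1 ('valL_0 (fun x : Omega => Phi (val x)) : C -> Z) z = L.
Proof.
move=> Oo Oz [d [c [d0 c0 h]]]; set F := 'valL_0 _.
have [r r0 hr] := open_ball Oo Oz.
have lim : (fun t : C => t^-1 *: (F (t *: 1 + z) - F z)) @ (0 : C)^' --> L.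
  apply/cvgrPdist_lt => e e0.
  have eE : e = (complex.Re e)%:C%C by rewrite RRe_real// gtr0_real.
  have e1 : 0 < complex.Re e by rewrite -ltcR -eE.
  have c1 : 0 < c + 1 by rewrite ltr_wpDl.
  apply/nbhs_nrmP; exists (Num.min (Num.min r d) (complex.Re e / (c + 1))).
    by rewrite !lt_min r0 d0 divr_gt0.
  move=> t; rewrite subr0 !lt_min => /andP[/andP[tr td] te] /= t0.
  have tz : t *: 1 + z - z = t by rewrite addrK /GRing.scale/= mulr1.
  have Otz : Omega (t *: 1 + z) by apply: hr; rewrite tz.
  rewrite eE nrmE ltcR /F !valL_E//.
  have n0 : 0 < nrm t by exact: nrm_neq0.
  have := h _ Otz; rewrite tz => /(_ td) h1.
  rewrite nrmBC.
  have -> : t^-1 *: (Phi (t *: 1 + z) - Phi z) - L =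
      t^-1 *: (Phi (t *: 1 + z) - Phi z - t *: L).
    by rewrite [RHS]scalerBr scalerA mulVf// scale1r.
  rewrite nrmZ nrmV mulrC ltr_pdivrMr//; apply: le_lt_trans h1 _.
  rewrite expr2 mulrA ltr_pM2r//.
  apply: (@le_lt_trans _ _ ((c + 1) * nrm t)).
    by rewrite ler_wpM2r ?nrm_ge0// lerDl.
  by rewrite mulrC -ltr_pdivlMr.
split; first by apply/cvg_ex; exists L.
by apply: cvg_lim => //; exact: norm_hausdorff.
Qed.

Section ImageSpace.
Variables (T : Type) (X K : hilbertType R) (c : R) (Phi : X -> T -> K).
Hypotheses (c0 : 0 < c) (lPhi : linear Phi) (iPhi : injective Phi).

Lemma image_fdot f g :
  fdot (image_space c%:C%C Phi) (Phi f) (Phi g) = c%:C%C * '[f, g].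
Proof.
rewrite /=; congr (_ * '[_, _]).
  by case: xgetP => [x _ /iPhi//|/(_ f)[]].
by case: xgetP => [x _ /iPhi//|/(_ g)[]].
Qed.

Lemma image_fnorm f :
  fnorm (image_space c%:C%C Phi) (Phi f) = (Num.sqrt c * nrm f)%:C%C.
Proof.
rewrite /fnorm image_fdot hdotxx -rmorphM/=.
have -> : c * nrm f ^+ 2 = (Num.sqrt c * nrm f) ^+ 2.
  by rewrite exprMn sqr_sqrtr// ltW.
by rewrite rmorphXn/= sqrCK// ler0c mulr_ge0 ?sqrtr_ge0 ?nrm_ge0.
Qed.

Lemma image_space_hilbert : is_hilbert (image_space c%:C%C Phi).
Proof.
have s0 : 0 < Num.sqrt c by rewrite sqrtr_gt0.
split.
- split; first by exists 0 => //; exact: linear0_op.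
  by move=> a _ _ [f _ <-] [g _ <-]; exists (a *: f + g) => //; exact: lPhi.
- move=> a _ _ _ [f _ <-] [g _ <-] [h _ <-].
  by rewrite -lPhi !image_fdot hdotDl hdotZl; ring.
- move=> _ _ [f _ <-] [g _ <-].
  by rewrite !image_fdot rmorphM/= conj_realC -hdotC.
- move=> _ [f _ <-] f0; rewrite image_fdot hdotxx -rmorphM ltcR mulr_gt0//.
  rewrite exprn_gt0//; apply: nrm_neq0; apply: contra_notN f0 => /eqP ->.
  exact: linear0_op.
move=> u uP cu; have /choice[x xE] n : exists f, Phi f = u n.
  by have [f _ fE] := uP n; exists f.
have xB m y : u m - Phi y = Phi (x m - y).
  by rewrite (linearB_op lPhi) xE.
have [l xl] : exists l, lim_to x l.
  apply: complete_seq => e e0.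
  have [|N hN] := cu (Num.sqrt c * e)%:C%C; first by rewrite ltcR mulr_gt0.
  exists N => m n Nm Nn; have := hN m n Nm Nn.
  by rewrite -(xE n) xB image_fnorm ltcR ltr_pM2l.
exists (Phi l); first by exists l.
move=> e e0; have eE : e = (complex.Re e)%:C%C by rewrite RRe_real// gtr0_real.
have e1 : 0 < complex.Re e by rewrite -ltcR -eE.
have [N hN] := xl _ (divr_gt0 e1 s0); exists N => n Nn.
by rewrite xB image_fnorm eE ltcR mulrC -ltr_pdivlMr// hN.
Qed.

End ImageSpace.
End FunctionSpaceFacts.

(** * Derivatives in the operator norm *)

Section OperatorDerivative.
Variables (R : realType) (K : hilbertType R).
Local Notation C := (R[i])^o.
Implicit Types (U : C -> K -> K) (z : C) (L : K -> K).

Lemma is_op_deriveP U z L : is_op_derive U z L <-> bounded_op L /\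
  forall e : R, 0 < e -> exists2 d : R, 0 < d & forall t : C, t != 0 -> nrm t < d ->
    forall u, nrm (t^-1 *: (U (t + z) u - U z u) - L u) <= e * nrm u.
Proof.
split=> -[bL h]; split=> // e e0.
  have /nbhs_nrmP[d d0 hd] := h e%:C%C ltac:(by rewrite ltcR).
  exists d => // t t0 td u; have := hd t; rewrite subr0 => /(_ td t0 u).
  by rewrite !nrmE -rmorphM lecR.
have eE : e = (complex.Re e)%:C%C by rewrite RRe_real// gtr0_real.
have e1 : 0 < complex.Re e by rewrite -ltcR -eE.
have [d d0 hd] := h _ e1; apply/nbhs_nrmP; exists d => // t.
rewrite subr0 => td t0 u; rewrite eE !nrmE -rmorphM lecR; exact: hd.
Qed.

(** A derivative known to exist in norm may be evaluated vector by vector; this gives its uniqueness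
    and the diagonal values of the kernel. *)
Lemma op_derive_pointwise U z L y v : is_op_derive U z L ->
  (forall e : R, 0 < e -> exists2 d : R, 0 < d & forall t : C, t != 0 -> nrm t < d ->
    nrm (t^-1 *: (U (t + z) y - U z y) - v) <= e) -> L y = v.
Proof.
move=> /is_op_deriveP[_ hL] hv; apply/eqP; rewrite -subr_eq0; apply/eqP/nrm_eq0/eqP.
rewrite eq_le nrm_ge0 andbT; apply: eps_le => e e0; rewrite add0r.
have y1 : 0 < nrm y + 1 by rewrite ltr_wpDl ?nrm_ge0.
have e2 : 0 < e / 2 by rewrite divr_gt0.
have [d1 d10 h1] := hL _ (divr_gt0 e2 y1).
have [d2 d20 h2] := hv _ e2.
have m0 : 0 < Num.min d1 d2 by rewrite lt_min d10.
pose t : C := (Num.min d1 d2 / 2)%:C%C.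
have nt : nrm t < Num.min d1 d2.
  by rewrite nrm_real gtr0_norm ?divr_gt0// gtr_pMr// invf_lt1// ltr1n.
have t0 : t != 0.
  by apply/eqP => /complexI/eqP; rewrite gt_eqF// divr_gt0.
move: nt; rewrite lt_min => /andP[t1 t2].
apply: le_trans (nrm_triangle (t^-1 *: (U (t + z) y - U z y)) _ _) _.
rewrite nrmBC (splitr e) lerD//; last exact: h2.
apply: le_trans (h1 t t0 t1 y) _.
by rewrite mulrAC ler_pdivrMr// ler_pM2l// lerDl.
Qed.

Lemma op_derive_eq U z L : is_op_derive U z L -> op_derive U z = L.
Proof.
move=> hL; rewrite /op_derive; case: xgetP => [L' _ hL'|/(_ L)//].
apply/funext => y; apply: (op_derive_pointwise hL') => e e0.
have y1 : 0 < nrm y + 1 by rewrite ltr_wpDl ?nrm_ge0.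
have /is_op_deriveP[_ h] := hL; have [d d0 hd] := h _ (divr_gt0 e0 y1).
exists d => // t t0 td; apply: le_trans (hd t t0 td y) _.
by rewrite mulrAC ler_pdivrMr// ler_pM2l// lerDl.
Qed.

End OperatorDerivative.

Section HSpace.
Variables (R : realType) (X : hilbertType R).
Local Notation C := (R[i])^o.
Let K := hsum X X.
Let J : K -> K := @J1 R X.
Variables (Omega : set C) (A A' B B' tau tau' : R[i] -> X -> X).
Let k : R[i] := (pi : R)%:C%C * 'i.
Let Gam z f : K := (A z f, B z f).
Let Gam' z (u : K) : X := A' z u.1 + B' z u.2.
Hypotheses (Omega0 : Omega !=set0) (Omega_open : open Omega)
  (Omega_sym : forall z, Omega z -> Omega z^*).
Hypothesis adj_A : forall z, Omega z -> adj (A z) (A' z).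
Hypothesis adj_B : forall z, Omega z -> adj (B z) (B' z).
Hypothesis adj_tau : forall z, Omega z -> adj (tau z) (tau' z).
Hypothesis Gam_diff : forall z w, Omega z -> Omega w -> forall f,
  Gam z f - Gam w f = (z - w) *: Gam z (tau w f).
Hypothesis deBranges : forall z w, Omega z -> Omega w -> forall f g,
  '[f, tau w g] - '[tau z f, g] + (z - w^*) * '[tau z f, tau w g] =
  - k * '[J (Gam z f), Gam w g].
Hypothesis A_coercive : forall z, Omega z ->
  exists2 d : R, 0 < d & forall u, d * nrm u <= nrm (A' z u).
Hypothesis Gam_locally_bounded : forall z, Omega z -> exists d c : R,
  [/\ 0 < d, 0 <= c & forall w, Omega w -> nrm (w - z) < d ->
    forall f, nrm (Gam w f) <= c * nrm f].
Hypothesis Xinf : ~ finite_dim [set: X].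
Hypothesis Gam_inj : forall f, (forall z, Omega z -> Gam z f = 0) -> f = 0.

Let N z w : K -> K := transfer Gam Gam' J k z w.
Let hG z : Omega z -> adj (Gam z) (Gam' z) := adj_Gam_pair adj_A adj_B (z := z).
Let JK : involutive J. Proof. by case. Qed.

Let conj_k : k^* = - k := conj_pii R.
Let k0 : k != 0 := pii_neq0 R.

Let adj_N z w (Oz : Omega z) (Ow : Omega w) : adj (N z w) (N w z) :=
  adj_transfer hG (@adj_J1 R X) conj_k Oz Ow.

Let Ncomp z m w : Omega z -> Omega m -> Omega w -> forall u,
  N z m (J (N m^* w u)) = N z w u :=
  transfer_comp Omega_sym hG adj_tau (@adj_J1 R X) JK Gam_diff deBranges
    (z := z) (m := m) (w := w).

Definition evaluation (f : X) : Omega -> K := fun x => (A (val x) f, B (val x) f).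

Lemma evaluation_linear : linear evaluation.
Proof.
move=> a f g; apply/funext => x; have Ox : Omega (val x) := set_valP x.
exact: (adj_linear (hG Ox)).
Qed.

Lemma evaluation_injective : injective evaluation.
Proof.
move=> f g fg; apply/eqP; rewrite -subr_eq0; apply/eqP/Gam_inj => z Oz.
rewrite (linearB_op (adj_linear (hG Oz))); apply/eqP; rewrite subr_eq0; apply/eqP.
have := congr1 (fun F => F (SigSub (mem_set Oz))) fg.
by rewrite /evaluation.
Qed.

(** Using [Gam_diff] twice exhibits the remainder (w - z)^2 Gamma(w) tau(z)^2 f. *)
Lemma Gam_derive z f : Omega z ->
  derivable ('valL_0 (fun x : Omega => Gam (val x) f) : C -> K) z 1 /\
  'D_1 ('valL_0 (fun x : Omega => Gam (val x) f) : C -> K) z = Gam z (tau z f).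
Proof.
move=> Oz; apply: (@valL_derive R Omega K (Gam^~ f)) => //.
have [d [c [d0 c0 hc]]] := Gam_locally_bounded Oz.
exists d, (c * nrm (tau z (tau z f))); split=> //.
  by rewrite mulr_ge0 ?nrm_ge0.
move=> w Ow wz; rewrite (Gam_diff Ow Oz) -scalerBr (Gam_diff Ow Oz).
rewrite scalerA nrmZ nrmM -expr2 mulrC ler_wpM2r ?sqr_ge0//.
exact: hc.
Qed.

Lemma Im_add_i (z : R[i]) (s : R) : complex.Im (z + s%:C%C * 'i) = complex.Im z + s.
Proof. by rewrite -complexiE; case: z => x y /=; rewrite mulr1 mul0r addr0. Qed.

Lemma exists_upper_half_plane : exists2 b, Omega b & 0 < complex.Im b.
Proof.
have [z Oz] := Omega0; have [i0|i0|i0] := ltgtP 0 (complex.Im z).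
- by exists z.
- exists z^*; first exact: Omega_sym.
  have -> : complex.Im z^* = - complex.Im z by case: z {Oz i0}.
  by rewrite oppr_gt0.
- have [r r0 hr] := open_ball Omega_open Oz.
  have r2 : 0 < r / 2 by rewrite divr_gt0.
  exists (z + (r / 2)%:C%C * 'i).
    apply: hr; rewrite addrC addKr nrmM nrm_real gtr0_norm//.
    have -> : nrm ('i : R[i]) = 1 by rewrite /nrm normCi.
    by rewrite mulr1 gtr_pMr// invf_lt1// ltr1n.
  by rewrite Im_add_i -i0 add0r.
Qed.

Lemma conj_sub (b : R[i]) : b - b^* = (complex.Im b *+ 2)%:C%C * 'i.
Proof. by rewrite subcJ -complexiE raddfMn/= mulr_natl. Qed.

Lemma exists_J_structure : exists b S S', [/\ Omega b, adj S S',
  forall u, S' (N b b (S u)) = J u,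
  forall u, S (J (S' u)) = J (N b^* b^* (J u)) &
  forall z, Omega z -> ~ tot_bounded (fun u => u - N z b (S u))].
Proof.
have [b Ob b0] := exists_upper_half_plane.
have c0 : 0 < pi * (complex.Im b *+ 2) :> R by rewrite mulr_gt0 ?pi_gt0// mulrn_wgt0.
(* (pi i)(2 i Im b) = - 2 pi Im b: the upper half plane is what makes the first block of M
   negative. *)
have kb : k * (b - b^*) = - (pi * (complex.Im b *+ 2))%:C%C.
  by rewrite conj_sub /k mulrACA -expr2 sqrCi mulrN1 rmorphM.
have [S [S' [hS SMS SJS]]] := J_congruence Omega_sym adj_A adj_B adj_tau conj_k
  Gam_diff deBranges A_coercive Ob c0 kb.
have A_loc z : Omega z -> exists d c : R,
    [/\ 0 < d, 0 <= c & forall w, Omega w -> nrm (w - z) < d ->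
    forall f, nrm (A w f) <= c * nrm f].
  move=> /Gam_locally_bounded[d [c [d0 c00 h]]]; exists d, c; split=> // w Ow wz f.
  by apply: le_trans (h w Ow wz f); exact: (nrm_fst (Gam w f)).
have [t t0 ht] := exists_good_dilation Omega_sym adj_A adj_B adj_tau conj_k k0
  Gam_diff deBranges A_coercive A_loc Xinf Ob hS SJS.
have dJd u : dilation t (J (dilation t u)) = J u.
  rewrite /dilation /J /J1/= !scalerA -!rmorphM/= mulfV ?mulVf ?gt_eqF//.
  by rewrite !scale1r.
exists b, (fun u => S (dilation t u)), (fun u => dilation t (S' u)); split=> //.
- by move=> u v; rewrite hS adj_dilation.
- by move=> u; rewrite [S' _]SMS dJd.
- by move=> u; rewrite dJd SJS.
Qed.

Lemma signature_J1 : signature_op J.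
Proof.
have aJ : adjoint J = J := adj_adjoint (@adj_J1 R X).
split; rewrite ?aJ//; exact: adj_bounded_op (@adj_J1 R X).
Qed.

Section Structure.
Variables (b : R[i]) (S S' : K -> K).
Hypotheses (Ob : Omega b) (hS : adj S S').
Hypothesis SMS : forall u, S' (N b b (S u)) = J u.
Hypothesis SJS : forall u, S (J (S' u)) = J (N b^* b^* (J u)).
Hypothesis noncompact : forall z, Omega z -> ~ tot_bounded (fun u => u - N z b (S u)).

Let U (z : C) (u : K) : K := N z b (S u).
Let U' (z : C) (u : K) : K := S' (N b z u).

Let hU z : Omega z -> adj (U z) (U' z).
Proof. by move=> Oz u v; rewrite /U /U' adj_N// hS. Qed.

Lemma U_adjoint z : Omega z -> adjoint (U z) = U' z.
Proof. by move=> Oz; exact: adj_adjoint (hU Oz). Qed.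

Lemma UJU z w u : Omega z -> Omega w -> U z (J (U' w u)) = N z w u.
Proof.
exact: (transfer_factor Omega_sym adj_A adj_B adj_tau Gam_diff deBranges Ob SJS).
Qed.

Lemma U_J_unitary : J_unitary Omega J U.
Proof.
move=> z u Oz; have Oz' := Omega_sym Oz; rewrite U_adjoint//; split.
  by rewrite UJU// /N transfer_conj.
by rewrite /U /U' -{2}[z]conjCK Ncomp.
Qed.

(** Product rule for k (z - b') Gamma(z), the derivative of Gamma at z being Gamma(z) tau(z). *)
Let dU (z : C) (u : K) : K :=
  k *: (Gam z (Gam' b (S u)) + (z - b^*) *: Gam z (tau z (Gam' b (S u)))).

Lemma U_derive z : Omega z -> is_op_derive U z (dU z).
Proof.
move=> Oz; have lGz := adj_linear (hG Oz); have ltz := adj_linear (adj_tau Oz).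
have lx : linear (fun u => Gam' b (S u)).
  by move=> a u v; rewrite (adj_linear hS) (adj_linear (adj_sym (hG Ob))).
have [D1 D10 hD1] := adj_bounded (adj_sym (hG Ob)).
have [D2 D20 hD2] := adj_bounded hS.
have [T T0 hT] := adj_bounded (adj_tau Oz).
have [G G0 hGz] := adj_bounded (hG Oz).
have xb u : nrm (Gam' b (S u)) <= D1 * D2 * nrm u.
  by apply: le_trans (hD1 _) _; rewrite -mulrA ler_wpM2l.
have P0 : 0 <= D1 * D2 by rewrite mulr_ge0.
apply/is_op_deriveP; split.
  apply: bounded_by_op.
    by move=> a u v; rewrite /dU lx ltz !lGz; vector_ring.
  exists (nrm k * (G + nrm (z - b^*) * (G * T)) * (D1 * D2)).
    by rewrite !mulr_ge0 ?addr_ge0 ?mulr_ge0 ?nrm_ge0.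
  move=> u; rewrite /dU nrmZ -mulrA -[nrm k * _ * _]mulrA ler_wpM2l ?nrm_ge0//.
  apply: le_trans (nrmD _ _) _; rewrite nrmZ mulrDl; apply: lerD.
    apply: le_trans (hGz _) _; rewrite ler_wpM2l//; exact: xb.
  rewrite -[nrm (z - _) * _ * _]mulrA -[G * T * _]mulrA ler_wpM2l ?nrm_ge0//.
  apply: le_trans (hGz _) _; rewrite ler_wpM2l//.
  apply: le_trans (hT _) _; rewrite ler_wpM2l//; exact: xb.
have [r r0 hr] := open_ball Omega_open Oz.
have [d [c [d0 c0 hc]]] := Gam_locally_bounded Oz.
pose M := nrm k * (c * (T + nrm (z - b^*) * (T * T)) * (D1 * D2)).
have M0 : 0 <= M by rewrite !mulr_ge0 ?addr_ge0 ?mulr_ge0 ?nrm_ge0.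
have M1 : 0 < M + 1 by rewrite ltr_wpDl.
move=> e e0; exists (Num.min (Num.min r d) (e / (M + 1))).
  by rewrite !lt_min r0 d0 divr_gt0.
move=> t t0; rewrite !lt_min => /andP[/andP[tr td] te] u.
have tz : t + z - z = t by rewrite addrK.
have Otz : Omega (t + z) by apply: hr; rewrite tz.
set x := Gam' b (S u).
have lGt := adj_linear (hG Otz).
have Gd f : Gam (t + z) f = Gam z f + t *: Gam (t + z) (tau z f).
  by have := Gam_diff Otz Oz f; rewrite tz => <-; rewrite [RHS]addrC subrK.
(* The error of the difference quotient is exactly [t] times an operator that is bounded near [z],
   uniformly in [t]. *)
have -> : t^-1 *: (U (t + z) u - U z u) - dU z u =
    (k * t) *: Gam (t + z) (tau z x + (z - b^*) *: tau z (tau z x)).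
  rewrite /U /N /transfer /dU -/x.
  have -> : J (S u) + (k * (t + z - b^*)) *: Gam (t + z) x -
     (J (S u) + (k * (z - b^*)) *: Gam z x) =
     t *: (k *: Gam (t + z) x) + (k * (z - b^*)) *: (Gam (t + z) x - Gam z x).
    by vector_ring.
  have -> : Gam (t + z) x - Gam z x = t *: Gam (t + z) (tau z x).
    by rewrite Gd [X in X - _]addrC addrK.
  have -> : t *: (k *: Gam (t + z) x) + (k * (z - b^*)) *: (t *: Gam (t + z) (tau z x))
      = t *: (k *: Gam (t + z) x + (k * (z - b^*)) *: Gam (t + z) (tau z x)).
    by vector_ring.
  rewrite scalerA mulVf// scale1r (Gd x) (linearD_op lGt) (linearZ_op lGt) (Gd (tau z x)).
  by vector_ring.
rewrite nrmZ nrmM.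
have h1 : nrm (Gam (t + z) (tau z x + (z - b^*) *: tau z (tau z x))) <=
    c * (T + nrm (z - b^*) * (T * T)) * (D1 * D2) * nrm u.
  apply: le_trans (hc _ Otz _ _) _; first by rewrite tz.
  rewrite -mulrA -[c * _ * _]mulrA ler_wpM2l//; apply: le_trans (nrmD _ _) _.
  have h2 : nrm (tau z x) <= T * (D1 * D2 * nrm u).
    apply: le_trans (hT _) _; rewrite ler_wpM2l//; exact: xb.
  move: h2; set P := D1 * D2; rewrite mulrDl => h2; apply: lerD => //.
  rewrite nrmZ -[nrm (z - _) * _ * _]mulrA -[T * T * _]mulrA ler_wpM2l ?nrm_ge0//.
  by apply: le_trans (hT _) _; rewrite ler_wpM2l.
apply: (@le_trans _ _ (nrm t * (M + 1) * nrm u)).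
  apply: (@le_trans _ _ (nrm t * M * nrm u)).
    rewrite [nrm k * _]mulrC /M -mulrA -[nrm t * _ * _]mulrA ler_wpM2l ?nrm_ge0//.
    by rewrite -[nrm k * _ * _]mulrA ler_wpM2l ?nrm_ge0.
  by rewrite ler_wpM2r ?nrm_ge0// ler_wpM2l ?nrm_ge0// lerDl.
by rewrite ler_wpM2r ?nrm_ge0// -ler_pdivlMr// ltW.
Qed.

(** U(z) J U(w)^* = N(z, w) differs from J by k (z - w') Gamma(z) Gamma(w)^*, and the denominator is
    - 2 k (z - w'). At z = w' the numerator is the derivative of N(., w), which is k Gamma(z)
    Gamma(w)^*, over 2 k. *)
Lemma kernelU_E z w u : Omega z -> Omega w ->
  kernelU J U w z u = 2^-1 *: Gam z (Gam' w u).
Proof.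
move=> Oz Ow; rewrite /kernelU.
have p0 : (pi : R)%:C%C != 0 :> R[i].
  by apply/eqP => /complexI/eqP; rewrite gt_eqF// pi_gt0.
have i0 : 'i != 0 :> R[i] := neq0Ci _.
have coef (p q d : R[i]) : p != 0 -> q != 0 -> d != 0 ->
    (- 2 * p * q * d)^-1 * - (p * q * d) = 2^-1.
  by move=> ? ? ?; field; apply/and3P.
have coef' : (2 * (pi : R)%:C%C * 'i)^-1 * k = 2^-1 :> R[i].
  by rewrite /k -mulrA invfM mulfVK// mulf_neq0.
case: eqVneq => [zw|zw]; last first.
  rewrite U_adjoint// UJU// /N /transfer.
  have -> : J u - (J u + (k * (z - w^*)) *: Gam z (Gam' w u)) =
      - (k * (z - w^*)) *: Gam z (Gam' w u) by vector_ring.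
  rewrite scalerA; congr (_ *: _); rewrite /k.
  have zw0 : z - w^* != 0 by rewrite subr_eq0.
  exact: coef.
have Ow' := Omega_sym Ow.
rewrite (op_derive_eq (U_derive Ow')) U_adjoint//.
suff -> : dU w^* (J (U' w u)) = k *: Gam z (Gam' w u).
  by rewrite scalerA coef'.
apply: (op_derive_pointwise (U_derive Ow')); rewrite -zw => e e0.
have [r r0 hr] := open_ball Omega_open Oz.
have [d [c [d0 c0 hc]]] := Gam_locally_bounded Oz.
set v := Gam' w u; pose M := nrm k * (c * nrm (tau z v)).
have M0 : 0 <= M by rewrite !mulr_ge0 ?nrm_ge0.
have M1 : 0 < M + 1 by rewrite ltr_wpDl.
exists (Num.min (Num.min r d) (e / (M + 1))).
  by rewrite !lt_min r0 d0 divr_gt0.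
move=> t t0; rewrite !lt_min => /andP[/andP[tr td] te].
have tz : t + z - z = t by rewrite addrK.
have Otz : Omega (t + z) by apply: hr; rewrite tz.
have -> : t^-1 *: (U (t + z) (J (U' w u)) - U z (J (U' w u))) - k *: Gam z v =
    (k * t) *: Gam (t + z) (tau z v).
  rewrite !UJU// /N /transfer -/v -zw subrr mulr0 scale0r addr0 tz.
  have -> : J u + (k * t) *: Gam (t + z) v - J u = t *: (k *: Gam (t + z) v).
    by vector_ring.
  by rewrite scalerA mulVf// scale1r -scalerBr (Gam_diff Otz Oz) tz scalerA.
rewrite nrmZ nrmM.
have h1 : nrm (Gam (t + z) (tau z v)) <= c * nrm (tau z v).
  by apply: hc => //; rewrite tz.
apply: (@le_trans _ _ (nrm t * (M + 1))).
  apply: (@le_trans _ _ (nrm t * M)); last by rewrite ler_wpM2l ?nrm_ge0// lerDl.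
  by rewrite [nrm k * _]mulrC /M -mulrA !ler_wpM2l ?nrm_ge0.
by rewrite -ler_pdivlMr// ltW.
Qed.

Lemma hdot_sum_sum n (f g : 'I_n -> X) :
  \sum_(i < n) \sum_(j < n) '[f j, g i] =
  '[\sum_(j < n) f j, \sum_(i < n) g i].
Proof.
rewrite (big_morph (fun y => '[\sum_(j < n) f j, y])
  (fun x y => hdotDr x y _) (hdot0r _)).
apply: eq_bigr => i _.
by rewrite (big_morph (fun x => '[x, g i]) (fun x y => hdotDl x y _) (hdot0l _)).
Qed.

Lemma H_space_is_HU : is_HU J U (image_space 2%:C%C evaluation).
Proof.
have half_real : (2^-1 : R[i])^* = 2^-1 by rewrite fmorphV/= conjC_nat.
split.
- exact: signature_J1.
- split=> z Oz; first exact: adj_bounded_op (hU Oz).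
  by exists (dU z); exact: U_derive.
- exact: U_J_unitary.
- move=> n w u Ow.
  under eq_bigr => i _ do under eq_bigr => j _ do
    rewrite kernelU_E// hdotZl (hG (Ow i)).
  under eq_bigr => i _ do rewrite -mulr_sumr.
  rewrite -mulr_sumr (hdot_sum_sum (fun j => Gam' (w j) (u j))) hdotxx.
  by rewrite mulr_ge0 ?invr_ge0 ?ler0n// ler0c sqr_ge0.
(* The 1/2 of the kernel cancels the 2 of the inner product, so the reproducing property becomes the
   adjoint relation of Gamma(w). *)
have section_E (w : Omega) u :
    section_fun (kernelU J U) (val w) u = evaluation (2^-1 *: Gam' (val w) u).
  apply/funext => z; have Oz : Omega (val z) := set_valP z.
  have Ow : Omega (val w) := set_valP w.
  rewrite /section_fun kernelU_E// -(linearZ_op (adj_linear (hG Oz))) //.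
split.
- apply: image_space_hilbert; first by [].
    exact: evaluation_linear.
  exact: evaluation_injective.
- by move=> _ [f _ <-] z Oz; have [] := Gam_derive f Oz.
- by move=> w u; rewrite section_E; exists (2^-1 *: Gam' (val w) u).
move=> _ w u [f _ <-]; have Ow : Omega (val w) := set_valP w.
rewrite section_E (image_fdot _ evaluation_injective) hdotZr half_real -(hG Ow).
by rewrite rmorph_nat mulrA mulfV ?pnatr_eq0// mul1r.
Qed.

End Structure.

Lemma H_space_is_H0U : is_H0U J (image_space 2%:C%C evaluation).
Proof.
have [b [S [S' [Ob hS SMS SJS nc]]]] := exists_J_structure.
exists (fun z u => N z b (S u)); first exact: (H_space_is_HU Ob hS SMS SJS).
by move=> z Oz /compact_op_tot_bounded; exact: nc.
Qed.

End HSpace.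

(** * The multiplication operator *)

Section MultiplicationOperator.
Variables (R : realType) (X : hilbertType R) (E : operator X X).
Local Notation C := (R[i])^o.
Hypotheses (Elin : linear_op E) (Esimple : simple_op E) (Eclosed : closed_op E)
  (Esym : symmetric_op E).
Variables (Y : set X) (Omega : set C) (G : X -> X).
Hypotheses (Ysub : linear_subspace Y)
  (Omega0 : Omega !=set0) (Omega_open : open Omega)
  (Omega_sym : forall z, Omega z -> Omega z^*)
  (Omega_reg : forall z, Omega z -> regular_point E Y z)
  (Gbounded : bounded_op G) (Ginj : injective G) (Grng : range G = Y).

Let A (z : R[i]) := gaugeA E Y G z.
Let tau (z : R[i]) := tauY E Y z.
Let Omega_ball z (Oz : Omega z) := open_ball Omega_open Oz.
Let decomposition_uniq (z : R[i]) f g x : Omega z -> dom E g ->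
  f = E g - z *: g + G x -> tau z f = g /\ A z f = x :=
  decomposition_unique Elin Esimple Eclosed Esym Ysub Omega_reg Ginj Grng
    (z := z) (f := f) (g := g) (x := x).
Let tauE (z : R[i]) f : Omega z -> dom E (tau z f) /\
    f = E (tau z f) - z *: tau z f + G (A z f) :=
  decomposition Elin Esimple Eclosed Esym Ysub Omega_reg Ginj Grng f (z := z).
Let hA (z : R[i]) : Omega z -> adj (A z) (adjoint (A z)) :=
  adj_gaugeA Elin Esimple Eclosed Esym Ysub Omega_reg Gbounded Ginj Grng (z := z).
Let A_diff (z w : R[i]) f : Omega z -> Omega w ->
  A z f - A w f = (z - w) *: A z (tau w f).
Proof.
move=> Oz Ow; have [_ h] := tau_gaugeA_diff Elin Esimple Eclosed Esym Ysub
  Omega_reg Gbounded Ginj Grng f Oz Ow.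
by rewrite /A h [X in X - _]addrC addrK.
Qed.
Let A_inj f : (forall z, Omega z -> A z f = 0) -> f = 0 :=
  gaugeA_injective Elin Esimple Eclosed Esym Ysub Omega_reg Gbounded Ginj Grng
    Omega0 Omega_ball Omega_sym (f := f).

Lemma fY_injective : injective (@fY R X E Y Omega G).
Proof.
move=> f g fg; apply/eqP; rewrite -subr_eq0; apply/eqP/A_inj => z Oz.
rewrite (linearB_op (adj_linear (hA Oz))); apply/eqP; rewrite subr_eq0; apply/eqP.
exact: (congr1 (fun F => F (SigSub (mem_set Oz))) fg).
Qed.

Lemma spaceN_fdot f g :
  fdot (spaceN E Y Omega G) (fY E Y G f) (fY E Y G g) = '[f, g].
Proof.
have := image_fdot 1 fY_injective f g; rewrite !rmorph1 mul1r => <-.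
by rewrite /spaceN.
Qed.

(** The backward shift is tau(xi) seen through f |-> f_Y: away from xi by the difference identity,
    at xi by its limit. *)
Lemma bshift_fY (xi : Omega) f :
  bshift xi (fY E Y G f) = fY E Y G (tau (val xi) f).
Proof.
apply/funext => z; have Oxi : Omega (val xi) := set_valP xi.
have Oz : Omega (val z) := set_valP z.
rewrite /bshift; case: eqVneq => [zx|zx]; last first.
  rewrite [fY _ _ _ _ z - _]A_diff// scalerA mulVf ?scale1r//.
  by rewrite subr_eq0.
have [_ ->] : derivable ('valL_0 (fun x : Omega => A (val x) f) : C -> X) (val xi) 1 /\
    'D_1 ('valL_0 (fun x : Omega => A (val x) f) : C -> X) (val xi) =
    A (val xi) (tau (val xi) f).
  apply: (@valL_derive R Omega X (A^~ f)) => //.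
  have [d [c [d0 c0 hc]]] := gaugeA_locally_bounded Elin Esimple Eclosed Esym Ysub
    Omega_reg Gbounded Ginj Grng Oxi.
  exists d, (c * nrm (tau (val xi) (tau (val xi) f))); split=> //.
    by rewrite mulr_ge0 ?nrm_ge0.
  move=> w Ow wz; rewrite (A_diff _ Ow Oxi) -scalerBr (A_diff _ Ow Oxi).
  rewrite scalerA nrmZ nrmM -expr2 mulrC ler_wpM2r ?sqr_ge0//.
  exact: hc.
by rewrite /fY zx.
Qed.

Lemma opZ_fY f : opZ E Y G (fY E Y G f) = ftilde (Omega := Omega) E Y G f.
Proof.
apply/funext => xi; rewrite /opZ bshift_fY.
have spec l : '[ftilde E Y G f xi, l] = ((pi : R)%:C%C * 'i)^-1 *
    fdot (spaceN E Y Omega G) (fY E Y G (tau (val xi) f)) (fY E Y G (G l)).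
  rewrite spaceN_fdot /ftilde hdotZl; congr (_ * _).
  exact: (adj_sym (bounded_op_has_adj Gbounded)).
case: xgetP => [v _ hv|/(_ (ftilde E Y G f xi))[]//].
by apply: hdot_injl => l; rewrite hv spec.
Qed.

(** E x = (E - z)(z tau(z) x + x) + G (z A(z) x) is the decomposition of E x at z. *)
Lemma gaugeA_E (z : R[i]) x : Omega z -> dom E x -> A z (E x) = z *: A z x.
Proof.
move=> Oz dx; have [dt _] := tauE x Oz; have [[dom0 domP] linE] := Elin.
have dh : dom E (z *: tau z x + x) by exact: domP.
have [|//] := decomposition_uniq (f := E x) (x := z *: A z x) Oz dh.
have lG := adj_linear (bounded_op_has_adj Gbounded).
rewrite linE// (linearZ_op lG) (E_tau Elin Esimple Eclosed Esym Ysub Omega_reg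
  Ginj Grng x Oz).
by vector_ring.
Qed.

Lemma mulT_fY x : dom E x ->
  mulT (fY (Omega := Omega) E Y G x) = fY E Y G (E x).
Proof.
by move=> dx; apply/funext => z; apply/esym; apply: gaugeA_E => //; exact: set_valP.
Qed.

(** If multiplication sends f_Y to g_Y, then A(z)(g - w f) = (z - w) A(z) f, so tau(w)(g - w f) and
    f have the same transform; by injectivity f is a value of tau(w) and lies in the domain. *)
Lemma domT_fY f : domT E Y G (fY (Omega := Omega) E Y G f) <-> dom E f.
Proof.
split=> [[_ [g _ gE]]|df]; last first.
  by split; [exists f|rewrite mulT_fY//; exists (E f)].
have AE z : Omega z -> A z g = z *: A z f.
  by move=> Oz; exact: (congr1 (fun F => F (SigSub (mem_set Oz))) gE).
have [w Ow] := Omega0.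
have lA z Oz := adj_linear (@hA z Oz).
have Aw z : Omega z -> A z (g - w *: f) = (z - w) *: A z f.
  move=> Oz; rewrite (linearB_op (lA _ Oz)) (linearZ_op (lA _ Oz)) AE//.
  by rewrite scalerBl.
have h z : Omega z -> z != w -> A z (tau w (g - w *: f) - f) = 0.
  move=> Oz zw; have := A_diff (g - w *: f) Oz Ow; rewrite !Aw// subrr scale0r subr0.
  move=> E1; rewrite (linearB_op (lA _ Oz)).
  have zw0 : z - w != 0 by rewrite subr_eq0.
  have := congr1 (fun v => (z - w)^-1 *: v) E1.
  by rewrite !scalerA mulVf// !scale1r => ->; rewrite subrr.
have : tau w (g - w *: f) - f = 0.
  apply: A_inj => z Oz; have [->|/h->//] := eqVneq z w.
  exact: (gaugeA_limit Elin Esimple Eclosed Esym Ysub Omega_reg Gbounded Ginj Grng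
    Omega_ball Ow h).
move/eqP; rewrite subr_eq0 => /eqP <-.
by have [] := tauE (g - w *: f) Ow.
Qed.

Lemma column_linear :
  linear (fun f => column (fY (Omega := Omega) E Y G f) (ftilde E Y G f)).
Proof.
move=> a f g; apply/funext => x; have Ox : Omega (val x) := set_valP x.
exact: (adj_linear (adj_gauge Elin Esimple Eclosed Esym Ysub Omega_reg
  Gbounded Ginj Grng Ox)).
Qed.

Lemma column_injective :
  injective (fun f => column (fY (Omega := Omega) E Y G f) (ftilde E Y G f)).
Proof.
move=> f g /(congr1 (fun F x => (F x).1)) fg; exact: fY_injective.
Qed.

Lemma H3_unitarily_equivalent :
  unitarily_equivalent E (H3 E Y Omega G) (opD E Y Omega G).
Proof.
pose Phi f := column (fY (Omega := Omega) E Y G f) (ftilde E Y G f).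
have lPhi : linear Phi := column_linear.
have [[dom0 domP] linE] := Elin.
have domZ a x : dom E x -> dom E (a *: x).
  by move=> dx; rewrite -[_ *: _]addr0; exact: domP.
have EZ a x : dom E x -> E (a *: x) = a *: E x.
  have E0 : E 0 = 0.
    by have := linE (-1) 0 0 dom0 dom0; rewrite scaler0 addr0 scaleN1r addNr.
  by move=> dx; rewrite -[a *: x]addr0 linE// E0 addr0.
(* The inner product of [H3] is twice that of X, so the unitary map is f |-> Phi(f / sqrt 2). *)
pose r : R[i] := (Num.sqrt 2)%:C%C.
have r2 : r * r = 2.
  by rewrite -rmorphM/= -expr2 sqr_sqrtr// rmorph_nat.
have r0 : r != 0 by apply: contra_eq_neq r2 => ->; rewrite mul0r eq_sym pnatr_eq0.
have rV : (r^-1)^* = r^-1 by rewrite fmorphV/= conj_realC.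
exists (fun f => Phi (r^-1 *: f)); split.
- by move=> a f g; rewrite scalerDr scalerA mulrC -scalerA lPhi.
- apply/seteqP; split=> [_ [f _ <-]|_ [f _ <-]]; first by exists (r^-1 *: f).
  by exists (r *: f) => //; rewrite scalerA mulVf// scale1r.
- move=> x y; have := image_fdot 2 column_injective (r^-1 *: x) (r^-1 *: y).
  rewrite rmorph_nat => ->; rewrite hdotZl hdotZr rV -r2.
  by rewrite !mulrA -[r * r * _]mulrA mulfV// mulr1 mulfV// mul1r.
- apply/seteqP; split=> [_ [f df <-]|_ [f [/domT_fY df ->]]].
    exists (r^-1 *: f); split; first by apply/domT_fY; exact: domZ.
    by rewrite opZ_fY.
  exists (r *: f); first exact: domZ.
  by rewrite scalerA mulVf// scale1r opZ_fY.
- move=> x dx; rewrite /opD/= mulT_fY; last exact: domZ.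
  by rewrite opZ_fY EZ.
Qed.

End MultiplicationOperator.

Theorem theorem3p11 (R : realType) (X : hilbertType R)
  (Xsep : separable_space X) (Xinf : ~ finite_dim [set: X])
  (E : operator X X)
  (Elin : linear_op E) (Esimple : simple_op E) (Eclosed : closed_op E)
  (Edense : dense (dom E)) (Esym : symmetric_op E)
  (Edef : infinite_deficiency E)
  (Y : set X) (Ysub : linear_subspace Y) (Yclosed : closed Y) (Yinf : ~ finite_dim Y)
  (Omega : set (R[i])^o) (Omega0 : Omega !=set0) (Omega_open : open Omega)
  (Omega_sym : forall z, Omega z -> Omega z^*)
  (Omega_reg : forall z, Omega z -> regular_point E Y z)
  (G : X -> X) (Gbounded : bounded_op G) (Ginj : injective G)
  (Grng : range G = Y) :
  is_H0U (@J1 R X) (H3 E Y Omega G) /\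
  ((exists alpha : (R[i])^o,
     [/\ Omega alpha, 0 < 'Im alpha,
         forall w : (R[i])^o, Omega w -> 'Im w < 0 ->
           finite_dim (op_rng E alpha `&` orthc (op_rng E w)) /\
           closed (set_add (op_rng E alpha) (orthc (op_rng E w))) &
         forall w : (R[i])^o, Omega w -> 0 < 'Im w ->
           finite_dim (op_rng E alpha^* `&` orthc (op_rng E w)) /\
           closed (set_add (op_rng E alpha^*) (orthc (op_rng E w)))]) ->
   unitarily_equivalent E (H3 E Y Omega G)
     (opD E Y Omega G)).
Proof.
split; last by move=> _; exact: H3_unitarily_equivalent.
have Omega_ball z (Oz : Omega z) := open_ball Omega_open Oz.
have -> : H3 E Y Omega G =
    image_space (2 : R)%:C%C (evaluation (gaugeA E Y G) (gaugeB E Y G)).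
  by rewrite rmorph_nat.
apply: (H_space_is_H0U Omega0 Omega_open Omega_sym
  (adj_gaugeA Elin Esimple Eclosed Esym Ysub Omega_reg Gbounded Ginj Grng)
  (adj_gaugeB Elin Esimple Eclosed Esym Ysub Omega_reg Gbounded Ginj Grng)
  (adj_tauY Elin Esimple Eclosed Esym Ysub Omega_reg Gbounded Ginj Grng)
  (gauge_diff Elin Esimple Eclosed Esym Ysub Omega_reg Gbounded Ginj Grng)
  (gauge_deBranges Elin Esimple Eclosed Esym Ysub Omega_reg Gbounded Ginj Grng)
  (gaugeA_coercive Elin Esimple Eclosed Esym Ysub Omega_reg Gbounded Ginj Grng)
  (gauge_locally_bounded Elin Esimple Eclosed Esym Ysub Omega_reg Gbounded Ginj Grng)
  Xinf) => f Gf.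
apply: (gaugeA_injective Elin Esimple Eclosed Esym Ysub Omega_reg Gbounded Ginj
  Grng Omega0 Omega_ball Omega_sym) => z Oz.
exact: (congr1 fst (Gf z Oz)).
Qed.
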